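(* Assume the Standing Setting described in the context, and let $\{(\mathbf D^\nu,\mathbf X^\nu)\}_\nu$ be generated by the D$^4$L algorithm from an arbitrary initial point. Then: (a) (Consensus) $\lim_{\nu\to\infty} e^\nu=0$. (b) (Convergence) (i) the sequence $\{(\overline{\mathbf D}^\nu,\mathbf X^\nu)\}_\nu$ is bounded; (ii) $\{U(\overline{\mathbf D}^\nu,\mathbf X^\nu)\}_\nu$ converges to a finite value; (iii) $\lim_{\nu\to\infty}\Delta_X(\overline{\mathbf D}^\nu,\mathbf X^\nu)=0$; (iv) $\liminf_{\nu\to\infty}\Delta_D(\overline{\mathbf D}^\nu,\mathbf X^\nu)=0$. Consequently $\{(\overline{\mathbf D}^\nu,\mathbf X^\nu)\}_\nu$ has at least one limit point that is a stationary solution of Problem (P). (b') If, in addition, every $g_i$ is $\mu_i$-strongly convex (alternative (ii) of (A5) holds for all $i$) and Assumption (T2) holds, then (b) holds and moreover $\lim_{\nu\to\infty}\Delta^\nu=0$, so every limit point of $\{(\overline{\mathbf D}^\nu,\mathbf X^\nu)\}_\nu$ is a stationary solution of (P).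
   Context: Problem (P). Fix positive integers $I,M,K,n_1,\dots,n_I$. Variables: $\mathbf D\in\mathbb R^{M\times K}$ and $\mathbf X_i\in\mathbb R^{K\times n_i}$, $\mathbf X=[\mathbf X_1,\dots,\mathbf X_I]$. Problem (P) is: minimize $U(\mathbf D,\mathbf X)=F(\mathbf D,\mathbf X)+\sum_{i=1}^I g_i(\mathbf X_i)+G(\mathbf D)$, where $F(\mathbf D,\mathbf X)=\sum_{i=1}^I f_i(\mathbf D,\mathbf X_i)$, subject to $\mathbf D\in\mathcal D$, $\mathbf X_i\in\mathcal X_i$, $i=1,\dots,I$. Notation: $\langle\mathbf A,\mathbf B\rangle=\mathrm{tr}(\mathbf A^\top\mathbf B)$, $\|\cdot\|_F$ is the Frobenius norm, $\|\mathbf A\|_{\infty,\infty}=\max_{i,j}|A_{ij}|$; $\nabla_D$, $\nabla_{X_i}$ denote partial gradients arranged as matrices of the shapes of $\mathbf D$, $\mathbf X_i$. Assumption (A): (A1) each $f_i:\mathcal O\times\mathcal O_i\to\mathbb R$ is $C^2$, bounded below, and biconvex (convex in $\mathbf D$ for fixed $\mathbf X_i$ and convex in $\mathbf X_i$ for fixed $\mathbf D$), where $\mathcal O\supseteq\mathcal D$, $\mathcal O_i\supseteq\mathcal X_i$ are open convex sets; (A2) for every $\mathbf D\in\mathcal D$, $\nabla_{X_i}f_i(\mathbf D,\cdot)$ is Lipschitz on $\mathcal X_i$ with constant $L_{\nabla X_i}(\mathbf D)$, and $L_{\nabla X_i}:\mathcal D\to\mathbb R$ is continuous; (A3) $\mathcal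 D$ is nonempty, compact and convex, and each $\mathcal X_i$ is nonempty, closed and convex; (A4) $G:\mathcal O\to\mathbb R$ is convex (possibly nonsmooth); (A5) for each $i$, either (i) $\mathcal X_i$ is compact and $g_i:\mathcal O_i\to\mathbb R$ is convex, or (ii) $g_i$ is $\mu_i$-strongly convex ($\mu_i>0$). Stationarity: $(\mathbf D^*,\mathbf X^* )$ with $\mathbf D^*\in\mathcal D$, $\mathbf X_i^*\in\mathcal X_i$ is a stationary solution of (P) if $\langle\nabla_D F(\mathbf D^*,\mathbf X^* ),\mathbf D-\mathbf D^*\rangle+G(\mathbf D)-G(\mathbf D^* )\ge0$ for all $\mathbf D\in\mathcal D$, and $\langle\nabla_{X_i}f_i(\mathbf D^*,\mathbf X_i^* ),\mathbf X_i-\mathbf X_i^*\rangle+g_i(\mathbf X_i)-g_i(\mathbf X_i^* )\ge0$ for all $\mathbf X_i\in\mathcal X_i$, all $i$. Network: at each time $\nu\in\mathbb N_+$ there is a digraph $\mathcal G^\nu=(\{1,\dots,I\},\mathcal E^\nu)$; $(j,i)\in\mathcal E^\nu$ means a link from $j$ to $i$; $\mathcal N_i^{\rm in}[\nu]=\{j:(j,i)\in\mathcal E^\nu\}\cup\{i\}$. B-strong connectivity: there is an integer $B>0$ such that for all $k\ge0$ the digraph with edge set $\bigcup_{t=kB}^{(k+1)B-1}\mathcal E^t$ is strongly connected. Weights: matrices $\mathbf A^\nu=(a^\nu_{ij})\in\mathbb R^{I\times I}$ with, for some $\kappa>0$, $a^\nu_{ii}\ge\kappa$; $a^\nu_{ij}\ge\kappa$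 if $(j,i)\in\mathcal E^\nu$ and $a^\nu_{ij}=0$ otherwise ($j\ne i$); and $\mathbf 1^\top\mathbf A^\nu=\mathbf 1^\top$. D$^4$L algorithm. Initialize $\phi_i^0=1$, $\mathbf D^0_{(i)}\in\mathcal D$, $\mathbf X_i^0\in\mathcal X_i$, $\boldsymbol\Theta^0_{(i)}=\nabla_Df_i(\mathbf D^0_{(i)},\mathbf X^0_i)$. For $\nu=0,1,\dots$, each agent $i$ computes $\widetilde{\mathbf D}^\nu_{(i)}=\arg\min_{\mathbf D\in\mathcal D}\ \tilde f_i(\mathbf D;\mathbf D^\nu_{(i)},\mathbf X^\nu_i)+\langle I\boldsymbol\Theta^\nu_{(i)}-\nabla_Df_i(\mathbf D^\nu_{(i)},\mathbf X^\nu_i),\mathbf D-\mathbf D^\nu_{(i)}\rangle+G(\mathbf D)$; $\mathbf U^\nu_{(i)}=\mathbf D^\nu_{(i)}+\gamma^\nu(\widetilde{\mathbf D}^\nu_{(i)}-\mathbf D^\nu_{(i)})$; $\mathbf X_i^{\nu+1}=\arg\min_{\mathbf X_i\in\mathcal X_i}\ \tilde h_i(\mathbf X_i;\mathbf U^\nu_{(i)},\mathbf X^\nu_i)+g_i(\mathbf X_i)$; $\phi_i^{\nu+1}=\sum_{j\in\mathcal N_i^{\rm in}[\nu]}a^\nu_{ij}\phi^\nu_j$; $\mathbf D^{\nu+1}_{(i)}=\frac{1}{\phi_i^{\nu+1}}\sum_{j\in\mathcal N_i^{\rm in}[\nu]}a^\nu_{ij}\phi^\nu_j\mathbf U^\nu_{(j)}$;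 $\boldsymbol\Theta^{\nu+1}_{(i)}=\frac{1}{\phi_i^{\nu+1}}\sum_{j\in\mathcal N_i^{\rm in}[\nu]}a^\nu_{ij}\phi^\nu_j\boldsymbol\Theta^\nu_{(j)}+\frac{1}{\phi_i^{\nu+1}}\big(\nabla_Df_i(\mathbf D^{\nu+1}_{(i)},\mathbf X^{\nu+1}_i)-\nabla_Df_i(\mathbf D^{\nu}_{(i)},\mathbf X^{\nu}_i)\big)$. Assumption (S) (surrogates): for each $i$, $\tilde f_i(\mathbf D;\mathbf D^\nu_{(i)},\mathbf X^\nu_i)$ is either $f_i(\mathbf D,\mathbf X^\nu_i)+\frac{\tau^\nu_{D,i}}2\|\mathbf D-\mathbf D^\nu_{(i)}\|_F^2$ or $\langle\nabla_Df_i(\mathbf D^\nu_{(i)},\mathbf X^\nu_i),\mathbf D-\mathbf D^\nu_{(i)}\rangle+\frac{\tau^\nu_{D,i}}2\|\mathbf D-\mathbf D^\nu_{(i)}\|_F^2$; and $\tilde h_i(\mathbf X_i;\mathbf U^\nu_{(i)},\mathbf X^\nu_i)$ is either $f_i(\mathbf U^\nu_{(i)},\mathbf X_i)+\frac{\tau^\nu_{X,i}}2\|\mathbf X_i-\mathbf X^\nu_i\|_F^2$ or $\langle\nabla_{X_i}f_i(\mathbf U^\nu_{(i)},\mathbf X^\nu_i),\mathbf X_i-\mathbf X^\nu_i\rangle+\frac{\tau^\nu_{X,i}}2\|\mathbf X_i-\mathbf X^\nu_i\|_F^2$, with $\tau^\nu_{D,i},\tau^\nu_{X,i}>0$. Assumption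 (T1): for all $i$, $0<\inf_\nu\tau^\nu_{D,i}\le\sup_\nu\tau^\nu_{D,i}<\infty$, $\sup_\nu\tau^\nu_{X,i}<\infty$, and $\tau^\nu_{X,i}\ge\frac12L_{\nabla X_i}(\mathbf U^\nu_{(i)})+\epsilon$ for all $\nu\ge1$, for a fixed $\epsilon>0$. Assumption (T2): for all $i$, $\sum_{t=0}^\infty|\tau^{t+1}_{D,i}-\tau^t_{D,i}|<\infty$ and $\limsup_\nu|\tau^\nu_{X,i}-\tau^{\nu-1}_{X,i}|<\mu:=\min_i\mu_i$. Step-size assumption: $\gamma^\nu\in(0,1]$, $\sum_\nu\gamma^\nu=\infty$, $\sum_\nu(\gamma^\nu)^2<\infty$. Standing Setting: Assumption (A), B-strong connectivity, the weight conditions above, Assumption (S), Assumption (T1), and the step-size assumption. Notation: $\mathbf D^\nu\in\mathbb R^{MI\times K}$ is the vertical stack of $\mathbf D^\nu_{(1)},\dots,\mathbf D^\nu_{(I)}$; $\overline{\mathbf D}^\nu=\frac1I\sum_i\mathbf D^\nu_{(i)}$; $\mathbf 1\otimes\mathbf Y$ is the vertical stack of $I$ copies of $\mathbf Y$; $\mathbf X^\nu=[\mathbf X^\nu_1,\dots,\mathbf X^\nu_I]$; consensus error $e^\nu=\|\mathbf D^\nu-\mathbf 1\otimes\overline{\mathbf D}^\nu\|_{\infty,\infty}$. For fixed constants $\hat\tau_D,\hat\tau_X>0$: $\widehat{\mathbf D}(\overline{\mathbf D},\mathbf X)=\arg\min_{\mathbf D'\in\mathcal D}\langle\nabla_DF(\overline{\mathbf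 D},\mathbf X),\mathbf D'-\overline{\mathbf D}\rangle+\frac{\hat\tau_D}2\|\mathbf D'-\overline{\mathbf D}\|_F^2+G(\mathbf D')$; $\widehat{\mathbf X}_i(\overline{\mathbf D},\mathbf X_i)=\arg\min_{\mathbf X_i'\in\mathcal X_i}\langle\nabla_{X_i}f_i(\overline{\mathbf D},\mathbf X_i),\mathbf X_i'-\mathbf X_i\rangle+\frac{\hat\tau_X}2\|\mathbf X_i'-\mathbf X_i\|_F^2+g_i(\mathbf X_i')$, $\widehat{\mathbf X}=[\widehat{\mathbf X}_1,\dots,\widehat{\mathbf X}_I]$; $\Delta_D(\overline{\mathbf D},\mathbf X)=\|\widehat{\mathbf D}(\overline{\mathbf D},\mathbf X)-\overline{\mathbf D}\|_{\infty,\infty}$, $\Delta_X(\overline{\mathbf D},\mathbf X)=\|\widehat{\mathbf X}(\overline{\mathbf D},\mathbf X)-\mathbf X\|_{\infty,\infty}$, $\Delta^\nu=\max(\Delta_D(\overline{\mathbf D}^\nu,\mathbf X^\nu),\Delta_X(\overline{\mathbf D}^\nu,\mathbf X^\nu))$. *)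

(* Defs.v *)
From HB Require Import structures.
From mathcomp Require Import all_boot.
From Stdlib Require Import Reals Relations ClassicalEpsilon List.
Set Implicit Arguments. Unset Strict Implicit. Unset Printing Implicit Defensive.
Local Open Scope R_scope.

Definition vec (T : finType) := T -> R.
Definition Mat (m n : nat) := vec ('I_m * 'I_n)%type.

Definition vadd (T : finType) (A B : vec T) : vec T := fun t => A t + B t.
Definition vsub (T : finType) (A B : vec T) : vec T := fun t => A t - B t.
Definition vscale (T : finType) (c : R) (A : vec T) : vec T := fun t => c * A t.
Definition vcomb (T : finType) (c : R) (A B : vec T) : vec T :=
  fun t => c * A t + (1 - c) * B t.
Definition vsumI (I : nat) (T : finType) (F : 'I_I -> vec T) : vec T :=
  fun t => \big[Rplus/0%R]_(i < I) F i t.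
Definition vsumI_if (I : nat) (T : finType) (P : 'I_I -> bool) (F : 'I_I -> vec T)
  : vec T := fun t => \big[Rplus/0%R]_(j < I | P j) F j t.

Definition inner (T : finType) (A B : vec T) : R := \big[Rplus/0%R]_(t : T) (A t * B t).
Definition fnorm (T : finType) (A : vec T) : R := sqrt (inner A A).
Definition infnorm (T : finType) (A : vec T) : R := \big[Rmax/0%R]_(t : T) Rabs (A t).

Definition pairv (A B : finType) (x : vec A) (y : vec B) : vec (A + B)%type :=
  fun t => match t with inl a => x a | inr b => y b end.
Definition fstv (A B : finType) (z : vec (A + B)%type) : vec A := fun a => z (inl a).
Definition sndv (A B : finType) (z : vec (A + B)%type) : vec B := fun b => z (inr b).

Definition is_open (T : finType) (S : vec T -> Prop) : Prop :=
  forall z, S z -> exists r, 0 < r /\ forall w, fnorm (vsub w z) < r -> S w.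
Definition is_closed (T : finType) (S : vec T -> Prop) : Prop :=
  is_open (fun z => ~ S z).
Definition is_compact (T : finType) (S : vec T -> Prop) : Prop :=
  forall (Idx : Type) (Uc : Idx -> vec T -> Prop),
    (forall k, is_open (Uc k)) ->
    (forall z, S z -> exists k, Uc k z) ->
    exists l : list Idx, forall z, S z -> exists k, In k l /\ Uc k z.
Definition nonempty (T : finType) (S : vec T -> Prop) : Prop := exists z, S z.
Definition subset_of (T : finType) (S1 S2 : vec T -> Prop) : Prop :=
  forall z, S1 z -> S2 z.
Definition convex_set (T : finType) (S : vec T -> Prop) : Prop :=
  forall x y c, S x -> S y -> 0 <= c <= 1 -> S (vcomb c x y).
Definition convex_on (T : finType) (S : vec T -> Prop) (h : vec T -> R) : Prop :=
  forall x y c, S x -> S y -> 0 <= c <= 1 ->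
    h (vcomb c x y) <= c * h x + (1 - c) * h y.
Definition strongly_convex_on (T : finType) (m : R) (S : vec T -> Prop)
  (h : vec T -> R) : Prop :=
  forall x y c, S x -> S y -> 0 <= c <= 1 ->
    h (vcomb c x y) <= c * h x + (1 - c) * h y
                       - m / 2 * c * (1 - c) * (fnorm (vsub x y)) ^ 2.

Definition has_grad (T : finType) (h : vec T -> R) (z gr : vec T) : Prop :=
  forall eps, 0 < eps -> exists delta, 0 < delta /\
    forall k, fnorm k < delta ->
      Rabs (h (vadd z k) - h z - inner gr k) <= eps * fnorm k.
Definition cont_at (T : finType) (h : vec T -> R) (z : vec T) : Prop :=
  forall eps, 0 < eps -> exists delta, 0 < delta /\
    forall w, fnorm (vsub w z) < delta -> Rabs (h w - h z) < eps.
Definition C1_on (T : finType) (S : vec T -> Prop) (h : vec T -> R)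
  (Gr : vec T -> vec T) : Prop :=
  (forall z, S z -> has_grad h z (Gr z)) /\
  (forall z, S z -> forall t, cont_at (fun w => Gr w t) z).
Definition C2_on (T : finType) (S : vec T -> Prop) (h : vec T -> R)
  (Gr : vec T -> vec T) : Prop :=
  C1_on S h Gr /\ forall t, exists H, C1_on S (fun w => Gr w t) H.

Definition cont_on_rel (T : finType) (S : vec T -> Prop) (h : vec T -> R) : Prop :=
  forall z, S z -> forall eps, 0 < eps -> exists delta, 0 < delta /\
    forall w, S w -> fnorm (vsub w z) < delta -> Rabs (h w - h z) < eps.

Definition is_min_on (T : finType) (S : vec T -> Prop) (obj : vec T -> R) (x : vec T)
  : Prop := S x /\ forall y, S y -> obj x <= obj y.
(* "the" minimizer of obj over S (all minimization problems used are strongly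
   convex, hence have a unique minimizer) *)
Definition argmin_on (T : finType) (S : vec T -> Prop) (obj : vec T -> R) : vec T :=
  epsilon (inhabits (fun _ => 0%R)) (is_min_on S obj).

Definition surrogate (T : finType) (lin : bool) (h : vec T -> R) (gr : vec T)
  (tau : R) (Y0 Y : vec T) : R :=
  (if lin then inner gr (vsub Y Y0) else h Y) + tau / 2 * (fnorm (vsub Y Y0)) ^ 2.

Definition is_liminf (u : nat -> R) (l : R) : Prop :=
  (forall eps, 0 < eps -> exists N, forall k, (N <= k)%nat -> l - eps < u k) /\
  (forall eps, 0 < eps -> forall N, exists k, (N <= k)%nat /\ u k < l + eps).

Definition strongly_connected (I : nat) (Ed : 'I_I -> 'I_I -> Prop) : Prop :=
  forall i j : 'I_I, clos_refl_trans _ Ed i j.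

Unset Implicit Arguments.
Section Problem.
Context {I M K : nat} {n : 'I_I -> nat}.
Variable Dset : Mat M K -> Prop.
Variable Xset : forall i : 'I_I, Mat K (n i) -> Prop.
Variable f : forall i : 'I_I, Mat M K -> Mat K (n i) -> R.
Variable gD : forall i : 'I_I, Mat M K -> Mat K (n i) -> Mat M K.
Variable gX : forall i : 'I_I, Mat M K -> Mat K (n i) -> Mat K (n i).
Variable g : forall i : 'I_I, Mat K (n i) -> R.
Variable G : Mat M K -> R.

Definition Uobj (D : Mat M K) (X : forall i, Mat K (n i)) : R :=
  \big[Rplus/0%R]_(i < I) f i D (X i) + \big[Rplus/0%R]_(i < I) g i (X i) + G D.
Definition gradF (D : Mat M K) (X : forall i, Mat K (n i)) : Mat M K :=
  vsumI (fun i => gD i D (X i)).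

Definition Dhat (tD : R) (Db : Mat M K) (X : forall i, Mat K (n i)) : Mat M K :=
  argmin_on Dset (fun D' => inner (gradF Db X) (vsub D' Db)
                            + tD / 2 * (fnorm (vsub D' Db)) ^ 2 + G D').
Definition Xhat (tX : R) (Db : Mat M K) (i : 'I_I) (Xi : Mat K (n i)) : Mat K (n i) :=
  argmin_on (Xset i) (fun X' => inner (gX i Db Xi) (vsub X' Xi)
                                + tX / 2 * (fnorm (vsub X' Xi)) ^ 2 + g i X').
Definition DeltaD (tD : R) (Db : Mat M K) (X : forall i, Mat K (n i)) : R :=
  infnorm (vsub (Dhat tD Db X) Db).
(* ||Xhat - X||_{inf,inf} for X = [X_1,...,X_I] : max over blocks and entries *)
Definition DeltaX (tX : R) (Db : Mat M K) (X : forall i, Mat K (n i)) : R :=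
  \big[Rmax/0%R]_(i < I) infnorm (vsub (Xhat tX Db i (X i)) (X i)).

Definition stationary (Ds : Mat M K) (Xs : forall i, Mat K (n i)) : Prop :=
  Dset Ds /\ (forall i, Xset i (Xs i)) /\
  (forall D, Dset D -> inner (gradF Ds Xs) (vsub D Ds) + G D - G Ds >= 0) /\
  (forall i (Xi : Mat K (n i)), Xset i Xi ->
     inner (gX i Ds (Xs i)) (vsub Xi (Xs i)) + g i Xi - g i (Xs i) >= 0).
End Problem.
Set Implicit Arguments.

Definition Dbar (I M K : nat) (Dl : 'I_I -> Mat M K) : Mat M K :=
  vscale (/ INR I) (vsumI Dl).
Definition cons_err (I M K : nat) (Dl : 'I_I -> Mat M K) : R :=
  \big[Rmax/0%R]_(i < I) infnorm (vsub (Dl i) (Dbar Dl)).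

Definition is_limit_point (I M K : nat) (n : 'I_I -> nat)
  (Db : nat -> Mat M K) (X : nat -> forall i, Mat K (n i))
  (Ds : Mat M K) (Xs : forall i, Mat K (n i)) : Prop :=
  forall eps, 0 < eps -> forall N, exists k, (N <= k)%nat /\
    fnorm (vsub (Db k) Ds) < eps /\ forall i, fnorm (vsub (X k i) (Xs i)) < eps.

(* Main.v *)
Require Import Defs.
From HB Require Import structures.
From mathcomp Require Import all_boot.
From Stdlib Require Import Reals Relations ClassicalEpsilon List.
From Stdlib Require Import Lra FunctionalExtensionality.

(* Write V for the objective at the phi-weighted average of the local copies, with
   the G-part replaced by the phi-weighted average of the G(D_(i)).  Convexity and
   column stochasticity make the mixing step harmless for V, so from time 1 on
   V decreases by a multiple of gamma |Dt - D|^2 + |X' - X|^2 up to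
   gamma^2, (disagreement)^2 and gamma times the tracking error of Theta.
   Disagreement and tracking error are dominated by one-step geometric recursions,
   the first driven by gamma, the second by gamma, the disagreement and |X' - X|;
   hence the errors are summable and everything in (a), (b) follows, the maps Dhat
   and Xhat being compared with the iterates through their variational inequalities.

   All this needs the X-iterates to be bounded, which is not automatic since X_i may
   be unbounded and tau_X may be as small as L/2.  It comes from the strong convexity
   of g_i and the nonexpansiveness of id - grad f / tau for tau >= L/2, which must be
   proved on X_i only (L bounds the gradient on X_i, not on a neighbourhood).

   For (b'), the same contraction applied to consecutive X-steps bounds the sum of
   |X' - X| over a time window by the sum of gamma over that window plus a vanishing
   term, so Delta_D cannot keep oscillating while sum gamma |Dt - D|^2 is finite. *)

Set Implicit Arguments.
Unset Strict Implicit.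
Unset Printing Implicit Defensive.
Local Open Scope R_scope.

(** * Finite sums and vectors *)

(** The weights [phi] of the average come from a conservation law: column stochastic mixing
    preserves [phi]-weighted sums, so this average moves only through the local steps, by a multiple
    of [gamma], whereas the plain average also feels the disagreement. Each local step trades its
    linear term against a change of [G] at that agent's own copy; averaging these values of [G]
    matches the changes term by term. Time 1 is the start because the lower bound on [tauX] holds
    only from there.

    The descent makes |X' - X| square summable but not summable. The path of X may then have
    infinite length, and as Delta_D varies with X, the divergence of the sum of [gamma] gives no
    more than a liminf in (b). A stationary limit point therefore has to be extracted along times at
    which Delta_D is small, for all blocks at once. Comparing the length of the X-path with the sum
    of [gamma] is what strong convexity and (T2) add in (b'). *)

HB.instance Definition _ := @Monoid.isComLaw.Build R 0 Rplus
  (fun x y z => esym (Rplus_assoc x y z)) Rplus_comm Rplus_0_l.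

Section FiniteSums.
Variable T : finType.
Implicit Types F H : T -> R.

Lemma sumR_ge0 F : (forall t, 0 <= F t) -> 0 <= \big[Rplus/0]_t F t.
Proof. by move=> h; apply: (big_ind (fun x => 0 <= x)) => //; [lra | move=> *; lra]. Qed.

Lemma sumR_le F H : (forall t, F t <= H t) ->
  \big[Rplus/0]_t F t <= \big[Rplus/0]_t H t.
Proof.
by move=> h; apply: (big_ind2 (fun x y => x <= y)) => //; [lra | move=> *; lra].
Qed.

Lemma sumR_add F H : \big[Rplus/0]_t (F t + H t) =
  \big[Rplus/0]_t F t + \big[Rplus/0]_t H t.
Proof. exact: big_split. Qed.

Lemma sumR_scale c F : \big[Rplus/0]_t (c * F t) = c * \big[Rplus/0]_t F t.
Proof. by apply: (big_rec2 (fun x y => x = c * y)); [ring | move=> i x y _ ->; ring]. Qed.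

Lemma sumR_sub F H : \big[Rplus/0]_t (F t - H t) =
  \big[Rplus/0]_t F t - \big[Rplus/0]_t H t.
Proof.
rewrite (eq_bigr (fun t => F t + (-1) * H t)) => [|t _]; last by ring.
by rewrite sumR_add sumR_scale; ring.
Qed.

Lemma sumR_abs F : Rabs (\big[Rplus/0]_t F t) <= \big[Rplus/0]_t Rabs (F t).
Proof.
apply: (big_ind2 (fun x y => Rabs x <= y)); first by rewrite Rabs_R0; lra.
- by move=> x1 x2 y1 y2 h1 h2; have := Rabs_triang x1 y1; lra.
- by move=> *; lra.
Qed.

Lemma sumR_term F t : (forall s, 0 <= F s) -> F t <= \big[Rplus/0]_s F s.
Proof.
move=> h; rewrite (bigD1 t) //=.
suff: 0 <= \big[Rplus/0]_(s | s != t) F s by lra.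
by apply: (big_ind (fun x => 0 <= x)) => //; [lra | move=> *; lra].
Qed.

Lemma sumR_const c : \big[Rplus/0]_(t : T) c = INR #|T| * c.
Proof.
rewrite big_const; elim: #|T| => [|k IH] /=; first by ring.
by rewrite IH; case: k {IH} => [|k] /=; ring.
Qed.

Lemma maxR_ge F t : F t <= \big[Rmax/0]_s F s.
Proof.
have : t \in index_enum T by exact: mem_index_enum.
elim: (index_enum T) => [|s r IH] //; rewrite inE big_cons.
by case/orP => [/eqP <-|/IH h]; [exact: Rmax_l | apply: Rle_trans h (Rmax_r _ _)].
Qed.

Lemma maxR_le F c : 0 <= c -> (forall t, F t <= c) -> \big[Rmax/0]_t F t <= c.
Proof.
by move=> c0 h; apply: (big_ind (fun x => x <= c)) => // x y; exact: Rmax_lub.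
Qed.

Lemma maxR_ge0 F : 0 <= \big[Rmax/0]_t F t.
Proof. by elim/big_rec: _ => [|t x _ h]; [lra | apply: Rle_trans h (Rmax_r _ _)]. Qed.

Lemma fin_argmax F (t0 : T) : exists t, forall s, F s <= F t.
Proof.
suff [t _ h] : exists2 t, t \in t0 :: enum T & forall s, s \in t0 :: enum T -> F s <= F t.
  by exists t => s; apply: h; rewrite inE mem_enum orbT.
elim: (enum T) => [|x r [t tin h]].
  by exists t0; [rewrite mem_head | move=> s; rewrite inE => /eqP ->; lra].
case: (Rle_dec (F t) (F x)) => c.
- exists x; first by rewrite !inE eqxx orbT.
  move=> s; rewrite !inE => /or3P[/eqP->|/eqP->|hs]; last first.
  + by have := h s; rewrite inE hs orbT => /(_ isT); lra.
  + lra.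
  + by have := h t0; rewrite mem_head => /(_ isT); lra.
- exists t; first by move: tin; rewrite !inE => /orP[->|->]; rewrite ?orbT.
  move=> s; rewrite !inE => /or3P[/eqP->|/eqP->|hs]; last first.
  + by have := h s; rewrite inE hs orbT => /(_ isT).
  + lra.
  + by have := h t0; rewrite mem_head => /(_ isT).
Qed.

Lemma fin_argmin F (t0 : T) : exists t, forall s, F t <= F s.
Proof. by have [t h] := fin_argmax (fun s => - F s) t0; exists t => s; have := h s; lra. Qed.

(** Turns constants that depend on the agent or coordinate into one constant: monotonicity of [P]
    lets the maximum of the chosen witnesses serve every [t]. *)
Lemma fin_bound (P : T -> R -> Prop) :
  (forall t a b, a <= b -> P t a -> P t b) -> (forall t, exists a, P t a) ->
  exists a, 0 <= a /\ forall t, P t a.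
Proof.
move=> mono ex.
pose a t := proj1_sig (constructive_indefinite_description _ (ex t)).
have ha t : P t (a t) by rewrite /a; case: constructive_indefinite_description.
exists (\big[Rmax/0]_t a t); split; first exact: maxR_ge0.
by move=> t; apply: mono (ha t); exact: maxR_ge.
Qed.

End FiniteSums.

Lemma exchange_sumR (S T : finType) (F : S -> T -> R) :
  \big[Rplus/0]_s \big[Rplus/0]_t F s t = \big[Rplus/0]_t \big[Rplus/0]_s F s t.
Proof. exact: exchange_big. Qed.

(* Restatements at ['I_I], so that the sums they produce are syntactically those
   elaborated from [\big[Rplus/0]_(i < I)], as [lra] requires. *)
Section OrdinalSums.
Variable I : nat.
Implicit Types F H : 'I_I -> R.

Lemma sumI_ge0 F : (forall i, 0 <= F i) -> 0 <= \big[Rplus/0]_(i < I) F i.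
Proof. exact: sumR_ge0. Qed.
Lemma sumI_le F H : (forall i, F i <= H i) ->
  \big[Rplus/0]_(i < I) F i <= \big[Rplus/0]_(i < I) H i.
Proof. exact: sumR_le. Qed.
Lemma sumI_add F H : \big[Rplus/0]_(i < I) (F i + H i) =
  \big[Rplus/0]_(i < I) F i + \big[Rplus/0]_(i < I) H i.
Proof. exact: sumR_add. Qed.
Lemma sumI_sub F H : \big[Rplus/0]_(i < I) (F i - H i) =
  \big[Rplus/0]_(i < I) F i - \big[Rplus/0]_(i < I) H i.
Proof. exact: sumR_sub. Qed.
Lemma sumI_scale c F : \big[Rplus/0]_(i < I) (c * F i) = c * \big[Rplus/0]_(i < I) F i.
Proof. exact: sumR_scale. Qed.
Lemma sumI_term F i : (forall j, 0 <= F j) -> F i <= \big[Rplus/0]_(j < I) F j.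
Proof. exact: sumR_term. Qed.
Lemma sumI_const c : \big[Rplus/0]_(i < I) c = INR I * c.
Proof. by rewrite sumR_const card_ord. Qed.
Lemma sumI_abs F : Rabs (\big[Rplus/0]_(i < I) F i) <= \big[Rplus/0]_(i < I) Rabs (F i).
Proof. exact: sumR_abs. Qed.
Lemma sumI_exchange (F : 'I_I -> 'I_I -> R) :
  \big[Rplus/0]_(i < I) \big[Rplus/0]_(j < I) F i j =
  \big[Rplus/0]_(j < I) \big[Rplus/0]_(i < I) F i j.
Proof. exact: exchange_sumR. Qed.

End OrdinalSums.

Section Vectors.
Variable T : finType.
Implicit Types A B C W : vec T.

Lemma vec_ext A B : (forall t, A t = B t) -> A = B.
Proof. exact: functional_extensionality. Qed.

Lemma inner_sym A B : inner A B = inner B A.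
Proof. by apply: eq_bigr => t _; ring. Qed.
Lemma inner_addl A B C : inner (vadd A B) C = inner A C + inner B C.
Proof. by rewrite -sumR_add; apply: eq_bigr => t _; rewrite /vadd; ring. Qed.
Lemma inner_subl A B C : inner (vsub A B) C = inner A C - inner B C.
Proof. by rewrite -sumR_sub; apply: eq_bigr => t _; rewrite /vsub; ring. Qed.
Lemma inner_scalel c A B : inner (vscale c A) B = c * inner A B.
Proof. by rewrite -sumR_scale; apply: eq_bigr => t _; rewrite /vscale; ring. Qed.
Lemma inner_addr A B C : inner C (vadd A B) = inner C A + inner C B.
Proof. by rewrite inner_sym inner_addl !(inner_sym C). Qed.
Lemma inner_subr A B C : inner C (vsub A B) = inner C A - inner C B.
Proof. by rewrite inner_sym inner_subl !(inner_sym C). Qed.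
Lemma inner_scaler c A B : inner B (vscale c A) = c * inner B A.
Proof. by rewrite inner_sym inner_scalel (inner_sym B). Qed.

Definition innerE := (inner_addl, inner_subl, inner_scalel,
  inner_addr, inner_subr, inner_scaler).

Lemma inner_ge0 A : 0 <= inner A A.
Proof. by apply: sumR_ge0 => t; nra. Qed.

Lemma fnorm_ge0 A : 0 <= fnorm A.
Proof. exact: sqrt_pos. Qed.

Lemma fnorm_sq A : fnorm A ^ 2 = inner A A.
Proof. by rewrite /fnorm pow2_sqrt //; exact: inner_ge0. Qed.

Lemma fnormE A : inner A A = fnorm A * fnorm A.
Proof. by rewrite -fnorm_sq; ring. Qed.

Lemma coord_le A t : Rabs (A t) <= fnorm A.
Proof.
apply: Rsqr_incr_0; [|exact: Rabs_pos|exact: fnorm_ge0].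
rewrite -Rsqr_abs /Rsqr -fnormE.
by apply: (@sumR_term _ (fun t => A t * A t)) => s; nra.
Qed.

Lemma fnorm_eq0 A : fnorm A = 0 -> forall t, A t = 0.
Proof. by move=> h t; have := coord_le A t; rewrite h; split_Rabs; lra. Qed.

Lemma cauchy_schwarz A B : inner A B <= fnorm A * fnorm B.
Proof.
have ha := fnorm_ge0 A; have hb := fnorm_ge0 B.
case: (Req_dec (fnorm A) 0) => a0.
  rewrite /inner big1 ?a0; last by move=> t _; rewrite (fnorm_eq0 a0); ring.
  lra.
case: (Req_dec (fnorm B) 0) => b0.
  rewrite /inner big1 ?b0; last by move=> t _; rewrite (fnorm_eq0 b0); ring.
  lra.
(* Expanding this square gives the claim multiplied by [2 * fnorm A * fnorm B], which is positive
   here. *)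
have := inner_ge0 (vsub (vscale (fnorm B) A) (vscale (fnorm A) B)).
rewrite !innerE !fnormE (inner_sym B A) => h.
have : 0 < fnorm A * fnorm B by apply: Rmult_lt_0_compat; lra.
nra.
Qed.

Lemma cauchy_schwarz_abs A B : Rabs (inner A B) <= fnorm A * fnorm B.
Proof.
apply: Rabs_le; split; last exact: cauchy_schwarz.
have := cauchy_schwarz (vscale (-1) A) B; rewrite inner_scalel.
suff -> : fnorm (vscale (-1) A) = fnorm A by lra.
by rewrite /fnorm !innerE; congr sqrt; ring.
Qed.

Lemma fnorm_scale c A : fnorm (vscale c A) = Rabs c * fnorm A.
Proof.
rewrite /fnorm !innerE -Rmult_assoc sqrt_mult_alt; last by nra.
by rewrite -/(Rsqr c) sqrt_Rsqr_abs.
Qed.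

Lemma fnorm_add A B : fnorm (vadd A B) <= fnorm A + fnorm B.
Proof.
have ha := fnorm_ge0 A; have hb := fnorm_ge0 B; have hc := fnorm_ge0 (vadd A B).
apply: Rsqr_incr_0; [|lra|lra].
rewrite /Rsqr -fnormE !innerE (inner_sym B A) !fnormE.
have := cauchy_schwarz A B; nra.
Qed.

Lemma fnorm_vsubC A B : fnorm (vsub A B) = fnorm (vsub B A).
Proof.
suff -> : vsub A B = vscale (-1) (vsub B A) by rewrite fnorm_scale Rabs_Ropp Rabs_R1; ring.
by apply: vec_ext => t; rewrite /vscale /vsub; ring.
Qed.

Lemma fnorm_sub A B : fnorm (vsub A B) <= fnorm A + fnorm B.
Proof.
suff -> : vsub A B = vadd A (vscale (-1) B).
  by apply: Rle_trans (fnorm_add _ _) _; rewrite fnorm_scale Rabs_Ropp Rabs_R1; lra.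
by apply: vec_ext => t; rewrite /vscale /vsub /vadd; ring.
Qed.

Lemma fnorm_tri C A B : fnorm (vsub A B) <= fnorm (vsub A C) + fnorm (vsub C B).
Proof.
suff -> : vsub A B = vadd (vsub A C) (vsub C B) by exact: fnorm_add.
by apply: vec_ext => t; rewrite /vsub /vadd; ring.
Qed.

Lemma fnorm_subrr A : fnorm (vsub A A) = 0.
Proof.
by rewrite /fnorm /inner big1 ?sqrt_0 // => t _; rewrite /vsub; ring.
Qed.

Lemma fnorm_le_sum A : fnorm A <= \big[Rplus/0]_t Rabs (A t).
Proof.
have h0 : 0 <= \big[Rplus/0]_t Rabs (A t) by apply: sumR_ge0 => t; exact: Rabs_pos.
apply: Rsqr_incr_0 => //; last exact: fnorm_ge0.
rewrite /Rsqr -fnormE.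
set S := (X in _ <= X * _); rewrite -/S -sumR_scale; apply: sumR_le => t.
have : Rabs (A t) <= S := @sumR_term _ (fun t => Rabs (A t)) t (fun s => Rabs_pos _).
by move=> h; have := Rabs_pos (A t); have := Rsqr_abs (A t); rewrite /Rsqr; nra.
Qed.

Lemma fnorm_le_coord A c : (forall t, Rabs (A t) <= c) -> fnorm A <= INR #|T| * c.
Proof.
by move=> h; apply: Rle_trans (fnorm_le_sum _) _; rewrite -sumR_const; exact: sumR_le.
Qed.

Lemma infnorm_le A : infnorm A <= fnorm A.
Proof. by apply: maxR_le (fnorm_ge0 _) _ => t; exact: coord_le. Qed.

Lemma fnorm_sq_comb A B c : 0 <= c <= 1 ->
  fnorm (vcomb c A B) ^ 2 = c * fnorm A ^ 2 + (1 - c) * fnorm B ^ 2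
                            - c * (1 - c) * fnorm (vsub A B) ^ 2.
Proof.
move=> _; rewrite !fnorm_sq.
have -> : vcomb c A B = vadd (vscale c A) (vscale (1 - c) B) by [].
by rewrite !innerE (inner_sym B A); ring.
Qed.

Lemma fnorm_sub_comb A B C c : 0 <= c <= 1 ->
  fnorm (vsub (vcomb c A B) C) <= c * fnorm (vsub A C) + (1 - c) * fnorm (vsub B C).
Proof.
move=> hc.
have -> : vsub (vcomb c A B) C = vadd (vscale c (vsub A C)) (vscale (1 - c) (vsub B C)).
  by apply: vec_ext => t; rewrite /vsub /vadd /vscale /vcomb; ring.
by apply: Rle_trans (fnorm_add _ _) _; rewrite !fnorm_scale !Rabs_pos_eq; lra.
Qed.

Lemma fnorm_comb_le A B c r : 0 <= c <= 1 -> fnorm A <= r -> fnorm B <= r ->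
  fnorm (vcomb c A B) <= r.
Proof.
move=> hc ha hb; have z (D : vec T) : vsub D (fun _ => 0) = D.
  by apply: vec_ext => t; rewrite /vsub; ring.
have := fnorm_sub_comb A B (fun _ => 0) hc; rewrite !z.
have c1 : 0 <= c by lra.
have c2 : 0 <= 1 - c by lra.
have := Rmult_le_compat_l _ _ _ c1 ha; have := Rmult_le_compat_l _ _ _ c2 hb; lra.
Qed.

End Vectors.

Ltac vring := apply: vec_ext => ?; rewrite /vsub /vadd /vscale /vcomb; try ring; try field.

(** Pair the sum with itself: Cauchy-Schwarz then applies summand by summand, and one factor
    [fnorm (vsumI F)] cancels. *)
Lemma fnorm_sumI (I : nat) (T : finType) (F : 'I_I -> vec T) :
  fnorm (vsumI F) <= \big[Rplus/0]_(i < I) fnorm (F i).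
Proof.
have h0 : 0 <= \big[Rplus/0]_(i < I) fnorm (F i).
  by apply: sumR_ge0 => i; exact: fnorm_ge0.
have [hz|hp] := Rle_lt_or_eq_dec 0 _ (fnorm_ge0 (vsumI F)); last by rewrite -hp.
apply: (Rmult_le_reg_l (fnorm (vsumI F))) => //.
rewrite -fnormE -sumR_scale {1}/inner.
rewrite (eq_bigr (fun t => \big[Rplus/0]_(i < I) (vsumI F t * F i t))); last first.
  by move=> t _; rewrite sumR_scale.
rewrite exchange_sumR; apply: sumR_le => i; exact: cauchy_schwarz.
Qed.

Lemma inner_sumI (I : nat) (T : finType) (F : 'I_I -> vec T) (A : vec T) :
  inner (vsumI F) A = \big[Rplus/0]_(i < I) inner (F i) A.
Proof.
rewrite /inner exchange_sumR; apply: eq_bigr => t _.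
by rewrite Rmult_comm -sumR_scale; apply: eq_bigr => i _; ring.
Qed.

Lemma fnorm_pair (S T : finType) (x : vec S) (y : vec T) :
  fnorm (pairv x y) ^ 2 = fnorm x ^ 2 + fnorm y ^ 2.
Proof. by rewrite !fnorm_sq /inner big_sumType. Qed.

Lemma fnorm_pair_le (S T : finType) (x : vec S) (y : vec T) :
  fnorm (pairv x y) <= fnorm x + fnorm y.
Proof.
have h := fnorm_pair x y; have := fnorm_ge0 x; have := fnorm_ge0 y.
have := fnorm_ge0 (pairv x y); nra.
Qed.

Lemma fnorm_fstv (S T : finType) (z : vec (S + T)%type) : fnorm (fstv z) <= fnorm z.
Proof.
have -> : fnorm z = fnorm (pairv (fstv z) (sndv z)).
  by congr fnorm; apply: vec_ext; case.
have h := fnorm_pair (fstv z) (sndv z); have := fnorm_ge0 (fstv z).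
have := fnorm_ge0 (pairv (fstv z) (sndv z)); nra.
Qed.

Lemma fnorm_sndv (S T : finType) (z : vec (S + T)%type) : fnorm (sndv z) <= fnorm z.
Proof.
have -> : fnorm z = fnorm (pairv (fstv z) (sndv z)).
  by congr fnorm; apply: vec_ext; case.
have h := fnorm_pair (fstv z) (sndv z); have := fnorm_ge0 (sndv z).
have := fnorm_ge0 (pairv (fstv z) (sndv z)); nra.
Qed.

(* [lra] compares atoms syntactically, but the index type of a matrix has several
   convertible forms; abstracting the atoms first identifies them. *)
Ltac abstract_inner := repeat (let x := fresh "ip" in set x := (inner _ _); clearbody x).

(** * Cluster points, compactness and convexity *)

Lemma Rdiv_ge0 (a b : R) : 0 <= a -> 0 < b -> 0 <= a / b.
Proof. by move=> a0 b0; apply: Rmult_le_pos => //; apply: Rlt_le; exact: Rinv_0_lt_compat. Qed.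

Lemma Rpos_le (a b : R) : (forall eps, 0 < eps -> a <= b + eps) -> a <= b.
Proof.
move=> h; case: (Rle_dec a b) => // c.
by have := h ((a - b) / 2); lra.
Qed.

Lemma Rpos_le_scale (a b c : R) : 0 <= c ->
  (forall eps, 0 < eps -> a <= b + c * eps) -> a <= b.
Proof.
move=> c0 h; apply: Rpos_le => eps e0.
have c1 : 0 < c + 1 by lra.
have h1 := Rdiv_lt_0_compat _ _ e0 c1.
have := h _ h1.
have -> : c * (eps / (c + 1)) = eps - eps / (c + 1) by field; lra.
lra.
Qed.

Lemma inv_small (eps : R) : 0 < eps -> exists n : nat, / (INR n + 1) < eps.
Proof.
move=> e0; have [n hn] := INR_unbounded (/ eps).
exists n; rewrite -(Rinv_inv eps); apply: Rinv_lt_contravar; last by lra.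
by apply: Rmult_lt_0_compat; [apply: Rinv_0_lt_compat | have := pos_INR n; lra].
Qed.

Lemma INR_leq (m n : nat) : (m <= n)%nat -> INR m <= INR n.
Proof. by move/leP; exact: le_INR. Qed.

Section Clusters.

(* [Q eps k] is a side condition that tightens as [eps] decreases; keeping it
   inside the statement replaces the extraction of subsequences. *)
Definition frequently (P : nat -> Prop) := forall N, exists k, (N <= k)%nat /\ P k.
Definition tightening (Q : R -> nat -> Prop) :=
  forall e1 e2 k, e1 <= e2 -> Q e1 k -> Q e2 k.

Lemma real_cluster (x : nat -> R) (C : R) (Q : R -> nat -> Prop) :
  tightening Q -> (forall k, Rabs (x k) <= C) ->
  (forall eps, 0 < eps -> frequently (Q eps)) ->
  exists l, forall eps, 0 < eps ->
    frequently (fun k => Q eps k /\ Rabs (x k - l) < eps).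
Proof.
move=> mono bx fr.
(* Levels exceeded frequently under every side condition; the supremum of [S] is the limit superior
   of [x] along the selected times. *)
pose S a := forall eps, 0 < eps -> frequently (fun k => Q eps k /\ a < x k).
have Sup a : S a -> a <= C.
  move=> /(_ 1 Rlt_0_1 0%nat) [k [_ [_ hk]]]; have := bx k; split_Rabs; lra.
have [l [lub lst]] : {l | is_lub S l}.
  apply: completeness; first by exists C => a; exact: Sup.
  exists (- C - 1) => eps e0 N; have [k [kN hk]] := fr _ e0 N.
  by exists k; split=> //; split=> //; have := bx k; split_Rabs; lra.
exists l => eps e0 N.
have [a [Sa la]] : exists a, S a /\ l - eps < a.
  apply: NNPP => h; suff : l <= l - eps by lra.
  apply: lst => a Sa; case: (Rle_dec a (l - eps)) => // c.
  by case: h; exists a; split=> //; lra.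
have [e1 [e10 [N1 hN1]]] : exists e1, 0 < e1 /\ exists N1, forall k, (N1 <= k)%nat ->
    ~ (Q e1 k /\ l + eps / 2 < x k).
  apply: NNPP => h; suff : l + eps / 2 <= l by lra.
  apply: lub => e1 e10 N1; apply: NNPP => h1; apply: h; exists e1; split=> //.
  by exists N1 => k kN hk; apply: h1; exists k.
have em : 0 < Rmin eps e1 by apply: Rmin_pos.
have [k [kN [hQ hk]]] := Sa _ em (maxn N N1).
exists k; split; first by apply: leq_trans kN; exact: leq_maxl.
split; first by apply: mono hQ; exact: Rmin_l.
have hl : ~ (l + eps / 2 < x k).
  move=> hl; apply: (hN1 k); first by apply: leq_trans kN; exact: leq_maxr.
  by split=> //; apply: mono hQ; exact: Rmin_r.
by split_Rabs; lra.
Qed.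

(** Coordinates are treated one at a time: closeness in those already done joins [Q] in the side
    condition passed to [real_cluster]. *)
Lemma vec_cluster (T : finType) (u : nat -> vec T) (C : R) (Q : R -> nat -> Prop) :
  tightening Q -> (forall k, fnorm (u k) <= C) ->
  (forall eps, 0 < eps -> frequently (Q eps)) ->
  exists l, forall eps, 0 < eps ->
    frequently (fun k => Q eps k /\ fnorm (vsub (u k) l) < eps).
Proof.
move=> mono bu fr.
have [l hl] : exists l : vec T, forall eps, 0 < eps -> frequently (fun k =>
    Q eps k /\ forall t, t \in enum T -> Rabs (u k t - l t) < eps).
  elim: (enum T) => [|s r [l IH]].
    by exists (fun _ => 0) => eps e0 N; have [k [kN hk]] := fr _ e0 N; exists k.
  have [||b hb] := @real_cluster (fun k => u k s) C (fun eps k =>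
     Q eps k /\ forall t, t \in r -> Rabs (u k t - l t) < eps) _ _ IH.
  - move=> e1 e2 k e12 [h1 h2]; split; first exact: mono h1.
    by move=> t tr; have := h2 t tr; lra.
  - by move=> k; apply: Rle_trans (coord_le _ _) (bu k).
  exists (fun t => if t == s then b else l t) => eps e0 N.
  have [k [kN [[hQ h2] h3]]] := hb _ e0 N.
  exists k; split=> //; split=> // t; rewrite inE; case: eqP => [->|_] //= tr; exact: h2.
exists l => eps e0 N.
pose n := INR #|T|; have n0 : 0 <= n by exact: pos_INR.
have e1 : 0 < eps / (n + 1) by apply: Rdiv_lt_0_compat; lra.
have [k [kN [hQ hk]]] := hl _ e1 N.
have le1 : eps / (n + 1) <= eps.
  by apply: (Rmult_le_reg_r (n + 1)); [lra | field_simplify; nra].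
exists k; split=> //; split; first exact: mono hQ.
have : fnorm (vsub (u k) l) <= n * (eps / (n + 1)).
  apply: fnorm_le_coord => t; apply: Rlt_le; apply: hk; exact: mem_enum.
have -> : n * (eps / (n + 1)) = eps - eps / (n + 1) by field; lra.
lra.
Qed.

End Clusters.

Section ClosedBounded.
Variable T : finType.
Implicit Types S K : vec T -> Prop.

Definition bounded_by S (C : R) := forall z, S z -> fnorm z <= C.

Lemma closed_limit S z : is_closed S ->
  (forall eps, 0 < eps -> exists w, S w /\ fnorm (vsub w z) < eps) -> S z.
Proof.
move=> cl lim; apply: NNPP => nz; have [r [r0 hr]] := cl z nz.
by have [w [Sw hw]] := lim r r0; apply: (hr w hw).
Qed.

Lemma list_INR_bound (l : list nat) : exists m : nat, forall k, In k l -> INR k <= INR m.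
Proof.
elim: l => [|a l [m IH]]; first by exists 0%nat.
exists (maxn a m) => k /= [<-|hk]; first by apply: INR_leq; exact: leq_maxl.
by apply: Rle_trans (IH k hk) _; apply: INR_leq; exact: leq_maxr.
Qed.

Lemma compact_bounded S : is_compact S -> exists C, 0 <= C /\ bounded_by S C.
Proof.
move=> cpt.
have [||l hl] := cpt nat (fun n w => fnorm w < INR n).
- move=> n z hz; exists (INR n - fnorm z); split; first lra.
  move=> w hw; have := fnorm_tri z w (fun _ => 0).
  have e (x : vec T) : vsub x (fun _ => 0) = x by vring.
  by rewrite !e; lra.
- by move=> z _; have [n hn] := INR_unbounded (fnorm z); exists n.
have [m hm] := list_INR_bound l.
exists (INR m); split; first exact: pos_INR.
by move=> z Sz; have [k [kl hk]] := hl z Sz; have := hm k kl; lra.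
Qed.

Lemma compact_closed S : is_compact S -> is_closed S.
Proof.
move=> cpt z nSz.
have [||l hl] := cpt nat (fun n w => / (INR n + 1) < fnorm (vsub w z)).
- move=> n w hw; exists (fnorm (vsub w z) - / (INR n + 1)); split; first lra.
  by move=> v hv; have := fnorm_tri v w z; rewrite (fnorm_vsubC w v); lra.
- move=> w Sw; apply: inv_small.
  case: (Rle_lt_or_eq_dec _ _ (fnorm_ge0 (vsub w z))) => // e.
  case: nSz; suff <- : w = z by [].
  by apply: vec_ext => t; have := fnorm_eq0 (esym e) t; rewrite /vsub; lra.
have [m hm] := list_INR_bound l.
have m1 := pos_INR m.
exists (/ (INR m + 1)); split; first by apply: Rinv_0_lt_compat; lra.
move=> w hw Sw; have [k [kl hk]] := hl w Sw.
have := hm k kl; have k1 := pos_INR k => hkm.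
suff : / (INR m + 1) <= / (INR k + 1) by lra.
by apply: Rinv_le_contravar; lra.
Qed.

(** Bolzano-Weierstrass combined with choice. It is the common core of the next three lemmas, where
    [P k] says that a point violates the claim, or nearly minimizes, at precision [k]. *)
Lemma closed_bounded_cluster K C (P : nat -> vec T -> Prop) : is_closed K ->
  bounded_by K C -> (forall k, exists z, K z /\ P k z) ->
  exists u l, (forall k, K (u k) /\ P k (u k)) /\ K l /\
    forall eps, 0 < eps -> frequently (fun k => fnorm (vsub (u k) l) < eps).
Proof.
move=> cl bd hz.
pose u k := proj1_sig (constructive_indefinite_description _ (hz k)).
have hu k : K (u k) /\ P k (u k) by rewrite /u; case: constructive_indefinite_description.
have [|||l hl] := @vec_cluster T u C (fun _ _ => True).
- by [].
- by move=> k; apply: bd; case: (hu k).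
- by move=> eps _ N; exists N.
exists u, l; split=> //; split.
  apply: closed_limit cl _ => eps e0; have [k [_ [_ hk]]] := hl _ e0 0%nat.
  by exists (u k); split=> //; case: (hu k).
by move=> eps e0 N; have [k [Nk [_ hk]]] := hl _ e0 N; exists k.
Qed.

Lemma cont_bounded K C (h : vec T -> R) : is_closed K -> bounded_by K C ->
  cont_on_rel K h -> exists B, forall z, K z -> Rabs (h z) <= B.
Proof.
move=> cl bd ct; apply: NNPP => hn.
have hz (n : nat) : exists z, K z /\ INR n < Rabs (h z).
  apply: NNPP => h1; apply: hn; exists (INR n) => z Kz.
  by case: (Rle_dec (Rabs (h z)) (INR n)) => // c; case: h1; exists z; split=> //; lra.
have [u [l [hu [Kl hl]]]] := closed_bounded_cluster cl bd hz.
have [d [d0 hd]] := ct l Kl 1 Rlt_0_1.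
have [N hN] := INR_unbounded (Rabs (h l) + 1).
have [k [kN hk]] := hl _ d0 N.
have [Kk hk2] := hu k; have := hd _ Kk hk; have := INR_leq kN.
by move: hk2; split_Rabs; lra.
Qed.

Lemma cont_min K C (h : vec T -> R) : is_closed K -> bounded_by K C -> nonempty K ->
  cont_on_rel K h -> exists x, is_min_on K h x.
Proof.
move=> cl bd [z0 Kz0] ct.
have [B hB] := cont_bounded cl bd ct.
have [m [ub lb]] : {m | is_lub (fun a => exists z, K z /\ a = - h z) m}.
  apply: completeness; last by exists (- h z0), z0.
  by exists B => a [z [Kz ->]]; have := hB z Kz; split_Rabs; lra.
have hz (n : nat) : exists z, K z /\ h z < - m + / (INR n + 1).
  have n0 : 0 < / (INR n + 1) by apply: Rinv_0_lt_compat; have := pos_INR n; lra.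
  apply: NNPP => h1; suff : m <= m - / (INR n + 1) by lra.
  apply: lb => a [z [Kz ->]]; case: (Rle_dec (- h z) (m - / (INR n + 1))) => // c.
  by case: h1; exists z; split=> //; lra.
have [u [l [hu [Kl hl]]]] := closed_bounded_cluster cl bd hz.
exists l; split=> // y Ky.
apply: (Rle_trans _ (- m)); last by have := ub (- h y) (ex_intro _ y (conj Ky erefl)); lra.
apply: Rpos_le => eps e0.
have e2 : 0 < eps / 2 by lra.
have [d [d0 hd]] := ct l Kl _ e2.
have [N hN] := inv_small e2.
have [k [kN hk]] := hl _ d0 N.
have [Kk hk2] := hu k; have := hd _ Kk hk.
have : / (INR k + 1) <= / (INR N + 1).
  by apply: Rinv_le_contravar; have := pos_INR N; have := INR_leq kN; lra.
by split_Rabs; lra.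
Qed.

Lemma cont_uniform K C (h : vec T -> R) : is_closed K -> bounded_by K C ->
  cont_on_rel K h -> forall eps, 0 < eps -> exists d, 0 < d /\
  forall z w, K z -> K w -> fnorm (vsub w z) < d -> Rabs (h w - h z) < eps.
Proof.
move=> cl bd ct eps e0; apply: NNPP => hn.
have hz (n : nat) : exists z, K z /\ exists w, K w /\
    fnorm (vsub w z) < / (INR n + 1) /\ eps <= Rabs (h w - h z).
  apply: NNPP => h1; apply: hn; exists (/ (INR n + 1)); split.
    by apply: Rinv_0_lt_compat; have := pos_INR n; lra.
  move=> z w Kz Kw hzw; case: (Rlt_dec (Rabs (h w - h z)) eps) => // c.
  by case: h1; exists z; split=> //; exists w; do 2!split=> //; lra.
have [u [l [hu [Kl hl]]]] := closed_bounded_cluster cl bd hz.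
have e2 : 0 < eps / 2 by lra.
have [d [d0 hd]] := ct l Kl _ e2.
have d2 : 0 < d / 2 by lra.
have [N hN] := inv_small d2.
have [k [kN hk]] := hl _ d2 N.
have [Kk [w [Kw [hw1 hw2]]]] := hu k.
have hkl : fnorm (vsub (u k) l) < d by lra.
have hwl : fnorm (vsub w l) < d.
  have := fnorm_tri (u k) w l.
  have : / (INR k + 1) <= / (INR N + 1).
    by apply: Rinv_le_contravar; have := pos_INR N; have := INR_leq kN; lra.
  lra.
have := hd _ Kk hkl; have := hd _ Kw hwl.
by move: hw2; split_Rabs; lra.
Qed.

End ClosedBounded.

(** * Jensen's inequality, local Lipschitz bounds and existence of minimizers *)

Section Convexity.
Variable T : finType.
Implicit Types S : vec T -> Prop.

Lemma convex_combination S (h : vec T -> R) (J : finType) (a : J -> R) (x : J -> vec T) :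
  convex_set S -> convex_on S h -> (forall j, 0 <= a j) -> (forall j, S (x j)) ->
  \big[Rplus/0]_j a j = 1 ->
  S (fun t => \big[Rplus/0]_j (a j * x j t)) /\
  h (fun t => \big[Rplus/0]_j (a j * x j t)) <= \big[Rplus/0]_j (a j * h (x j)).
Proof.
move=> cS ch a0 Sx.
(* Both claims are multiplied by the partial sum of the weights, so the induction needs no
   normalized weights. *)
have key (r : list J) : 0 < \big[Rplus/0]_(j <- r) a j -> exists p, S p /\
    (forall t, \big[Rplus/0]_(j <- r) a j * p t = \big[Rplus/0]_(j <- r) (a j * x j t)) /\
    \big[Rplus/0]_(j <- r) a j * h p <= \big[Rplus/0]_(j <- r) (a j * h (x j)).
  elim: r => [|j r IH]; first by rewrite big_nil; lra.
  have r0 : 0 <= \big[Rplus/0]_(j <- r) a j.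
    by apply: (big_ind (fun x => 0 <= x)) => //; [lra | move=> *; lra].
  rewrite big_cons; set s := \big[Rplus/0]_(j <- r) a j in IH r0 *.
  have hj := a0 j; case: (Rle_lt_or_eq_dec _ _ r0) => [sp|s0] hs.
    have [p [Sp [hp1 hp2]]] := IH sp.
    pose c := a j / (a j + s).
    have c01 : 0 <= c <= 1.
      split; first by apply: Rdiv_ge0 => //; lra.
      by apply: (Rmult_le_reg_r (a j + s)) => //; rewrite /c; field_simplify; lra.
    exists (vcomb c (x j) p); split; first exact: cS.
    split.
      move=> t; rewrite big_cons -hp1 /vcomb /c; field; lra.
    rewrite big_cons; have := ch (x j) p c (Sx j) Sp c01 => hc.
    have : (a j + s) * h (vcomb c (x j) p) <= (a j + s) * (c * h (x j) + (1 - c) * h p).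
      by apply: Rmult_le_compat_l => //; lra.
    have -> : (a j + s) * (c * h (x j) + (1 - c) * h p) = a j * h (x j) + s * h p.
      by rewrite /c; field; lra.
    lra.
  (* A tail of total weight 0 has only zero weights, so it contributes nothing and [x j] alone is
     the combination. *)
  have z (F : J -> R) : \big[Rplus/0]_(j <- r) (a j * F j) = 0.
    have : \big[Rplus/0]_(j <- r) a j = 0 by rewrite -/s -s0.
    elim: r {IH s r0 s0 hs} => [|k r IH]; first by rewrite !big_nil.
    have rk : 0 <= \big[Rplus/0]_(j <- r) a j.
      by apply: (big_ind (fun x => 0 <= x)) => //; [lra | move=> *; lra].
    rewrite !big_cons => h0; have := a0 k => ak.
    have -> : a k = 0 by lra.
    by rewrite IH; lra.
  exists (x j); split=> //; split=> [t|]; rewrite big_cons z -s0; lra.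
move=> a1.
have [|p [Sp [hp1 hp2]]] := key (index_enum J); first by rewrite a1; lra.
have <- : p = fun t => \big[Rplus/0]_j (a j * x j t).
  by apply: vec_ext => t; rewrite -hp1 a1; ring.
by split=> //; move: hp2; rewrite a1; lra.
Qed.

Lemma strongly_convex_convex m S (h : vec T -> R) : 0 <= m ->
  strongly_convex_on m S h -> convex_on S h.
Proof.
move=> m0 sc x y c Sx Sy hc; apply: Rle_trans (sc x y c Sx Sy hc) _.
suff : 0 <= m / 2 * c * (1 - c) * fnorm (vsub x y) ^ 2 by lra.
by repeat apply: Rmult_le_pos; try lra; exact: fnorm_ge0.
Qed.

Lemma convex_strongly0 S (h : vec T -> R) : convex_on S h -> strongly_convex_on 0 S h.
Proof. by move=> cv x y c Sx Sy hc; have := cv x y c Sx Sy hc; lra. Qed.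

Lemma strongly_convex_subset m S S' (h : vec T -> R) : subset_of S' S ->
  strongly_convex_on m S h -> strongly_convex_on m S' h.
Proof. by move=> ss sc x y c Sx Sy; apply: sc; exact: ss. Qed.

Lemma strongly_convex_add m m' S (h h' : vec T -> R) :
  strongly_convex_on m S h -> strongly_convex_on m' S h' ->
  strongly_convex_on (m + m') S (fun x => h x + h' x).
Proof.
move=> c1 c2 x y c Sx Sy hc; have := c1 x y c Sx Sy hc; have := c2 x y c Sx Sy hc; lra.
Qed.

Lemma quadratic_strongly_convex m S (x0 : vec T) :
  strongly_convex_on m S (fun x => m / 2 * fnorm (vsub x x0) ^ 2).
Proof.
move=> x y c _ _ hc.
have -> : vsub (vcomb c x y) x0 = vcomb c (vsub x x0) (vsub y x0) by vring.
rewrite fnorm_sq_comb //.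
have -> : vsub (vsub x x0) (vsub y x0) = vsub x y by vring.
lra.
Qed.

Lemma linear_strongly_convex S (gr x0 : vec T) :
  strongly_convex_on 0 S (fun x => inner gr (vsub x x0)).
Proof.
move=> x y c _ _ hc.
have -> : vsub (vcomb c x y) x0 =
  vadd (vscale c (vsub x x0)) (vscale (1 - c) (vsub y x0)) by vring.
by rewrite !innerE; lra.
Qed.

(* Writing [w] as the average of the points [z + #|T| (w t - z t) e_t] bounds
   [h w - h z] from above by values of [h] on the coordinate axes through [z];
   the lower bound follows by reflecting [w] through [z]. *)
Lemma convex_local_lipschitz S (h : vec T -> R) z :
  is_open S -> convex_set S -> convex_on S h -> S z ->
  exists r C, 0 < r /\ 0 <= C /\ forall w, fnorm (vsub w z) <= r ->
    S w /\ Rabs (h w - h z) <= C * fnorm (vsub w z).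
Proof.
move=> op cS ch Sz; have [rho [rho0 hrho]] := op z Sz.
(* Without coordinates every vector equals [z]; the average used below divides by [#|T|]. *)
case: (posnP #|T|) => [T0|Tpos].
  exists (rho / 2), 0; split; [lra|split; [lra|move=> w hw]].
  have -> : w = z by apply: vec_ext => t; move/card0_eq: T0 => /(_ t).
  by split=> //; rewrite fnorm_subrr Rminus_diag Rabs_R0; lra.
pose n := INR #|T|.
have n1 : 1 <= n by exact: (INR_leq Tpos).
pose e t : vec T := fun s => if s == t then 1 else 0.
have e1 t : fnorm (e t) = 1.
  rewrite /fnorm /inner (bigD1 t) //= big1 /e => [|s /negbTE ->]; last by ring.
  by rewrite eqxx -{3}sqrt_1; congr sqrt; ring.
pose c := rho / 2; have c0 : 0 < c by rewrite /c; lra.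
pose ax t s := vadd z (vscale s (e t)).
have Sax t s : Rabs s <= c -> S (ax t s).
  move=> hs; apply: hrho.
  have -> : vsub (ax t s) z = vscale s (e t) by rewrite /ax; vring.
  by rewrite fnorm_scale e1; rewrite /c in hs; lra.
have [M [M0 hM]] : exists M, 0 <= M /\ forall t,
    h (ax t c) - h z <= M /\ h (ax t (- c)) - h z <= M.
  apply: (@fin_bound T (fun t M => h (ax t c) - h z <= M /\ h (ax t (- c)) - h z <= M)).
    by move=> t a b ab [h1 h2]; lra.
  move=> t; exists (Rmax (h (ax t c) - h z) (h (ax t (- c)) - h z)).
  by split; [exact: Rmax_l | exact: Rmax_r].
have hax t s : Rabs s <= c -> h (ax t s) - h z <= Rabs s / c * M.
  move=> hs; pose sg := if Rle_dec 0 s then c else - c.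
  have cc : 0 <= Rabs s / c <= 1.
    split; first by apply: Rdiv_ge0 => //; exact: Rabs_pos.
    by apply: (Rmult_le_reg_r c) => //; field_simplify; lra.
  have -> : ax t s = vcomb (Rabs s / c) (ax t sg) z.
    rewrite /ax /sg; apply: vec_ext => u; rewrite /vadd /vscale /vcomb.
    by case: Rle_dec => hh /=; [rewrite Rabs_pos_eq // | rewrite Rabs_left; last lra]; field; lra.
  have Ssg : S (ax t sg).
    by apply: Sax; rewrite /sg; case: Rle_dec => ? /=; split_Rabs; lra.
  have := ch _ _ _ Ssg Sz cc.
  have : h (ax t sg) - h z <= M by rewrite /sg; case: Rle_dec => ? /=; case: (hM t).
  nra.
have up w : fnorm (vsub w z) <= c / n -> S w /\ h w - h z <= n / c * M * fnorm (vsub w z).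
  move=> hw; pose s t := n * (w t - z t).
  have hs t : Rabs (s t) <= n * fnorm (vsub w z).
    rewrite /s Rabs_mult Rabs_pos_eq; last by lra.
    by apply: Rmult_le_compat_l; [lra | exact: (coord_le (vsub w z))].
  have hs2 t : Rabs (s t) <= c.
    apply: Rle_trans (hs t) _; have -> : c = n * (c / n) by field; lra.
    by apply: Rmult_le_compat_l; lra.
  have we : (fun u => \big[Rplus/0]_(t : T) (/ n * ax t (s t) u)) = w.
    apply: vec_ext => u; rewrite /ax /vadd /vscale.
    rewrite (eq_bigr (fun t => / n * z u + / n * (s t * e t u))); last by move=> t _; ring.
    rewrite sumR_add sumR_const (bigD1 u) //= big1 => [|t tu]; last first.
      by rewrite /e eq_sym (negbTE tu); ring.
    by rewrite /e eqxx /s -/n; field; lra.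
  have [|||Sw hh] := @convex_combination S h T (fun _ => / n) (fun t => ax t (s t)) cS ch.
  - by move=> _; apply: Rlt_le; apply: Rinv_0_lt_compat; lra.
  - by move=> t; apply: Sax.
  - by rewrite sumR_const -/n; field; lra.
  rewrite we in Sw hh; split=> //.
  have : \big[Rplus/0]_(t : T) (/ n * h (ax t (s t))) <=
         \big[Rplus/0]_(t : T) (/ n * (h z + n * fnorm (vsub w z) / c * M)).
    apply: sumR_le => t; apply: Rmult_le_compat_l.
      by apply: Rlt_le; apply: Rinv_0_lt_compat; lra.
    have := hax t (s t) (hs2 t).
    suff : Rabs (s t) / c * M <= n * fnorm (vsub w z) / c * M by lra.
    apply: Rmult_le_compat_r => //; apply: Rmult_le_compat_r => //.
    by apply: Rlt_le; apply: Rinv_0_lt_compat; lra.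
  rewrite sumR_const -/n.
  have -> : n * (/ n * (h z + n * fnorm (vsub w z) / c * M)) =
            h z + n / c * M * fnorm (vsub w z) by field; lra.
  lra.
have cn : 0 < c / n by apply: Rdiv_lt_0_compat; lra.
exists (c / n), (n / c * M); split=> //; split.
  by apply: Rmult_le_pos => //; apply: Rdiv_ge0; lra.
move=> w hw; have [Sw hw1] := up w hw; split=> //.
pose w' := vsub (vscale 2 z) w.
have ew' : vsub w' z = vsub z w by rewrite /w'; vring.
have nw' : fnorm (vsub w' z) = fnorm (vsub w z) by rewrite ew' fnorm_vsubC.
have [Sw' hw'] : S w' /\ h w' - h z <= n / c * M * fnorm (vsub w z).
  by rewrite -nw'; apply: up; rewrite nw'.
have hh : 0 <= 1 / 2 <= 1 by lra.
have := ch w w' _ Sw Sw' hh.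
have -> : vcomb (1 / 2) w w' = z by rewrite /w'; vring.
by move=> h3; apply: Rabs_le; lra.
Qed.

Lemma convex_cont S S' (h : vec T -> R) : is_open S -> convex_set S -> convex_on S h ->
  subset_of S' S -> cont_on_rel S' h.
Proof.
move=> op cS ch ss z /ss Sz eps e0.
have [r [C [r0 [C0 hr]]]] := convex_local_lipschitz op cS ch Sz.
have C1 : 0 < C + 1 by lra.
exists (Rmin r (eps / (C + 1))); split.
  by apply: Rmin_pos => //; apply: Rdiv_lt_0_compat.
move=> w _ hw; have hw1 := Rmin_l r (eps / (C + 1)); have hw2 := Rmin_r r (eps / (C + 1)).
have [|_ hl] := hr w; first by lra.
have : (C + 1) * fnorm (vsub w z) < eps.
  have -> : eps = (C + 1) * (eps / (C + 1)) by field; lra.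
  by apply: Rmult_lt_compat_l => //; lra.
by have := fnorm_ge0 (vsub w z); nra.
Qed.

(* The local Lipschitz bound at [y] propagates along segments by convexity. *)
Lemma strongly_convex_minorant m S (h : vec T -> R) y :
  0 <= m -> is_open S -> convex_set S -> strongly_convex_on m S h -> S y ->
  exists C, 0 <= C /\ forall z, S z ->
    h y - C * fnorm (vsub z y) + m / 2 * fnorm (vsub z y) ^ 2 <= h z.
Proof.
move=> m0 op cS sc Sy.
have ch := strongly_convex_convex m0 sc.
have [r [C [r0 [C0 hr]]]] := convex_local_lipschitz op cS ch Sy.
exists C; split=> // z Sz.
set d := fnorm (vsub z y); have d0 : 0 <= d by exact: fnorm_ge0.
apply: (@Rpos_le_scale _ _ (m / 2 * d ^ 2)); first by nra.
move=> eps e0.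
(* Small enough for the point at fraction [c] from [y] to [z] to lie in the ball of the local
   Lipschitz bound; [c <= eps] absorbs the loss of the factor [1 - c] in the strong convexity
   term. *)
pose c := Rmin (Rmin 1 eps) (r / (d + 1)).
have c1 : c <= 1 by apply: Rle_trans (Rmin_l _ _) (Rmin_l _ _).
have ce : c <= eps by apply: Rle_trans (Rmin_l _ _) (Rmin_r _ _).
have cr : c * (d + 1) <= r.
  have -> : r = r / (d + 1) * (d + 1) by field; lra.
  by apply: Rmult_le_compat_r; [lra | exact: Rmin_r].
have cp : 0 < c.
  by repeat apply: Rmin_pos; try lra; apply: Rdiv_lt_0_compat; lra.
have e1 : fnorm (vsub (vcomb c z y) y) = c * d.
  have -> : vsub (vcomb c z y) y = vscale c (vsub z y) by vring.
  by rewrite fnorm_scale -/d Rabs_pos_eq; lra.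
have [|_ hl] := hr (vcomb c z y); first by rewrite e1; nra.
rewrite e1 in hl.
have c01 : 0 <= c <= 1 by lra.
have := sc z y c Sz Sy c01; rewrite -/d => h1.
have h2 : - (C * (c * d)) <= h (vcomb c z y) - h y by move: hl; split_Rabs; lra.
have h3 : c * (h y - C * d + m / 2 * (1 - c) * d ^ 2 - h z) <= 0 by nra.
have h4 : h y - C * d + m / 2 * (1 - c) * d ^ 2 - h z <= 0.
  by apply: (Rmult_le_reg_l c) => //; lra.
have : m / 2 * d ^ 2 * c <= m / 2 * d ^ 2 * eps by apply: Rmult_le_compat_l; nra.
nra.
Qed.

(** [argmin_on] carries information only once a minimizer exists. By the quadratic minorant at [y],
    [h] is at least [h y] outside the ball of radius [Rr], so a minimizer over the part of [S'] in
    that ball, which is closed and bounded, minimizes over all of [S']. *)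
Lemma argmin_strongly_convex m S S' (h : vec T -> R) :
  0 < m -> is_open S -> convex_set S -> strongly_convex_on m S h ->
  subset_of S' S -> is_closed S' -> nonempty S' ->
  is_min_on S' h (argmin_on S' h).
Proof.
move=> m0 op cS sc ss cl [y Sy].
suff ex : exists x, is_min_on S' h x by exact: epsilon_spec ex.
have m0' : 0 <= m by lra.
have ch := strongly_convex_convex m0' sc.
have [C [C0 hC]] := strongly_convex_minorant m0' op cS sc (ss y Sy).
pose Rr := 2 * C / m + 1.
pose K z := S' z /\ fnorm (vsub z y) <= Rr.
have R0 : 0 <= Rr by have : 0 <= 2 * C / m; [apply: Rdiv_ge0; lra | rewrite /Rr; lra].
have clK : is_closed K.
  move=> z nK; case: (classic (S' z)) => Sz; last first.
    have [r [r0 hr]] := cl z Sz; exists r; split=> // w hw [Sw _]; exact: hr hw Sw.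
  have hz : Rr < fnorm (vsub z y).
    by case: (Rle_lt_dec (fnorm (vsub z y)) Rr) => // c; case: nK.
  exists (fnorm (vsub z y) - Rr); split; first lra.
  by move=> w hw [_ hw2]; have := fnorm_tri w z y; rewrite (fnorm_vsubC z w); lra.
have bK : bounded_by K (Rr + fnorm y).
  move=> z [_ hz]; have -> : z = vadd (vsub z y) y by vring.
  by apply: Rle_trans (fnorm_add _ _) _; lra.
have Ky : K y by split=> //; rewrite fnorm_subrr.
have [||x [[Sx _] hx]] := @cont_min _ K _ h clK bK.
- by exists y.
- by apply: convex_cont op cS ch _ => z [/ss].
exists x; split=> // z Sz; case: (Rle_dec (fnorm (vsub z y)) Rr) => hz; first exact: hx.
apply: Rle_trans (hx y Ky) _; apply: Rle_trans _ (hC z (ss z Sz)).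
have : m * Rr = 2 * C + m by rewrite /Rr; field; lra.
move=> hr; suff : 0 <= fnorm (vsub z y) * (m / 2 * fnorm (vsub z y) - C) by lra.
by apply: Rmult_le_pos; nra.
Qed.

End Convexity.

(** * Gradients *)

Section Gradients.
Variable T : finType.
Implicit Types (S : vec T -> Prop) (h q g : vec T -> R) (x y z d gr : vec T).

Lemma has_grad_small h x gr d : has_grad h x gr -> forall eps, 0 < eps ->
  exists c0, 0 < c0 /\ forall c, 0 < c < c0 ->
    Rabs (h (vadd x (vscale c d)) - h x - c * inner gr d) <= eps * (c * fnorm d).
Proof.
move=> hg eps e0; have [del [del0 hdel]] := hg eps e0.
have d0 := fnorm_ge0 d.
exists (del / (fnorm d + 1)); split; first by apply: Rdiv_lt_0_compat; lra.
move=> c [c0 hc].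
have e1 : fnorm (vscale c d) = c * fnorm d by rewrite fnorm_scale Rabs_pos_eq; lra.
have := hdel (vscale c d); rewrite e1 inner_scaler; apply.
have : c * (fnorm d + 1) < del.
  have -> : del = del / (fnorm d + 1) * (fnorm d + 1) by field; lra.
  by apply: Rmult_lt_compat_r; lra.
nra.
Qed.

Lemma vcomb_seg c x y : vcomb c y x = vadd x (vscale c (vsub y x)).
Proof. by vring. Qed.

Lemma convex_grad_ineq S h x y gr : convex_on S h -> S x -> S y -> has_grad h x gr ->
  h x + inner gr (vsub y x) <= h y.
Proof.
move=> ch Sx Sy hg.
apply: (@Rpos_le_scale _ _ (fnorm (vsub y x)) (fnorm_ge0 _)) => eps e0.
have [c0 [c00 hc]] := has_grad_small (vsub y x) hg e0.
pose c := Rmin (c0 / 2) 1.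
have hc0 : 0 < c by apply: Rmin_pos; lra.
have hc1 : c <= 1 by exact: Rmin_r.
have hc2 : c < c0 by have := Rmin_l (c0 / 2) 1; rewrite -/c; lra.
have h1 := hc c (conj hc0 hc2).
have c01 : 0 <= c <= 1 by lra.
have := ch y x c Sy Sx c01; rewrite vcomb_seg => h2.
apply: (Rmult_le_reg_l c) => //; move: h1; split_Rabs; lra.
Qed.

Lemma convex_grad_monotone S h x y gx gy : convex_on S h -> S x -> S y ->
  has_grad h x gx -> has_grad h y gy -> 0 <= inner (vsub gx gy) (vsub x y).
Proof.
move=> ch Sx Sy hx hy.
have h1 := convex_grad_ineq ch Sx Sy hx; have h2 := convex_grad_ineq ch Sy Sx hy.
move: h1 h2; rewrite !innerE; lra.
Qed.

Lemma has_grad_linear gr x0 x : has_grad (fun y => inner gr (vsub y x0)) x gr.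
Proof.
move=> eps e0; exists 1; split; first lra.
move=> k _; have := fnorm_ge0 k; rewrite !innerE => k0.
rewrite (_ : _ - _ = 0); last by ring.
by rewrite Rabs_R0; nra.
Qed.

Lemma has_grad_quadratic m x0 x : 0 <= m ->
  has_grad (fun y => m / 2 * fnorm (vsub y x0) ^ 2) x (vscale m (vsub x x0)).
Proof.
move=> m0 eps e0; exists (eps / (m + 1)); split; first by apply: Rdiv_lt_0_compat; lra.
move=> k hk; have k0 := fnorm_ge0 k.
rewrite !fnorm_sq.
have -> : vsub (vadd x k) x0 = vadd (vsub x x0) k by vring.
move: (vsub x x0) => d; rewrite !innerE (inner_sym k d).
rewrite (_ : _ - _ = m / 2 * inner k k); last by field.
rewrite fnormE Rabs_pos_eq; last by nra.
have : (m + 1) * fnorm k < eps.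
  have -> : eps = (m + 1) * (eps / (m + 1)) by field; lra.
  by apply: Rmult_lt_compat_l; lra.
nra.
Qed.

Lemma has_grad_add h q x (a b : vec T) : has_grad h x a -> has_grad q x b ->
  has_grad (fun y => h y + q y) x (vadd a b).
Proof.
move=> H1 H2 eps e0; have e2 : 0 < eps / 2 by lra.
have [d1 [d10 h1]] := H1 _ e2; have [d2 [d20 h2]] := H2 _ e2.
exists (Rmin d1 d2); split; first exact: Rmin_pos.
move=> k hk; have := h1 k (Rlt_le_trans _ _ _ hk (Rmin_l _ _)).
have := h2 k (Rlt_le_trans _ _ _ hk (Rmin_r _ _)).
rewrite inner_addl; split_Rabs; lra.
Qed.

Lemma has_grad_sub h q x (a b : vec T) : has_grad h x a -> has_grad q x b ->
  has_grad (fun y => h y - q y) x (vsub a b).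
Proof.
move=> H1 H2 eps e0; have e2 : 0 < eps / 2 by lra.
have [d1 [d10 h1]] := H1 _ e2; have [d2 [d20 h2]] := H2 _ e2.
exists (Rmin d1 d2); split; first exact: Rmin_pos.
move=> k hk; have := h1 k (Rlt_le_trans _ _ _ hk (Rmin_l _ _)).
have := h2 k (Rlt_le_trans _ _ _ hk (Rmin_r _ _)).
rewrite inner_subl; split_Rabs; lra.
Qed.

Lemma has_grad_seg_derivable h x d t gr : has_grad h (vadd x (vscale t d)) gr ->
  derivable_pt_lim (fun s => h (vadd x (vscale s d))) t (inner gr d).
Proof.
move=> hg eps e0.
have d0 := fnorm_ge0 d.
have e1 : 0 < eps / (fnorm d + 1) by apply: Rdiv_lt_0_compat; lra.
have [del [del0 hdel]] := hg _ e1.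
have p0 : 0 < del / (fnorm d + 1) by apply: Rdiv_lt_0_compat; lra.
exists (mkposreal _ p0) => s s0 /= hs.
have es : eps / (fnorm d + 1) * (fnorm d + 1) = eps by field; lra.
have sp : 0 < Rabs s by exact: Rabs_pos_lt.
have ks : fnorm (vscale s d) < del.
  rewrite fnorm_scale.
  have : Rabs s * (fnorm d + 1) < del.
    have -> : del = del / (fnorm d + 1) * (fnorm d + 1) by field; lra.
    by apply: Rmult_lt_compat_r; lra.
  nra.
have := hdel _ ks.
have -> : vadd (vadd x (vscale t d)) (vscale s d) = vadd x (vscale (t + s) d) by vring.
rewrite fnorm_scale inner_scaler; set a := h _; set b := h _ => hab.
have -> : (a - b) / s - inner gr d = (a - b - s * inner gr d) / s by field.
rewrite /Rdiv Rabs_mult Rabs_inv; apply: (Rmult_lt_reg_r (Rabs s)) => //.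
rewrite Rmult_assoc Rinv_l ?Rmult_1_r; last by lra.
apply: Rle_lt_trans hab _; rewrite -{2}es; nra.
Qed.

Lemma seg_mean_value h (Gr : vec T -> vec T) x d :
  (forall t, 0 <= t <= 1 -> has_grad h (vadd x (vscale t d)) (Gr (vadd x (vscale t d)))) ->
  exists t, 0 <= t <= 1 /\
    h (vadd x d) - h x = inner (Gr (vadd x (vscale t d))) d.
Proof.
move=> hg.
have [||t [ht1 ht2]] := @MVT_cor2 (fun s => h (vadd x (vscale s d)))
   (fun t => inner (Gr (vadd x (vscale t d))) d) 0 1.
- lra.
- by move=> t ht; apply: has_grad_seg_derivable; exact: hg.
exists t; split; first lra.
move: ht1; rewrite Rminus_0_r Rmult_1_r => <-.
have -> : vadd x (vscale 1 d) = vadd x d by vring.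
by have -> : vadd x (vscale 0 d) = x by vring.
Qed.

Lemma seg_in S x d t : convex_set S -> S x -> S (vadd x d) -> 0 <= t <= 1 ->
  S (vadd x (vscale t d)).
Proof.
move=> cS Sx Sd ht; have := cS _ _ _ Sd Sx ht.
by have -> : vcomb t (vadd x d) x = vadd x (vscale t d) by vring.
Qed.

Lemma vadd_subK x y : vadd x (vsub y x) = y.
Proof. by vring. Qed.

Lemma descent_lemma S h (Gr : vec T -> vec T) L x y : convex_set S ->
  (forall z, S z -> has_grad h z (Gr z)) ->
  (forall z w, S z -> S w -> fnorm (vsub (Gr z) (Gr w)) <= L * fnorm (vsub z w)) ->
  S x -> S y ->
  h y <= h x + inner (Gr x) (vsub y x) + L / 2 * fnorm (vsub y x) ^ 2.
Proof.
move=> cS hg hL Sx Sy; set d := vsub y x.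
have ey : y = vadd x d by rewrite /d vadd_subK.
have Sd : S (vadd x d) by rewrite -ey.
pose c := inner (Gr x) d; pose a := L / 2 * fnorm d ^ 2.
have [||t [ht1 ht2]] := @MVT_cor2
   (fun s => h (vadd x (vscale s d)) - (c * s + a * Rsqr s))
   (fun t => inner (Gr (vadd x (vscale t d))) d - (c * 1 + a * (2 * t))) 0 1.
- lra.
- move=> t ht; apply: derivable_pt_lim_minus.
    by apply: has_grad_seg_derivable; apply: hg; exact: seg_in.
  apply: (derivable_pt_lim_plus (fun s => c * s) (fun s => a * Rsqr s)).
    by apply: derivable_pt_lim_scal; exact: derivable_pt_lim_id.
  by apply: derivable_pt_lim_scal; exact: derivable_pt_lim_Rsqr.
move: ht1; rewrite /Rsqr.
have -> : vadd x (vscale 1 d) = y by rewrite ey; vring.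
have -> : vadd x (vscale 0 d) = x by vring.
have t01 : 0 <= t <= 1 by lra.
have := hL _ _ (seg_in cS Sx Sd t01) Sx.
have -> : vsub (vadd x (vscale t d)) x = vscale t d by vring.
rewrite fnorm_scale Rabs_pos_eq; last lra.
set p := vadd x (vscale t d) => h1.
have := cauchy_schwarz (vsub (Gr p) (Gr x)) d; rewrite inner_subl -/c => h2.
have h3 : inner (Gr p) d - c <= L * t * fnorm d ^ 2.
  by have := fnorm_ge0 d; nra.
have h4 : inner (Gr p) d - (c * 1 + a * (2 * t)) <= 0 by rewrite /a; lra.
rewrite -/c -/a; nra.
Qed.

Lemma C1_lipschitz S K C h (Gr : vec T -> vec T) : C1_on S h Gr -> subset_of K S ->
  is_closed K -> bounded_by K C -> convex_set K ->
  exists B, 0 <= B /\ forall x y, K x -> K y -> Rabs (h x - h y) <= B * fnorm (vsub x y).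
Proof.
move=> [hg hc] KS cl bd cK.
have [B [B0 hB]] : exists B, 0 <= B /\ forall t, forall z, K z -> Rabs (Gr z t) <= B.
  apply: (@fin_bound T (fun t B => forall z, K z -> Rabs (Gr z t) <= B)).
    by move=> t a b ab hh z Kz; apply: Rle_trans (hh z Kz) ab.
  move=> t; apply: (cont_bounded cl bd) => z Kz eps e0.
  have [del [del0 hd]] := hc z (KS z Kz) t eps e0.
  by exists del; split=> // w _; exact: hd.
exists (INR #|T| * B); split; first by apply: Rmult_le_pos => //; exact: pos_INR.
move=> x y Kx Ky; have ex := vadd_subK y x.
have Kd : K (vadd y (vsub x y)) by rewrite ex.
have [|t [ht]] := @seg_mean_value h Gr y (vsub x y).
  by move=> t ht; apply: hg; apply: KS; exact: seg_in.
rewrite ex => ->; apply: Rle_trans (cauchy_schwarz_abs _ _) _.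
apply: Rmult_le_compat_r; first exact: fnorm_ge0.
by apply: fnorm_le_coord => s; apply: hB; exact: seg_in.
Qed.

(** The place where second derivatives enter: every component of the gradient is itself C1, hence
    Lipschitz on a closed, bounded and convex set. *)
Lemma C2_grad_lipschitz S K C h (Gr : vec T -> vec T) : C2_on S h Gr -> subset_of K S ->
  is_closed K -> bounded_by K C -> convex_set K ->
  exists B, 0 <= B /\ forall x y, K x -> K y ->
    fnorm (vsub (Gr x) (Gr y)) <= B * fnorm (vsub x y).
Proof.
move=> [_ h2] KS cl bd cK.
have [B [B0 hB]] : exists B, 0 <= B /\ forall t, forall x y, K x -> K y ->
    Rabs (Gr x t - Gr y t) <= B * fnorm (vsub x y).
  apply: (@fin_bound T (fun t B => forall x y, K x -> K y ->
    Rabs (Gr x t - Gr y t) <= B * fnorm (vsub x y))).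
    move=> t a b ab hh x y Kx Ky; apply: Rle_trans (hh x y Kx Ky) _.
    by apply: Rmult_le_compat_r => //; exact: fnorm_ge0.
  move=> t; have [H hH] := h2 t.
  by have [B [_ hB]] := C1_lipschitz hH KS cl bd cK; exists B.
exists (INR #|T| * B); split; first by apply: Rmult_le_pos => //; exact: pos_INR.
move=> x y Kx Ky; rewrite Rmult_assoc; apply: fnorm_le_coord => t; exact: hB.
Qed.

(* Testing convexity and smoothness at the two extra points [p + (d +- u) / 2]
   is the cocoercivity argument restricted to directions available inside [S]. *)
Lemma grad_step_local S h (Gr : vec T -> vec T) L tau p d u : convex_set S ->
  convex_on S h -> (forall z, S z -> has_grad h z (Gr z)) ->
  (forall z w, S z -> S w -> fnorm (vsub (Gr z) (Gr w)) <= L * fnorm (vsub z w)) ->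
  L / 2 <= tau -> fnorm u = fnorm d ->
  S p -> S (vadd p d) -> S (vadd p (vscale (1 / 2) (vadd d u))) ->
  S (vadd p (vscale (1 / 2) (vsub d u))) ->
  Rabs (tau * inner d u - inner (vsub (Gr (vadd p d)) (Gr p)) u) <= tau * fnorm d ^ 2.
Proof.
move=> cS ch hg hL Lt nu Sp; set q := vadd p d => Sq S1 S2.
have core v : fnorm v = fnorm d -> S (vadd p (vscale (1 / 2) (vadd d v))) ->
    S (vadd p (vscale (1 / 2) (vsub d v))) ->
    tau * inner d v - inner (vsub (Gr q) (Gr p)) v <= tau * fnorm d ^ 2.
  move=> nv Sa Sb.
  pose e := vscale (1 / 2) (vsub d v).
  have ea : vadd p (vscale (1 / 2) (vadd d v)) = vadd q (vscale (-1) e).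
    by rewrite /q /e; vring.
  rewrite ea in Sa; rewrite -/e in Sb.
  (* In the sum of the two descent bounds and the two convexity bounds the values of [h] cancel,
     leaving [inner (vsub (Gr p) (Gr q)) v <= L * fnorm e ^ 2]. Since [v] and [d] have equal norms,
     [fnorm e ^ 2] is half of [fnorm d ^ 2 - inner d v], which is nonnegative, so [L / 2] may be
     replaced by [tau]. *)
  have := descent_lemma cS hg hL Sq Sa; have := descent_lemma cS hg hL Sp Sb.
  have := convex_grad_ineq ch Sp Sa (hg _ Sp); have := convex_grad_ineq ch Sq Sb (hg _ Sq).
  have -> : vsub (vadd q (vscale (-1) e)) p = vsub d e by rewrite /q; vring.
  have -> : vsub (vadd q (vscale (-1) e)) q = vscale (-1) e by vring.
  have -> : vsub (vadd p e) q = vsub e d by rewrite /q; vring.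
  have -> : vsub (vadd p e) p = e by vring.
  rewrite !fnorm_sq /e !innerE (inner_sym v d) (fnormE v) (fnormE d) nv.
  have := cauchy_schwarz d v; rewrite nv; nra.
(* The lower bound is [core] at [-u], which exchanges the two extra points. *)
apply: Rabs_le; split; last exact: core.
have := core (vscale (-1) u); rewrite fnorm_scale nu !inner_scaler.
rewrite Rabs_Ropp Rabs_R1 Rmult_1_l => /(_ erefl).
have -> : vadd d (vscale (-1) u) = vsub d u by vring.
have -> : vsub d (vscale (-1) u) = vadd d u by vring.
by move=> /(_ S2 S1); lra.
Qed.

(* Nonexpansiveness of [id - Gr / tau] on [S], tested in directions of [S] only:
   [S] may have empty interior, so [Gr] is subdivided along a slightly shrunk
   copy of the segment [y, x] inside the triangle [y, x, w]. *)
Lemma grad_step_nonexpansive S h (Gr : vec T -> vec T) L tau x y w : convex_set S ->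
  convex_on S h -> (forall z, S z -> has_grad h z (Gr z)) ->
  (forall z w, S z -> S w -> fnorm (vsub (Gr z) (Gr w)) <= L * fnorm (vsub z w)) ->
  0 <= L -> L / 2 <= tau -> S x -> S y -> S w ->
  Rabs (tau * inner (vsub x y) (vsub w y) - inner (vsub (Gr x) (Gr y)) (vsub w y))
    <= tau * (fnorm (vsub x y) * fnorm (vsub w y)).
Proof.
move=> cS ch hg hL L0 Lt Sx Sy Sw.
set v := vsub x y; set u := vsub w y.
have v0 := fnorm_ge0 v; have u0 := fnorm_ge0 u.
case: (Rle_lt_or_eq_dec _ _ v0) => [vp|/esym vz]; last first.
  have -> : x = y by apply: vec_ext => t; have := fnorm_eq0 vz t; rewrite /v /vsub; lra.
  have -> : inner v u = 0.
    by rewrite /inner big1 // => t _; rewrite (fnorm_eq0 vz); ring.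
  rewrite (inner_subl (Gr _)) vz (_ : _ - _ = 0); last by ring.
  by rewrite Rabs_R0; lra.
case: (Rle_lt_or_eq_dec _ _ u0) => [up|/esym uz]; last first.
  have z A : inner A u = 0.
    by rewrite /inner big1 // => t _; rewrite (fnorm_eq0 uz); ring.
  by rewrite !z uz Rmult_0_r Rminus_0_r Rabs_R0; lra.
(* Coordinates of the triangle [y], [x], [w] with origin [y]. *)
pose P a b := vadd y (vadd (vscale a v) (vscale b u)).
have SP a b : 0 <= a -> 0 <= b -> a + b <= 1 -> S (P a b).
  move=> a0 b0 ab; case: (Req_dec b 1) => b1.
    have -> : P a b = w by rewrite /P (_ : a = 0) ?b1 /u; [vring|lra].
    exact: Sw.
  have b1' : 0 < 1 - b by lra.
  have c1 : 0 <= a / (1 - b) <= 1.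
    split; first by apply: Rdiv_ge0.
    by apply: (Rmult_le_reg_r (1 - b)) => //; field_simplify; lra.
  have c2 : 0 <= b <= 1 by lra.
  have := cS _ _ _ Sw (cS _ _ _ Sx Sy c1) c2.
  have -> // : vcomb b w (vcomb (a / (1 - b)) x y) = P a b.
  by rewrite /P /u /v; vring; lra.
(* [grad_step_local] wants a test direction as long as the step; [r] rescales [u] to the length of
   [v]. *)
pose r := fnorm v / fnorm u; have r0 : 0 < r by apply: Rdiv_lt_0_compat.
have ru : r * fnorm u = fnorm v by rewrite /r; field; lra.
(* The segment from [P eta eta] to [P (1 - 2 * eta) eta] keeps a margin [eta] from the sides of the
   triangle. It is cut into [N] pieces so short that the sideways shift [r * c / 2] of the extra
   points stays within that margin. *)
have main eta : 0 < eta -> eta <= 1 / 4 ->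
    Rabs (tau * ((1 - 3 * eta) * inner v u)
          - inner (vsub (Gr (P (1 - 2 * eta) eta)) (Gr (P eta eta))) u)
      <= tau * (fnorm v * fnorm u).
  move=> e0 e1; pose s := 1 - 3 * eta; have s0 : 1 / 4 <= s <= 1 by rewrite /s; lra.
  have [N hN] := INR_unbounded (r / eta).
  have Np : 0 < INR N.
    by apply: Rlt_trans hN; apply: Rdiv_lt_0_compat.
  pose c := s / INR N; have c0 : 0 < c by apply: Rdiv_lt_0_compat; lra.
  have cN : INR N * c = s by rewrite /c; field; lra.
  have rc : r * c <= eta.
    have h1 : r < INR N * eta.
      have -> : r = r / eta * eta by field; lra.
      by apply: Rmult_lt_compat_r.
    apply: (Rmult_le_reg_r (INR N)) => //.
    have -> : r * c * INR N = r * (INR N * c) by ring.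
    by rewrite cN; nra.
  pose p k := P (eta + INR k * c) eta.
  have step k : (k < N)%nat ->
      Rabs (tau * (c * inner v u) - inner (vsub (Gr (p k.+1)) (Gr (p k))) u)
        <= c * (tau * (fnorm v * fnorm u)).
    move=> kN; have hk : INR k + 1 <= INR N by rewrite -S_INR; exact: INR_leq.
    have k0 := pos_INR k.
    have kc : INR k * c + c <= s by rewrite -cN; nra.
    have kc0 : 0 <= INR k * c by nra.
    have ep : p k.+1 = vadd (p k) (vscale c v).
      by rewrite /p /P S_INR; vring.
    have := @grad_step_local S h Gr L tau (p k) (vscale c v) (vscale (c * r) u)
      cS ch hg hL Lt; rewrite -ep.
    have -> : vadd (p k) (vscale (1 / 2) (vadd (vscale c v) (vscale (c * r) u))) =
              P (eta + INR k * c + c / 2) (eta + r * c / 2) by rewrite /p /P; vring.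
    have -> : vadd (p k) (vscale (1 / 2) (vsub (vscale c v) (vscale (c * r) u))) =
              P (eta + INR k * c + c / 2) (eta - r * c / 2) by rewrite /p /P; vring.
    rewrite !fnorm_scale !inner_scalel !inner_scaler Rabs_mult.
    rewrite !(Rabs_pos_eq c) ?(Rabs_pos_eq r); try lra.
    move=> /(_ _ _ _ _ _) H.
    have crp : 0 < c * r by nra.
    have /H hh : c * r * fnorm u = c * fnorm v by rewrite Rmult_assoc ru.
    have {}hh : Rabs (tau * (c * (c * r * inner v u)) -
        c * r * inner (vsub (Gr (p k.+1)) (Gr (p k))) u) <= tau * (c * fnorm v) ^ 2.
      by apply: hh; try (apply: SP; rewrite /s in kc; nra);
        rewrite /p S_INR; apply: SP; rewrite /s in kc; nra.
    apply: (Rmult_le_reg_l (c * r)) => //.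
    rewrite -{1}(Rabs_pos_eq (c * r)); last lra.
    rewrite -Rabs_mult.
    have -> : c * r * (tau * (c * inner v u) - inner (vsub (Gr (p k.+1)) (Gr (p k))) u) =
      tau * (c * (c * r * inner v u)) - c * r * inner (vsub (Gr (p k.+1)) (Gr (p k))) u by ring.
    apply: Rle_trans hh _.
    have -> : c * r * (c * (tau * (fnorm v * fnorm u))) =
      c * c * tau * fnorm v * (r * fnorm u) by ring.
    by rewrite ru; lra.
  have tele k : (k <= N)%nat ->
      Rabs (tau * (INR k * c * inner v u) - inner (vsub (Gr (p k)) (Gr (p 0%nat))) u)
        <= INR k * (c * (tau * (fnorm v * fnorm u))).
    elim: k => [|k IH] kN.
      by rewrite /= (inner_subl (Gr _)) !Rmult_0_l !Rminus_diag Rmult_0_r Rminus_0_r Rabs_R0; lra.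
    have := IH (ltnW kN); have := step k kN; rewrite S_INR !(inner_subl (Gr _)); split_Rabs; lra.
  have := tele N (leqnn N); rewrite /p cN.
  have -> : eta + s = 1 - 2 * eta by rewrite /s; lra.
  rewrite Rmult_0_l Rplus_0_r -(Rmult_assoc (INR N) c) cN => hh.
  apply: Rle_trans hh _; have : 0 <= tau * (fnorm v * fnorm u) by apply: Rmult_le_pos; nra.
  nra.
have tau0 : 0 <= tau by lra.
(* Let [eta] tend to 0: the ends of the shrunk segment are at distance proportional to [eta] from
   [y] and [x], and [Gr] is Lipschitz. The factor of [eps] collects these errors and the lost length
   [3 * eta]. *)
apply: (@Rpos_le_scale _ _ (3 * tau * Rabs (inner v u) +
   L * (fnorm (vsub u (vscale 2 v)) + fnorm (vadd v u)) * fnorm u)).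
  have := Rabs_pos (inner v u); have := fnorm_ge0 (vsub u (vscale 2 v)).
  have := fnorm_ge0 (vadd v u) => h1 h2 h3.
  by apply: Rplus_le_le_0_compat; repeat apply: Rmult_le_pos; lra.
move=> eps e0; pose eta := Rmin eps (1 / 4).
have eta0 : 0 < eta by apply: Rmin_pos; lra.
have eta1 : eta <= 1 / 4 by exact: Rmin_r.
have eta2 : eta <= eps by exact: Rmin_l.
have hm := main eta eta0 eta1.
have SN : S (P (1 - 2 * eta) eta) by apply: SP; lra.
have S0 : S (P eta eta) by apply: SP; lra.
have n1 := hL _ _ SN Sx; have n2 := hL _ _ S0 Sy.
have q1 : fnorm (vsub (P (1 - 2 * eta) eta) x) = eta * fnorm (vsub u (vscale 2 v)).
  have -> : vsub (P (1 - 2 * eta) eta) x = vscale eta (vsub u (vscale 2 v)).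
    by rewrite /P /v; vring.
  by rewrite fnorm_scale Rabs_pos_eq; lra.
have q2 : fnorm (vsub (P eta eta) y) = eta * fnorm (vadd v u).
  have -> : vsub (P eta eta) y = vscale eta (vadd v u) by rewrite /P; vring.
  by rewrite fnorm_scale Rabs_pos_eq; lra.
rewrite q1 in n1; rewrite q2 in n2.
have c1 := cauchy_schwarz_abs (vsub (Gr (P (1 - 2 * eta) eta)) (Gr x)) u.
have c2 := cauchy_schwarz_abs (vsub (Gr (P eta eta)) (Gr y)) u.
set a1 := fnorm (vsub u _) in n1 *; set a2 := fnorm (vadd v u) in n2 *.
have a10 : 0 <= a1 by exact: fnorm_ge0.
have a20 : 0 <= a2 by exact: fnorm_ge0.
have m1 : fnorm (vsub (Gr (P (1 - 2 * eta) eta)) (Gr x)) * fnorm u <= L * a1 * fnorm u * eta.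
  by have := Rmult_le_compat_r _ _ _ u0 n1; lra.
have m2 : fnorm (vsub (Gr (P eta eta)) (Gr y)) * fnorm u <= L * a2 * fnorm u * eta.
  by have := Rmult_le_compat_r _ _ _ u0 n2; lra.
set B := Rabs (inner v u).
have B0 : 0 <= B by exact: Rabs_pos.
have hB : Rabs (3 * eta * tau * inner v u) = 3 * tau * B * eta.
  by rewrite Rabs_mult Rabs_pos_eq -/B; [ring | nra].
have fin : (3 * tau * B + L * (a1 + a2) * fnorm u) * eta <=
           (3 * tau * B + L * (a1 + a2) * fnorm u) * eps.
  apply: Rmult_le_compat_l => //.
  by apply: Rplus_le_le_0_compat; repeat apply: Rmult_le_pos; lra.
have := Rle_trans _ _ _ c1 m1; have := Rle_trans _ _ _ c2 m2.
move: hm hB; rewrite !(inner_subl (Gr _)); move: fin; clear.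
set X1 := inner (Gr x) u; set X2 := inner (Gr y) u.
set X3 := inner (Gr _) u; set X4 := inner (Gr _) u => fin hm hB k1 k2.
have : Rabs (tau * inner v u - (X1 - X2)) <=
  Rabs (tau * ((1 - 3 * eta) * inner v u) - (X3 - X4)) + Rabs (3 * eta * tau * inner v u)
  + Rabs (X4 - X2) + Rabs (X3 - X1).
  have -> : tau * inner v u - (X1 - X2) =
    (tau * ((1 - 3 * eta) * inner v u) - (X3 - X4)) + 3 * eta * tau * inner v u
     - (X4 - X2) + (X3 - X1) by ring.
  by split_Rabs; lra.
rewrite hB; lra.
Qed.

(** Compare [x] with the point at a small fraction [c] of the way to [y], divide by [c] and let it
    tend to 0. The strong convexity of [g] survives as the quadratic term, the source of all
    contraction factors for the X-steps. *)
Lemma prox_optimality m S q g (obj : vec T -> R) x gr : convex_set S ->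
  strongly_convex_on m S g -> (forall y, obj y = q y + g y) -> is_min_on S obj x ->
  has_grad q x gr -> forall y, S y ->
  m / 2 * fnorm (vsub y x) ^ 2 <= inner gr (vsub y x) + g y - g x.
Proof.
move=> cS sg eo [Sx hx] hg y Sy.
set d := vsub y x; have d0 := fnorm_ge0 d.
apply: (@Rpos_le_scale _ _ (fnorm d + Rabs m * fnorm d ^ 2)).
  by have := Rabs_pos m; nra.
move=> eps e0; have [c0 [c00 hc]] := has_grad_small d hg e0.
pose c := Rmin (c0 / 2) (Rmin 1 eps).
have hc0 : 0 < c by repeat apply: Rmin_pos; lra.
have hc1 : c <= 1 by apply: Rle_trans (Rmin_r _ _) (Rmin_l _ _).
have hce : c <= eps by apply: Rle_trans (Rmin_r _ _) (Rmin_r _ _).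
have hc2 : c < c0 by have := Rmin_l (c0 / 2) (Rmin 1 eps); rewrite -/c; lra.
have c01 : 0 <= c <= 1 by lra.
have h1 := hc c (conj hc0 hc2).
have := hx _ (cS _ _ _ Sy Sx c01); have := sg _ _ _ Sy Sx c01.
rewrite !eo vcomb_seg -/d => h2 h3.
have h4 : c * (m / 2 * fnorm d ^ 2 * (1 - c)) <=
          c * (inner gr d + g y - g x + eps * fnorm d) by move: h1; split_Rabs; lra.
have h5 := Rmult_le_reg_l _ _ _ hc0 h4.
have h6 : m * fnorm d ^ 2 * c <= Rabs m * fnorm d ^ 2 * eps.
  have := Rle_abs m; have := Rabs_pos m => p1 p2.
  have dd : 0 <= fnorm d ^ 2 by exact: pow2_ge_0.
  apply: (Rle_trans _ (Rabs m * fnorm d ^ 2 * c)).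
    by repeat (apply: Rmult_le_compat_r => //; try lra).
  by apply: Rmult_le_compat_l => //; exact: Rmult_le_pos.
have h7 : 0 <= Rabs m * fnorm d ^ 2 * eps.
  by have := Rabs_pos m => p1; repeat apply: Rmult_le_pos; lra.
lra.
Qed.

(** Adding the two inequalities cancels [g]. In the applications [a] and [a'] contain proximal
    terms, and subtracting [tau] times the difference of the solutions leaves the mismatch of the
    data. *)
Lemma vi_stability (g : vec T -> R) tau y y' a a' : 0 < tau ->
  0 <= inner a (vsub y' y) + g y' - g y -> 0 <= inner a' (vsub y y') + g y - g y' ->
  tau * fnorm (vsub y y') <= fnorm (vsub (vsub a a') (vscale tau (vsub y y'))).
Proof.
move=> t0 h1 h2; set r := vsub (vsub a a') _.
have n0 := fnorm_ge0 (vsub y y').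
case: (Rle_lt_or_eq_dec _ _ n0) => [np|<-]; last by rewrite Rmult_0_r; exact: fnorm_ge0.
apply: (Rmult_le_reg_r (fnorm (vsub y y'))) => //.
have := cauchy_schwarz r (vsub y' y); rewrite (fnorm_vsubC y' y).
suff : tau * fnorm (vsub y y') * fnorm (vsub y y') <= inner r (vsub y' y) by lra.
rewrite Rmult_assoc -fnormE /r.
move: h1 h2; rewrite !innerE (inner_sym y' y); lra.
Qed.

Lemma surrogate_strongly_convex tau S h lin gr Y0 : convex_on S h ->
  strongly_convex_on tau S (surrogate lin h gr tau Y0).
Proof.
move=> ch; rewrite -{1}(Rplus_0_l tau).
apply: strongly_convex_add; last exact: quadratic_strongly_convex.
case: lin; [exact: linear_strongly_convex | exact: convex_strongly0].
Qed.

Lemma surrogate_has_grad tau h lin (Gr : vec T -> vec T) Y0 Y : 0 <= tau ->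
  has_grad h Y (Gr Y) -> has_grad (surrogate lin h (Gr Y0) tau Y0) Y
    (vadd (Gr (if lin then Y0 else Y)) (vscale tau (vsub Y Y0))).
Proof.
move=> t0 hg; apply: has_grad_add; last exact: has_grad_quadratic.
by case: lin => //; exact: has_grad_linear.
Qed.

End Gradients.

(** * Partial gradients of a jointly differentiable function *)

Section PartialGradients.
Variables (S T : finType) (f : vec S -> vec T -> R).

Lemma vadd_pair (x k : vec S) (y l : vec T) :
  vadd (pairv x y) (pairv k l) = pairv (vadd x k) (vadd y l).
Proof. by apply: vec_ext; case. Qed.

Lemma vsub_pair (x k : vec S) (y l : vec T) :
  vsub (pairv x y) (pairv k l) = pairv (vsub x k) (vsub y l).
Proof. by apply: vec_ext; case. Qed.

Lemma inner_pair (x k : vec S) (y l : vec T) :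
  inner (pairv x y) (pairv k l) = inner x k + inner y l.
Proof. by rewrite /inner big_sumType. Qed.

Lemma fstv_pair (x : vec S) (y : vec T) : fstv (pairv x y) = x. Proof. by []. Qed.
Lemma sndv_pair (x : vec S) (y : vec T) : sndv (pairv x y) = y. Proof. by []. Qed.

Let zeroS : vec S := fun _ => 0.
Let zeroT : vec T := fun _ => 0.

Lemma has_grad_fst D X gd gx :
  has_grad (fun z => f (fstv z) (sndv z)) (pairv D X) (pairv gd gx) ->
  has_grad (fun D' => f D' X) D gd.
Proof.
move=> hg eps e0; have [d [d0 hd]] := hg eps e0; exists d; split=> // k hk.
have nk : fnorm (pairv k zeroT) = fnorm k.
  rewrite /fnorm inner_pair [inner zeroT _]big1 ?Rplus_0_r // => t _.
  by rewrite /zeroT; ring.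
have := hd (pairv k zeroT); rewrite nk vadd_pair inner_pair => /(_ hk).
rewrite !fstv_pair !sndv_pair.
have -> : vadd X zeroT = X by rewrite /zeroT; vring.
by rewrite [inner gx _]big1 ?Rplus_0_r // => t _; rewrite /zeroT; ring.
Qed.

Lemma has_grad_snd D X gd gx :
  has_grad (fun z => f (fstv z) (sndv z)) (pairv D X) (pairv gd gx) ->
  has_grad (f D) X gx.
Proof.
move=> hg eps e0; have [d [d0 hd]] := hg eps e0; exists d; split=> // k hk.
have nk : fnorm (pairv zeroS k) = fnorm k.
  rewrite /fnorm inner_pair [inner zeroS _]big1 ?Rplus_0_l // => t _.
  by rewrite /zeroS; ring.
have := hd (pairv zeroS k); rewrite nk vadd_pair inner_pair => /(_ hk).
rewrite !fstv_pair !sndv_pair.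
have -> : vadd D zeroS = D by rewrite /zeroS; vring.
by rewrite [inner gd _]big1 ?Rplus_0_l // => t _; rewrite /zeroS; ring.
Qed.

End PartialGradients.

(** * Scalar sequences *)

Section ScalarSequences.
Implicit Types a b c : nat -> R.

Fixpoint psum a (N : nat) : R := if N is S k then psum a k + a k else 0.

Definition summable a := exists C, forall N, psum a N <= C.
Definition cv0 a := forall eps, 0 < eps -> exists N, forall k, (N <= k)%nat -> a k < eps.

Lemma psumS a N : psum a N.+1 = psum a N + a N. Proof. by []. Qed.

Lemma psum_le a b N : (forall k, a k <= b k) -> psum a N <= psum b N.
Proof. by move=> h; elim: N => [|N IH] /=; [lra | have := h N; lra]. Qed.

Lemma psum_le_lt a b N : (forall k, (k < N)%nat -> a k <= b k) -> psum a N <= psum b N.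
Proof.
elim: N => [|N IH] h /=; first lra.
by have := h N (leqnn _); have := IH (fun k kN => h k (leqW kN)); lra.
Qed.

Lemma psum_ge0 a N : (forall k, 0 <= a k) -> 0 <= psum a N.
Proof. by move=> h; elim: N => [|N IH] /=; [lra | have := h N; lra]. Qed.

Lemma psum_add a b N : psum (fun k => a k + b k) N = psum a N + psum b N.
Proof. by elim: N => [|N IH] /=; [lra | rewrite IH; lra]. Qed.

Lemma psum_scale x a N : psum (fun k => x * a k) N = x * psum a N.
Proof. by elim: N => [|N IH] /=; [lra | rewrite IH; lra]. Qed.

Lemma psum_cat a m l : psum a (m + l)%nat = psum a m + psum (fun k => a (m + k)%nat) l.
Proof. by elim: l => [|l IH]; [rewrite addn0 /=; lra | rewrite addnS /= IH; lra]. Qed.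

Lemma psum_recl a N : psum a N.+1 = a 0%nat + psum (fun k => a k.+1) N.
Proof.
elim: N => [|N IH]; first by rewrite /=; ring.
by rewrite -[LHS]/(psum a N.+1 + a N.+1) IH /=; ring.
Qed.

Lemma psum_sum_f_R0 a N : sum_f_R0 a N = psum a N.+1.
Proof. by elim: N => [|N IH] /=; [lra | rewrite IH /=; lra]. Qed.

Lemma psum_mono a m n : (forall k, 0 <= a k) -> (m <= n)%nat -> psum a m <= psum a n.
Proof.
move=> h mn; rewrite -(subnKC mn) psum_cat.
by have := @psum_ge0 (fun k => a (m + k)%nat) (n - m)%nat (fun k => h _); lra.
Qed.

Lemma psum_tele a m l :
  Rabs (a (m + l)%nat - a m) <= psum (fun k => Rabs (a (m + k).+1 - a (m + k)%nat)) l.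
Proof.
elim: l => [|l IH] /=; first by rewrite addn0 Rminus_diag Rabs_R0; lra.
by rewrite addnS; move: IH; split_Rabs; lra.
Qed.

Lemma psum_sumI (I : nat) (F : 'I_I -> nat -> R) N :
  psum (fun k => \big[Rplus/0]_(i < I) F i k) N = \big[Rplus/0]_(i < I) psum (F i) N.
Proof.
elim: N => [|N IH]; first by rewrite [RHS]sumI_const /=; ring.
by rewrite psumS IH -sumI_add.
Qed.

Lemma summable_le a b : (forall k, a k <= b k) -> summable b -> summable a.
Proof. by move=> h [C hC]; exists C => N; apply: Rle_trans (psum_le _ h) (hC N). Qed.

Lemma summable_add a b : summable a -> summable b -> summable (fun k => a k + b k).
Proof.
move=> [C hC] [D hD]; exists (C + D) => N; rewrite psum_add.
by have := hC N; have := hD N; lra.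
Qed.

Lemma summable_scale x a : 0 <= x -> summable a -> summable (fun k => x * a k).
Proof.
by move=> x0 [C hC]; exists (x * C) => N; rewrite psum_scale; apply: Rmult_le_compat_l.
Qed.

Lemma summable_shift m a : (forall k, 0 <= a k) -> summable a ->
  summable (fun k => a (m + k)%nat).
Proof.
move=> h [C hC]; exists C => N; have := hC (m + N)%nat; rewrite psum_cat.
by have := psum_ge0 m h; lra.
Qed.

Lemma summable_unshift a : summable (fun k => a k.+1) -> summable a.
Proof.
move=> [C hC]; exists (Rabs (a 0%nat) + Rabs C) => -[|N].
  by rewrite /=; have := Rabs_pos (a 0%nat); have := Rabs_pos C; lra.
by rewrite psum_recl; have := hC N; have := Rle_abs C; have := Rle_abs (a 0%nat); lra.
Qed.

Lemma growing_bounded_cv a C : (forall k, a k <= a k.+1) -> (forall k, a k <= C) ->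
  exists l, Un_cv a l.
Proof.
move=> gr bd; apply: Un_cv_crit; first exact: gr.
by exists C => x [k ->].
Qed.

Lemma sum_f_R0_cv_summable a : (forall k, 0 <= a k) ->
  (exists l, Un_cv (fun N => sum_f_R0 a N) l) -> summable a.
Proof.
move=> h [l hl]; exists l => N; apply: (Rle_trans _ (psum a N.+1)); first exact: psum_mono.
rewrite -psum_sum_f_R0; apply: (growing_ineq _ _ _ hl) => k.
by rewrite !psum_sum_f_R0 [X in _ <= X]psumS; have := h k.+1; lra.
Qed.

Lemma summable_tail a : (forall k, 0 <= a k) -> summable a -> forall eps, 0 < eps ->
  exists N, forall m l, (N <= m)%nat -> psum (fun k => a (m + k)%nat) l < eps.
Proof.
move=> h [C hC] eps e0.
have [l hl] := @growing_bounded_cv (psum a) C (fun k => ltac:(simpl; have := h k; lra)) hC.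
have e2 : 0 < eps / 2 by lra.
have [N hN] := hl _ e2; exists N => m k Nm.
have h1 := hN m (elimT leP Nm).
have h2 := hN (m + k)%nat (elimT leP (leq_trans Nm (leq_addr _ _))).
by move: h1 h2; rewrite /Rdist psum_cat; split_Rabs; lra.
Qed.

Lemma summable_cv0 a : (forall k, 0 <= a k) -> summable a -> cv0 a.
Proof.
move=> h s eps e0; have [N hN] := summable_tail h s e0; exists N => k Nk.
by have := hN k 1%nat Nk; rewrite /= addn0; lra.
Qed.

Lemma cv0_le a b : (forall k, a k <= b k) -> cv0 b -> cv0 a.
Proof.
move=> h cb eps e0; have [N hN] := cb eps e0; exists N => k Nk.
by have := hN k Nk; have := h k; lra.
Qed.

Lemma cv0_add a b : cv0 a -> cv0 b -> cv0 (fun k => a k + b k).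
Proof.
move=> ca cb eps e0; have e2 : 0 < eps / 2 by lra.
have [N hN] := ca _ e2; have [M hM] := cb _ e2; exists (maxn N M) => k.
by rewrite geq_max => /andP[h1 h2]; have := hN k h1; have := hM k h2; lra.
Qed.

Lemma cv0_scale x a : 0 <= x -> cv0 a -> cv0 (fun k => x * a k).
Proof.
move=> x0 ca eps e0; have x1 : 0 < x + 1 by lra.
have e1 := Rdiv_lt_0_compat _ _ e0 x1.
have [N hN] := ca _ e1; exists N => k Nk; have := hN k Nk => h.
have : (x + 1) * a k < eps.
  have -> : eps = (x + 1) * (eps / (x + 1)) by field; lra.
  exact: Rmult_lt_compat_l.
case: (Rle_dec 0 (a k)) => c; nra.
Qed.

Lemma cv0_unshift a : cv0 (fun k => a k.+1) -> cv0 a.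
Proof. by move=> ca eps e0; have [N hN] := ca _ e0; exists N.+1 => -[|k] // Nk; exact: hN. Qed.

Lemma cv0_drop N a : cv0 (fun k => a (N + k)%nat) -> cv0 a.
Proof.
move=> ca eps e0; have [M hM] := ca _ e0; exists (N + M)%nat => k hk.
have Nk : (N <= k)%nat by apply: leq_trans hk; exact: leq_addr.
by rewrite -(subnKC Nk); apply: hM; rewrite leq_subRL.
Qed.

Lemma cv0_add_index N a : cv0 a -> cv0 (fun k => a (N + k)%nat).
Proof.
move=> ca eps e0; have [M hM] := ca _ e0; exists M => k hk.
by apply: hM; apply: leq_trans hk _; exact: leq_addl.
Qed.

Lemma cv0_sqr a : cv0 (fun k => a k ^ 2) -> cv0 a.
Proof.
move=> ca eps e0; have e2 : 0 < eps ^ 2 by nra.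
have [N hN] := ca _ e2; exists N => k Nk; have := hN k Nk => h.
by apply: Rnot_le_lt => c; nra.
Qed.

Lemma cv0_Un_cv a l : cv0 (fun k => Rabs (a k - l)) -> Un_cv a l.
Proof.
move=> ca eps e0; have [N hN] := ca eps e0; exists N => k /leP Nk; exact: hN.
Qed.

Lemma Un_cv_cv0 a l : Un_cv a l -> cv0 (fun k => Rabs (a k - l)).
Proof.
move=> ca eps e0; have [N hN] := ca eps e0; exists N => k /leP Nk; exact: hN.
Qed.

Lemma recursion_psum rho a b N : 0 <= rho < 1 -> (forall k, 0 <= a k) ->
  (forall k, 0 <= b k) -> (forall k, a k.+1 <= rho * a k + b k) ->
  (1 - rho) * psum a N <= a 0%nat + psum b N.
Proof.
move=> hr a0 b0 rec.
have key m : psum a m.+1 <= a 0%nat + rho * psum a m + psum b m.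
  by elim: m => [|m IH] /=; [lra | have := rec m; move: IH => /=; lra].
case: N => [|N]; first by rewrite /=; have := a0 0%nat; lra.
have := key N; have := b0 N; have := a0 N; have := psum_ge0 N a0.
have : rho * psum a N <= rho * psum a N.+1.
  by apply: Rmult_le_compat_l; [lra | exact: psum_mono].
move=> /=; lra.
Qed.

(** Convexity of the square at [rho * a k + (1 - rho) * (b k / (1 - rho))]: squaring keeps the same
    ratio [rho]. *)
Lemma recursion_sqr rho a b : 0 <= rho < 1 -> (forall k, 0 <= a k) ->
  (forall k, 0 <= b k) -> (forall k, a k.+1 <= rho * a k + b k) ->
  forall k, a k.+1 ^ 2 <= rho * a k ^ 2 + / (1 - rho) * b k ^ 2.
Proof.
move=> hr a0 b0 rec k; have ak := a0 k; have bk := b0 k; have ak1 := a0 k.+1.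
apply: (Rle_trans _ ((rho * a k + b k) ^ 2)).
  by apply: pow_incr; split; [exact: ak1 | exact: rec].
apply: (Rmult_le_reg_l (1 - rho)); first lra.
have -> : (1 - rho) * (rho * a k ^ 2 + / (1 - rho) * b k ^ 2) =
  (1 - rho) * rho * a k ^ 2 + b k ^ 2 by field; lra.
have : 0 <= rho * ((1 - rho) * a k - b k) ^ 2.
  by apply: Rmult_le_pos; [lra | exact: pow2_ge_0].
lra.
Qed.

Lemma recursion_summable rho a b : 0 <= rho < 1 -> (forall k, 0 <= a k) ->
  (forall k, 0 <= b k) -> (forall k, a k.+1 <= rho * a k + b k) ->
  summable b -> summable a.
Proof.
move=> hr a0 b0 rec [C hC]; exists (/ (1 - rho) * (a 0%nat + C)) => N.
apply: (Rmult_le_reg_l (1 - rho)); first lra.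
rewrite -Rmult_assoc Rinv_r ?Rmult_1_l; last lra.
by have := recursion_psum N hr a0 b0 rec; have := hC N; lra.
Qed.

Lemma recursion_sqr_summable rho a b : 0 <= rho < 1 -> (forall k, 0 <= a k) ->
  (forall k, 0 <= b k) -> (forall k, a k.+1 <= rho * a k + b k) ->
  summable (fun k => b k ^ 2) -> summable (fun k => a k ^ 2).
Proof.
move=> hr a0 b0 rec sb.
apply: (@recursion_summable rho (fun k => a k ^ 2) (fun k => / (1 - rho) * b k ^ 2)) => //;
  last by apply: summable_scale => //; apply: Rlt_le; apply: Rinv_0_lt_compat; lra.
- by move=> k; exact: pow2_ge_0.
- move=> k; apply: Rmult_le_pos; last exact: pow2_ge_0.
  by apply: Rlt_le; apply: Rinv_0_lt_compat; lra.
- exact: recursion_sqr.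
Qed.

Lemma recursion_bounded rho a C : 0 <= rho < 1 -> 0 <= C ->
  (forall k, a k.+1 <= rho * a k + C) -> exists B, forall k, a k <= B.
Proof.
move=> hr C0 rec; exists (Rmax (a 0%nat) (C / (1 - rho))) => k.
set B := Rmax _ _; elim: k => [|k IH]; first exact: Rmax_l.
have : C <= (1 - rho) * B.
  have -> : C = (1 - rho) * (C / (1 - rho)) by field; lra.
  by apply: Rmult_le_compat_l; [lra | exact: Rmax_r].
by have := rec k; have : rho * a k <= rho * B by [apply: Rmult_le_compat_l; lra]; lra.
Qed.

(** Deterministic Robbins-Siegmund argument: [psum b - V] is nondecreasing and bounded above, so it
    converges, and [V] converges together with [psum b]. *)
Lemma quasi_descent V a b lb : (forall k, 0 <= a k) -> (forall k, 0 <= b k) ->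
  summable b -> (forall k, lb <= V k) -> (forall k, V k.+1 <= V k - a k + b k) ->
  summable a /\ exists l, Un_cv V l.
Proof.
move=> a0 b0 [C hC] hlb rec.
have sa N : psum a N <= V 0%nat - lb + C.
  have : V N <= V 0%nat - psum a N + psum b N.
    by elim: N => [|N IH]; [rewrite /=; lra | have := rec N; rewrite !psumS; lra].
  by have := hlb N; have := hC N; lra.
split; first by exists (V 0%nat - lb + C).
have [l1 h1] := @growing_bounded_cv (psum b) C (fun k => ltac:(simpl; have := b0 k; lra)) hC.
have [||l2 h2] := @growing_bounded_cv (fun k => psum b k - V k) (C - lb).
- by move=> k /=; have := rec k; have := a0 k; lra.
- by move=> k; have := hC k; have := hlb k; lra.
exists (l1 - l2) => eps e0.
have [N hN] := CV_minus _ _ _ _ h1 h2 eps e0; exists N => n Nn.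
have := hN n Nn; have -> // : psum b n - (psum b n - V n) = V n by ring.
Qed.

(* The tracking error [qT] is driven by the increments [x], which only the
   descent controls; adding a small multiple of [qT ^ 2] to [V] lets the descent
   of one and the contraction of the other compensate each other. *)
Lemma descent_summable (V gam dd dx q qT x : nat -> R) (c1 c2 C CT Cx rho lb : R) :
  0 < c1 -> 0 < c2 -> 0 <= C -> 0 <= Cx -> 0 <= CT -> 0 <= rho < 1 ->
  (forall k, 0 <= gam k) -> (forall k, 0 <= dd k) -> (forall k, 0 <= dx k) ->
  (forall k, 0 <= q k) -> (forall k, 0 <= qT k) -> (forall k, 0 <= x k) ->
  (forall k, V k.+1 <= V k - c1 * (gam k * dd k) - c2 * dx k
     + C * (gam k ^ 2 + q k ^ 2 + gam k * qT k)) ->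
  (forall k, qT k.+1 <= rho * qT k + CT * (q k + gam k + x k)) ->
  (forall k, x k ^ 2 <= Cx * dx k) ->
  summable (fun k => gam k ^ 2) -> summable (fun k => q k ^ 2) ->
  (forall k, lb <= V k) ->
  [/\ summable (fun k => gam k * dd k), summable dx, summable (fun k => qT k ^ 2)
    & exists l, Un_cv V l].
Proof.
move=> c10 c20 C0 Cx0 CT0 hr g0 dd0 dx0 q0 qT0 x0 hV hqT hx Sg Sq hlb.
have r10 : 0 < / (1 - rho) by apply: Rinv_0_lt_compat; lra.
pose B := 3 * (/ (1 - rho) * CT ^ 2).
have B0 : 0 <= / (1 - rho) * CT ^ 2 by apply: Rmult_le_pos; [lra | exact: pow2_ge_0].
have BCx : 0 <= B * Cx by apply: Rmult_le_pos; rewrite /B; lra.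
have hT k : qT k.+1 ^ 2 <= rho * qT k ^ 2 + B * (q k ^ 2 + gam k ^ 2 + Cx * dx k).
  have b0 j : 0 <= CT * (q j + gam j + x j).
    by apply: Rmult_le_pos => //; have := q0 j; have := g0 j; have := x0 j; lra.
  have := recursion_sqr hr qT0 b0 hqT k.
  have : (q k + gam k + x k) ^ 2 <= 3 * (q k ^ 2 + gam k ^ 2 + Cx * dx k).
    have := hx k; have := pow2_ge_0 (q k - gam k); have := pow2_ge_0 (q k - x k).
    by have := pow2_ge_0 (gam k - x k); lra.
  by move=> h; have := Rmult_le_compat_l _ _ _ B0 h; rewrite /B; lra.
(* The weight of [qT ^ 2] in the Lyapunov function: so small that the part of its recursion driven
   by [dx] uses at most half of the decrease [c2 * dx]. *)
pose K := c2 / (2 * (B * Cx + 1)); have K0 : 0 < K by apply: Rdiv_lt_0_compat; lra.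
have KB : K * B * Cx <= c2 / 2.
  have : K * (2 * (B * Cx + 1)) = c2 by rewrite /K; field; lra.
  lra.
(* Half of the decrease gained from the contraction of [K * qT ^ 2]. Young's inequality spends this
   half on [C * (gam * qT)]; the other half remains in [a]. *)
pose s := K * (1 - rho) / 2; have s0 : 0 < s.
  by apply: Rdiv_lt_0_compat; [apply: Rmult_lt_0_compat |]; lra.
have young k : C * (gam k * qT k) <= s * qT k ^ 2 + C ^ 2 / (4 * s) * gam k ^ 2.
  apply: (Rmult_le_reg_l (4 * s)); first lra.
  rewrite Rmult_plus_distr_l; have -> : 4 * s * (C ^ 2 / (4 * s) * gam k ^ 2) = (C * gam k) ^ 2.
    by field; lra.
  have := pow2_ge_0 (2 * s * qT k - C * gam k); lra.
pose a k := c1 * (gam k * dd k) + c2 / 2 * dx k + s * qT k ^ 2.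
have p1 k : 0 <= c1 * (gam k * dd k).
  by apply: Rmult_le_pos; [lra | exact: Rmult_le_pos].
have p2 k : 0 <= c2 / 2 * dx k by apply: Rmult_le_pos => //; lra.
have p3 k : 0 <= s * qT k ^ 2 by apply: Rmult_le_pos; [lra | exact: pow2_ge_0].
have Cs0 : 0 <= C ^ 2 / (4 * s) by apply: Rdiv_ge0; [exact: pow2_ge_0 | lra].
have KB0 : 0 <= K * B by apply: Rmult_le_pos; rewrite /B; lra.
have [|||||sa [l hl]] := @quasi_descent (fun k => V k + K * qT k ^ 2) a
  (fun k => (C + K * B + C ^ 2 / (4 * s)) * (gam k ^ 2 + q k ^ 2)) lb.
- by move=> k; have := p1 k; have := p2 k; have := p3 k; rewrite /a; lra.
- move=> k; apply: Rmult_le_pos; first lra.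
  by have := pow2_ge_0 (gam k); have := pow2_ge_0 (q k); lra.
- by apply: summable_scale; [lra | exact: summable_add].
- move=> k; have := hlb k; have := Rmult_le_pos _ _ (Rlt_le _ _ K0) (pow2_ge_0 (qT k)); lra.
- move=> k; have h1 := hV k; have h2 := Rmult_le_compat_l _ _ _ (Rlt_le _ _ K0) (hT k).
  have h3 := young k; have h4 := Rmult_le_compat_r _ _ _ (dx0 k) KB.
  have h5 := Rmult_le_pos _ _ Cs0 (pow2_ge_0 (q k)).
  have e : 2 * s = K * (1 - rho) by rewrite /s; field.
  have h6 : 2 * s * qT k ^ 2 = K * qT k ^ 2 - K * rho * qT k ^ 2 by rewrite e; ring.
  rewrite /a; lra.
have part (c : R) (b : nat -> R) : 0 < c -> (forall k, c * b k <= a k) -> summable b.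
  move=> c0 h; have ic : 0 < / c by exact: Rinv_0_lt_compat.
  apply: (summable_le _ (summable_scale (Rlt_le _ _ ic) sa)) => k.
  by apply: (Rmult_le_reg_l c) => //; rewrite -Rmult_assoc Rinv_r ?Rmult_1_l; [exact: h | lra].
have sT : summable (fun k => qT k ^ 2).
  by apply: (part s) => // k; have := p1 k; have := p2 k; rewrite /a; lra.
split=> //.
- by apply: (part c1) => // k; have := p2 k; have := p3 k; rewrite /a; lra.
- by apply: (part (c2 / 2)) => [|k]; [lra | have := p1 k; have := p3 k; rewrite /a; lra].
exists l; apply: cv0_Un_cv.
apply: (@cv0_le _ (fun k => Rabs (V k + K * qT k ^ 2 - l) + K * qT k ^ 2)) => [k|].
  have := Rmult_le_pos _ _ (Rlt_le _ _ K0) (pow2_ge_0 (qT k)); split_Rabs; lra.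
apply: cv0_add; first exact: (Un_cv_cv0 hl).
by apply: cv0_scale; [lra | apply: summable_cv0 => // k; exact: pow2_ge_0].
Qed.

Lemma weighted_frequently_small (gam dd : nat -> R) : (forall k, 0 <= gam k) ->
  (forall k, 0 <= dd k) -> cv_infty (psum gam) -> summable (fun k => gam k * dd k) ->
  forall eps, 0 < eps -> forall N, exists k, (N <= k)%nat /\ dd k < eps.
Proof.
move=> g0 d0 gi [C hC] eps e0 N; apply: NNPP => hn.
have hd k : (N <= k)%nat -> eps <= dd k.
  by move=> Nk; apply: Rnot_lt_le => c; apply: hn; exists k.
have [M hM] := gi (C / eps + psum gam N).
have h1 := hM (maxn M N) (elimT leP (leq_maxl _ _)).
have NM : (N <= maxn M N)%nat by exact: leq_maxr.
have gd0 k : 0 <= gam k * dd k by exact: Rmult_le_pos.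
have := hC (maxn M N); rewrite -(subnKC NM) psum_cat; rewrite -(subnKC NM) psum_cat in h1.
set l := (_ - _)%nat in h1 *.
have h2 : psum (fun k => eps * gam (N + k)%nat) l <=
    psum (fun k => gam (N + k)%nat * dd (N + k)%nat) l.
  apply: psum_le => k; rewrite Rmult_comm; apply: Rmult_le_compat_l => //.
  by apply: hd; exact: leq_addr.
rewrite psum_scale in h2; have := psum_ge0 N gd0.
have : eps * (C / eps) = C by field; lra.
nra.
Qed.

(** [m + i] is the last time of the window with [d] below [del]; writing the remaining length as
    [j.+1] records that it is positive. *)
Lemma last_below (d : nat -> R) del m l : d m < del -> del <= d (m + l)%nat ->
  exists i j, (l = i + j.+1)%nat /\ d (m + i)%nat < del /\
    forall k, (k < j.+1)%nat -> del <= d (m + i + k.+1)%nat.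
Proof.
elim: l m => [|l IH] m hm hl; first by rewrite addn0 in hl; lra.
case: (Rlt_dec (d m.+1) del) => c.
  have [|i [j [e [h1 h2]]]] := IH m.+1 c; first by rewrite addSnnS.
  exists i.+1, j; split; first by rewrite e.
  by rewrite -(addSnnS m i).
case: (classic (exists k, (k <= l)%nat /\ d (m.+1 + k)%nat < del)) => [[k [kl hk]]|hn].
  have [i0 [hi0 hmax]] : exists i0, ((i0 <= l)%nat /\ d (m.+1 + i0)%nat < del) /\
      forall k, (i0 < k)%nat -> (k <= l)%nat -> del <= d (m.+1 + k)%nat.
    have [i0 /andP[h1 h2] hi0] := @ex_maxnP
      (fun k => (k <= l)%nat && (if Rlt_dec (d (m.+1 + k)%nat) del then true else false)) l
      ltac:(exists k; rewrite kl; by case: Rlt_dec) ltac:(by move=> ? /andP[]).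
    exists i0; split; first by split=> //; move: h2; case: Rlt_dec.
    move=> j ij jl; apply: Rnot_lt_le => cc.
    have := hi0 j; rewrite jl /=; case: Rlt_dec => //= _ /(_ isT).
    by rewrite leqNgt ij.
  case: hi0 => il hi.
  have il' : (i0 < l)%nat.
    rewrite ltn_neqAle il andbT; apply/eqP => e; move: hi; rewrite e addSnnS; lra.
  exists i0.+1, (l - i0.+1)%nat; split; first by rewrite subnSK // addSn subnKC.
  split=> [|j jl]; first by rewrite -(addSnnS m).
  have -> : (m + i0.+1 + j.+1 = m.+1 + (i0 + j.+1))%nat by rewrite addnA addSnnS.
  apply: hmax; first by rewrite addnS ltnS leq_addr.
  by rewrite addnS -addSn; move: jl; rewrite subnSK // ltn_subRL addnC addSn addnC.
exists 0%nat, l; rewrite add0n addn0; split=> //; split=> // k kl.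
rewrite -addSnnS; apply: Rnot_lt_le => cc; apply: hn; exists k; split=> //.
Qed.

(* Between a time below [del] and a later time above [2 del], [d] spends a
   [gam]-length bounded below in the region [d >= del]. *)
Lemma crossing_cv0 (d gam w h eps' : nat -> R) (C C' : R) :
  (forall k, 0 <= gam k) -> cv0 gam -> cv0 h -> cv0 eps' -> (forall k, 0 <= w k) ->
  0 < C -> 0 < C' ->
  (forall m l, psum (fun k => Rabs (d (m + k).+1 - d (m + k)%nat)) l <=
     h m + C * psum (fun k => gam (m + k)%nat) l) ->
  summable (fun k => gam k * w k ^ 2) ->
  (forall k, d k <= C' * w k + eps' k) ->
  (forall eps, 0 < eps -> forall N, exists k, (N <= k)%nat /\ d k < eps) ->
  cv0 d.
Proof.
move=> g0 cg ch ce w0 C0 C'0 hvar hs hd hl eta eta0; apply: NNPP => hn.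
pose del := eta / 2; have del0 : 0 < del by rewrite /del; lra.
have sw k : 0 <= gam k * w k ^ 2 by apply: Rmult_le_pos => //; exact: pow2_ge_0.
(* What one upcrossing contributes at least to the sum of [gam * w ^ 2]: a [gam]-length of
   [del / (4 * C)] on which [w] is at least [del / (2 * C')]. Tails below [kap] exclude
   upcrossings. *)
pose kap := del / (4 * C) * (del / (2 * C')) ^ 2.
have kap0 : 0 < kap.
  by apply: Rmult_lt_0_compat; [| apply: pow_lt]; apply: Rdiv_lt_0_compat; lra.
have [N1 hN1] := summable_tail sw hs kap0.
have d4 : 0 < del / 4 by lra.
have d2 : 0 < del / 2 by lra.
have d4C : 0 < del / (4 * C) by apply: Rdiv_lt_0_compat; lra.
have [N2 hN2] := ch _ d4; have [N3 hN3] := ce _ d2; have [N4 hN4] := cg _ d4C.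
have [m [mN hm]] := hl _ del0 (N1 + N2 + N3 + N4)%nat.
have [n [mn hnn]] : exists n, (m <= n)%nat /\ eta <= d n.
  apply: NNPP => hx; apply: hn; exists m => k mk.
  by apply: Rnot_le_lt => c; apply: hx; exists k.
have hdn : del <= d (m + (n - m))%nat by rewrite subnKC // /del; lra.
have [i [j [e [h1 h2]]]] := last_below hm hdn.
set m' := (m + i)%nat in h1 h2.
have big k : (m' <= k)%nat -> [/\ (N1 <= k)%nat, (N2 <= k)%nat, (N3 <= k)%nat & (N4 <= k)%nat].
  move=> mk; have hk : (N1 + N2 + N3 + N4 <= k)%nat.
    by apply: leq_trans mN (leq_trans (leq_addr _ _) mk).
  split; apply: leq_trans hk; rewrite ?leq_addl // -?addnA ?leq_addr //.
    by rewrite addnCA leq_addr.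
  by rewrite addnA addnCA leq_addr.
have en : (m' + j.+1 = n)%nat by rewrite /m' -addnA -e subnKC.
have [b1 b2 b3 b4] := big m' (leqnn _).
have t1 := psum_tele d m' j.+1; rewrite en in t1.
have t2 := hvar m' j.+1; have t3 := hN2 m' b2; have t4 := hN4 m' b4.
have t5 : del <= Rabs (d n - d m').
  by have := Rle_abs (d n - d m'); rewrite /del in h1 *; lra.
have t6 : del - del / 4 <= C * psum (fun k => gam (m' + k)%nat) j.+1 by lra.
(* At [m'] itself [d] is still below [del], so this term has to leave the window; it is small
   because [gam] tends to 0. *)
have t7 : psum (fun k => gam (m' + k)%nat) j.+1 =
    gam m' + psum (fun k => gam (m'.+1 + k)%nat) j.
  rewrite psum_recl addn0; congr (_ + _).
  by elim: (j) => [|p IH] //=; rewrite IH addSnnS.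
have t8 : C * gam m' <= del / 4.
  have -> : del / 4 = C * (del / (4 * C)) by field; lra.
  by apply: Rmult_le_compat_l; lra.
have t9 : del / (4 * C) <= psum (fun k => gam (m'.+1 + k)%nat) j.
  apply: (Rmult_le_reg_l C) => //; have -> : C * (del / (4 * C)) = del / 4 by field; lra.
  by rewrite t7 in t6; lra.
have t10 : psum (fun k => (del / (2 * C')) ^ 2 * gam (m'.+1 + k)%nat) j <=
    psum (fun k => gam (m'.+1 + k)%nat * w (m'.+1 + k)%nat ^ 2) j.
  apply: psum_le_lt => p pj; have hdp := h2 p (leq_trans pj (leqnSn _)).
  have [_ _ b3' _] := big (m' + p.+1)%nat (leq_addr _ _).
  have := hN3 _ b3'; have := hd (m' + p.+1)%nat; rewrite -addSnnS in hdp *.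
  set k := (m'.+1 + p)%nat in hdp * => k1 k2.
  have k3 : del / (2 * C') <= w k.
    apply: (Rmult_le_reg_l C') => //; have -> : C' * (del / (2 * C')) = del / 2 by field; lra.
    lra.
  have k4 : 0 < del / (2 * C') by apply: Rdiv_lt_0_compat; lra.
  rewrite [X in X <= _]Rmult_comm.
  by apply: Rmult_le_compat_l => //; apply: pow_incr; lra.
rewrite psum_scale in t10.
have t11 := hN1 m'.+1 j (leq_trans b1 (leqnSn _)).
have : kap <= (del / (2 * C')) ^ 2 * psum (fun k => gam (m'.+1 + k)%nat) j.
  by rewrite /kap Rmult_comm; apply: Rmult_le_compat_l => //; exact: pow2_ge_0.
lra.
Qed.

End ScalarSequences.

(** * Push-sum consensus *)

Section Consensus.
Variables (I B : nat) (E : nat -> 'I_I -> 'I_I -> bool).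
Hypothesis B0 : (0 < B)%nat.
Hypothesis HB : forall k : nat, strongly_connected
  (fun j i => exists t : nat, (k * B <= t <= (k + 1) * B - 1)%nat /\ E t j i).

Let T := (I.+1 * B)%nat.

(** The set [S s] of nodes holding at least [w ^ s * y 0 j] never shrinks, and each complete block
    of [B] steps adds a node until it is full, since strong connectivity provides an edge leaving
    it. Of the [I.+1] blocks in [T], one pays for aligning [nu] with a block boundary. *)
Lemma spreading nu (y : nat -> 'I_I -> R) w j : 0 < w ->
  (forall s i, w * y s i <= y s.+1 i) ->
  (forall s i k, E (nu + s)%nat k i -> w * y s k <= y s.+1 i) ->
  forall i, w ^ T * y 0%nat j <= y T i.
Proof.
move=> w0 ydiag yedge.
pose S s := [set i | if Rle_dec (w ^ s * y 0%nat j) (y s i) then true else false].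
have SP s i : reflect (w ^ s * y 0%nat j <= y s i) (i \in S s).
  by rewrite inE; case: Rle_dec => c; [apply: ReflectT | apply: ReflectF].
have grow s i k : w * y s k <= y s.+1 i -> k \in S s -> i \in S s.+1.
  move=> h /SP h1; apply/SP => /=; apply: Rle_trans h.
  by rewrite Rmult_assoc; apply: Rmult_le_compat_l; lra.
have Smono s r : S s \subset S (s + r)%nat.
  elim: r => [|r IH]; first by rewrite addn0.
  by apply: subset_trans IH _; apply/subsetP => i; rewrite addnS; apply: grow.
(* After [s0] steps, at most [B], the time is the boundary [k0 * B]. *)
pose s0 := (B - nu %% B)%nat; pose k0 := (nu %/ B).+1.
have es0 : (nu + s0 = k0 * B)%nat.
  rewrite /s0 /k0 mulSn {1}(divn_eq nu B) -addnA subnKC ?(addnC B) //.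
  by apply: ltnW; rewrite ltn_mod.
have s0B : (s0 <= B)%nat by exact: leq_subr.
have jS s : j \in S s.
  by have /subsetP := Smono 0%nat s; apply; apply/SP => /=; lra.
have card b : (minn b.+1 I <= #|S (s0 + b * B)%nat|)%nat.
  elim: b => [|b IH].
    apply: leq_trans (geq_minl _ _) _; rewrite card_gt0; apply/set0Pn; exists j; exact: jS.
  have e1 : (s0 + b.+1 * B = s0 + b * B + B)%nat by rewrite mulSn addnCA addnC.
  set R0 := S (s0 + b * B)%nat in IH.
  have sub : R0 \subset S (s0 + b.+1 * B)%nat by rewrite e1; exact: Smono.
  case: (boolP (R0 == setT)) => [/eqP full|nfull].
    apply: leq_trans (geq_minr _ _) _.
    by apply: leq_trans (subset_leq_card sub); rewrite full cardsT card_ord.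
  have [c cR] : exists c, c \notin R0.
    apply/existsP; rewrite -negb_forall; apply: contra nfull => /forallP h.
    by apply/eqP/setP => c; rewrite h inE.
  (* If no edge of the block left [R0], the path from [j] to [c] would stay inside [R0]. *)
  have [a [d [aR [dR [t [/andP[t1 t2] Et]]]]]] : exists a d, a \in R0 /\ d \notin R0 /\
      exists t : nat, ((k0 + b) * B <= t <= (k0 + b + 1) * B - 1)%nat /\ E t a d.
    apply: NNPP => hn; have path := HB (k0 + b) j c; move/negP: cR; apply.
    have : j \in R0 by exact: jS.
    elim: path => // [u v huv uR|u v z _ h1 _ h2 uR]; last by apply: h2; apply: h1.
    by apply/negPn/negP => vR; apply: hn; exists u, v.
  pose r := (t - (k0 + b) * B)%nat.
  have rB : (r < B)%nat.
    have : (t < (k0 + b + 1) * B)%nat.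
      by apply: leq_ltn_trans t2 _; rewrite ltn_subrL /= muln_gt0 addn1 B0.
    by rewrite addn1 mulSn addnC -ltn_subLR.
  have et : (t = nu + (s0 + b * B + r))%nat.
    by rewrite !addnA es0 -mulnDl /r subnKC.
  have dS : d \in S (s0 + b.+1 * B)%nat.
    have : d \in S (s0 + b * B + r).+1.
      apply: (@grow _ _ a); first by apply: yedge; rewrite -et.
      by have /subsetP := Smono (s0 + b * B)%nat r; apply.
    have -> : (s0 + b.+1 * B = (s0 + b * B + r).+1 + (B - r.+1))%nat.
      by rewrite e1 -addnS -[RHS]addnA subnKC.
    by move=> h; have /subsetP := Smono (s0 + b * B + r).+1 (B - r.+1)%nat; apply.
  have : (#|R0| < #|S (s0 + b.+1 * B)%nat|)%nat.
    by apply: proper_card; apply/properP; split=> //; exists d.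
  apply: leq_trans; apply: leq_trans (_ : (minn b.+1 I).+1 <= _)%nat; last by rewrite ltnS.
  by rewrite -minnSS leq_min geq_minl (leq_trans (geq_minr _ _) (leqnSn _)).
move=> i.
have full : S (s0 + I * B)%nat = setT.
  apply/eqP; rewrite eqEcard subsetT cardsT card_ord /=.
  by apply: leq_trans (card I); rewrite leq_min leqnSn leqnn.
have : i \in S (s0 + I * B)%nat by rewrite full inE.
have eT : (T = s0 + I * B + (B - s0))%nat by rewrite addnAC subnKC // /T mulSn.
by move=> h; apply/SP; rewrite eT; have /subsetP := Smono (s0 + I * B)%nat (B - s0)%nat; apply.
Qed.

(** * Perturbed averaging with row stochastic weights *)

Section RowStochastic.
Variables (W : nat -> 'I_I -> 'I_I -> R) (w : R).
Hypothesis w01 : 0 < w <= 1.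
Hypothesis W0 : forall nu i j, 0 <= W nu i j.
Hypothesis W1 : forall nu i, \big[Rplus/0]_(j < I) W nu i j = 1.
Hypothesis Wdiag : forall nu i, w <= W nu i i.
Hypothesis Wedge : forall nu i j, E nu j i -> w <= W nu i j.

Lemma averaging_ge nu (y : 'I_I -> R) i k : (forall j, 0 <= y j) -> w <= W nu i k ->
  w * y k <= \big[Rplus/0]_(j < I) (W nu i j * y j).
Proof.
move=> y0 wk; apply: (Rle_trans _ (W nu i k * y k)); first exact: Rmult_le_compat_r.
by apply: (@sumI_term I (fun j => W nu i j * y j)) => j; exact: Rmult_le_pos.
Qed.

Lemma averaging_affine nu (x : 'I_I -> R) a b i :
  \big[Rplus/0]_(j < I) (W nu i j * (a * x j + b)) = a * \big[Rplus/0]_(j < I) (W nu i j * x j) + b.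
Proof.
rewrite (eq_bigr (fun j => a * (W nu i j * x j) + b * W nu i j)); last by move=> *; ring.
by rewrite sumI_add !sumI_scale W1; ring.
Qed.

Variables (x : nat -> 'I_I -> R) (e : nat -> R).
Hypothesis e0 : forall nu, 0 <= e nu.
Hypothesis xrec : forall nu i,
  Rabs (x nu.+1 i - \big[Rplus/0]_(j < I) (W nu i j * x nu j)) <= e nu.

Lemma perturbed_averaging_ge nu m : (forall i, m <= x nu i) ->
  forall s i, m - psum (fun k => e (nu + k)%nat) s <= x (nu + s)%nat i.
Proof.
move=> hm; elim=> [|s IH] i; first by rewrite addn0 /=; have := hm i; lra.
have := xrec (nu + s)%nat i; rewrite addnS psumS; set P := psum _ s in IH *.
have : 0 <= \big[Rplus/0]_(j < I) (W (nu + s) i j * (1 * x (nu + s)%nat j + (P - m))).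
  by apply: sumI_ge0 => j; apply: Rmult_le_pos => //; have := IH j; lra.
by rewrite averaging_affine; split_Rabs; lra.
Qed.

Lemma perturbed_averaging_spread nu m j0 : (forall i, m <= x nu i) ->
  forall i, m + w ^ T * (x nu j0 - m) - psum (fun k => e (nu + k)%nat) T <= x (nu + T)%nat i.
Proof.
move=> hm i.
(* Shifted by the lower bound and the accumulated error, [x] becomes nonnegative and dominates its
   own exact averaging, as [spreading] requires. The factor 1 gives it the shape of
   [averaging_affine]. *)
pose y s i := 1 * x (nu + s)%nat i + (psum (fun k => e (nu + k)%nat) s - m).
have y0 s k : 0 <= y s k by have := perturbed_averaging_ge hm s k; rewrite /y; lra.
have yrec s k : \big[Rplus/0]_(j < I) (W (nu + s) k j * y s j) <= y s.+1 k.
  rewrite averaging_affine /y addnS psumS.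
  by have := xrec (nu + s)%nat k; split_Rabs; lra.
have hw : 0 < w by lra.
have := @spreading nu y w j0 hw _ _ i.
rewrite /y addn0 /= => /(_ _ _) h; suff : w ^ T * (1 * x nu j0 + (0 - m)) <=
  1 * x (nu + T)%nat i + (psum (fun k => e (nu + k)%nat) T - m) by lra.
apply: h.
- by move=> s k; apply: Rle_trans (yrec s k); apply: averaging_ge.
- by move=> s k l hE; apply: Rle_trans (yrec s k); apply: averaging_ge => //; exact: Wedge.
Qed.

End RowStochastic.

(** By Bernoulli, [rate w ^ T] is at least [1 - w ^ T / 2]: a one-step recursion with this ratio
    decays over a window more slowly than the spread, which contracts by [1 - w ^ T]. *)
Definition rate (w : R) := 1 - w ^ T / 2 / INR T.

Lemma T_gt0 : 1 <= INR T.
Proof. by apply: (@INR_leq 1); rewrite /T muln_gt0 B0. Qed.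

Lemma rate_bounds w : 0 < w <= 1 -> 0 <= rate w < 1.
Proof.
move=> hw; have t1 := T_gt0; rewrite /rate.
have h1 : 0 < w ^ T by apply: pow_lt; lra.
have h2 : w ^ T <= 1 by rewrite -(pow1 T); apply: pow_incr; lra.
have h3 : 0 < w ^ T / 2 / INR T by repeat apply: Rdiv_lt_0_compat; lra.
have h4 : w ^ T / 2 / INR T <= 1.
  by apply: (Rmult_le_reg_r (INR T)); [lra | field_simplify; lra].
lra.
Qed.

Lemma rate_pow w s : 0 < w <= 1 -> (s <= T)%nat -> 1 - w ^ T / 2 <= rate w ^ s.
Proof.
move=> hw sT; have hr := rate_bounds hw; have t1 := T_gt0.
have h1 : 0 < w ^ T by apply: pow_lt; lra.
have key k : 1 - INR k * (w ^ T / 2 / INR T) <= rate w ^ k.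
  elim: k => [|k IH]; first by rewrite /=; lra.
  rewrite S_INR /=; have h3 : 0 < w ^ T / 2 / INR T by repeat apply: Rdiv_lt_0_compat; lra.
  have : rate w * (1 - INR k * (w ^ T / 2 / INR T)) <= rate w * rate w ^ k.
    by apply: Rmult_le_compat_l; lra.
  rewrite -/(rate w); set dl := w ^ T / 2 / INR T in h3 *.
  have k0 := pos_INR k; have -> : rate w = 1 - dl by [].
  by have : 0 <= INR k * (dl * dl) by [apply: Rmult_le_pos => //; nra]; lra.
apply: Rle_trans _ (key s).
have : INR s * (w ^ T / 2 / INR T) <= INR T * (w ^ T / 2 / INR T).
  apply: Rmult_le_compat_r; last exact: INR_leq.
  by apply: Rlt_le; repeat apply: Rdiv_lt_0_compat; lra.
have -> : INR T * (w ^ T / 2 / INR T) = w ^ T / 2 by field; lra.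
lra.
Qed.

(* Over a window of [T] steps the spread of [x] contracts by [1 - w ^ T], which
   the geometric recursion [q] dominates. *)
Lemma consensus_bound (W : nat -> 'I_I -> 'I_I -> R) w (x : nat -> 'I_I -> R)
    (e q : nat -> R) : 0 < w <= 1 ->
  (forall nu i j, 0 <= W nu i j) -> (forall nu i, \big[Rplus/0]_(j < I) W nu i j = 1) ->
  (forall nu i, w <= W nu i i) -> (forall nu i j, E nu j i -> w <= W nu i j) ->
  (forall nu, 0 <= e nu) ->
  (forall nu i, Rabs (x nu.+1 i - \big[Rplus/0]_(j < I) (W nu i j * x nu j)) <= e nu) ->
  (forall i j, x 0%nat i - x 0%nat j <= q 0%nat) ->
  (forall nu, q nu.+1 = rate w * q nu + e nu) ->
  forall nu i j, x nu i - x nu j <= 4 * q nu.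
Proof.
move=> hw W0 W1 Wd We e0 xrec hq0 qrec nu i j.
have hr := rate_bounds hw.
have q00 : 0 <= q 0%nat by have := hq0 i i; lra.
have q0 k : 0 <= q k.
  by elim: k => [|k IH] //; rewrite qrec; have := e0 k; nra.
have qlow k s : rate w ^ s * (q k + psum (fun l => e (k + l)%nat) s) <= q (k + s)%nat.
  elim: s => [|s IH]; first by rewrite addn0 /=; lra.
  rewrite addnS qrec /=; set P := psum _ s in IH *.
  have h1 : rate w * (rate w ^ s * (q k + P)) <= rate w * q (k + s)%nat.
    by apply: Rmult_le_compat_l; lra.
  have h2 : rate w * rate w ^ s * e (k + s)%nat <= 1 * e (k + s)%nat.
    apply: Rmult_le_compat_r => //; have := pow_incr (rate w) 1 s; rewrite pow1.
    by have := pow_le (rate w) s; nra.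
  lra.
have wT0 : 0 < w ^ T by apply: pow_lt; lra.
have wT1 : w ^ T <= 1 by rewrite -(pow1 T); apply: pow_incr; lra.
(* Origin of the factor 4: the accumulated error enters the spread twice, from above and from below,
   and reaches [q] with a weight of at least one half. *)
have half s : (s <= T)%nat -> 1 / 2 <= rate w ^ s.
  by move=> sT; have := rate_pow hw sT; lra.
have up k M : (forall i, x k i <= M) ->
    forall s i, x (k + s)%nat i <= M + psum (fun l => e (k + l)%nat) s.
  move=> hM s i1.
  have xrec' n1 i2 :
      Rabs (- x n1.+1 i2 - \big[Rplus/0]_(j < I) (W n1 i2 j * - x n1 j)) <= e n1.
    rewrite (eq_bigr (fun j => (-1) * (W n1 i2 j * x n1 j))); last by move=> *; ring.
    by rewrite sumI_scale; have := xrec n1 i2; split_Rabs; lra.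
  have := @perturbed_averaging_ge W W0 W1 (fun n i => - x n i) e xrec' k (- M) _ s i1.
  by move=> /(_ (fun i => Ropp_le_contravar _ _ (hM i))); lra.
have eP k s : 0 <= psum (fun l => e (k + l)%nat) s by apply: psum_ge0.
elim/ltn_ind: nu i j => nu IH i j.
case: (ltnP nu T) => [nuT|Tnu].
  have [i1 hi1] := fin_argmax (x 0%nat) i; have [j1 hj1] := fin_argmin (x 0%nat) i.
  have h1 := up 0%nat _ hi1 nu i.
  have h2 := @perturbed_averaging_ge W W0 W1 x e xrec 0%nat _ hj1 nu j.
  have h3 := hq0 i1 j1; have h4 := qlow 0%nat nu; have h5 := half nu (ltnW nuT).
  have h6 := eP 0%nat nu.
  rewrite !add0n in h1 h2 h4; set P := psum _ nu in h1 h2 h4 h6.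
  have : 1 / 2 * (q 0%nat + P) <= rate w ^ nu * (q 0%nat + P).
    by apply: Rmult_le_compat_r; lra.
  lra.
pose k := (nu - T)%nat; have ek : (k + T = nu)%nat by rewrite subnK.
have kn : (k < nu)%nat.
  by rewrite -ek -{1}(addn0 k) ltn_add2l /T muln_gt0 B0.
have [i1 hi1] := fin_argmax (x k) i; have [j1 hj1] := fin_argmin (x k) i.
have h1 := up k _ hi1 T i.
have h2 := @perturbed_averaging_spread W w hw W0 W1 Wd We x e xrec k (x k j1) i1 hj1 j.
have h3 := IH k kn i1 j1; have h4 := qlow k T; have h5 := rate_pow hw (leqnn T).
have h6 := eP k T; have h7 := half T (leqnn T); have h8 := q0 k; have h9 := hi1 j1.
rewrite ek in h1 h2 h4; set P := psum _ T in h1 h2 h4 h6.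
have t1 : (1 - w ^ T / 2) * q k <= rate w ^ T * q k by apply: Rmult_le_compat_r.
have t2 : 1 / 2 * P <= rate w ^ T * P by apply: Rmult_le_compat_r.
have t3 : (1 - w ^ T / 2) * (x k i1 - x k j1) <= (1 - w ^ T / 2) * (4 * q k).
  by apply: Rmult_le_compat_l; lra.
have t4 : 0 <= w ^ T / 2 * (x k i1 - x k j1) by apply: Rmult_le_pos; lra.
lra.
Qed.

(** * Push-sum weights for column stochastic matrices *)

Section PushSum.
Variables (A : nat -> 'I_I -> 'I_I -> R) (kappa : R) (phi : nat -> 'I_I -> R).
Hypothesis HI : (0 < I)%nat.
Hypothesis Hkappa : 0 < kappa.
Hypothesis HAdiag : forall nu i, kappa <= A nu i i.
Hypothesis HAoff : forall nu (i j : 'I_I), j <> i ->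
  (E nu j i -> kappa <= A nu i j) /\ (~~ E nu j i -> A nu i j = 0).
Hypothesis HAcol : forall nu j, \big[Rplus/0]_(i < I) A nu i j = 1.
Hypothesis Hphi0 : forall i, phi 0%nat i = 1.
Hypothesis Hphi : forall nu i, phi nu.+1 i =
  \big[Rplus/0]_(j < I | (j == i) || E nu j i) (A nu i j * phi nu j).

Lemma weights_ge0 nu i j : 0 <= A nu i j.
Proof.
case: (eqVneq j i) => [->|/eqP ji]; first by have := HAdiag nu i; lra.
case: (HAoff nu ji); case: (E nu j i) => [h _|_ h]; first by have := h isT; lra.
by rewrite h //; lra.
Qed.

Lemma weights_neighbours nu i (F : 'I_I -> R) :
  \big[Rplus/0]_(j < I | (j == i) || E nu j i) (A nu i j * F j) =
  \big[Rplus/0]_(j < I) (A nu i j * F j).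
Proof.
rewrite big_mkcond; apply: eq_bigr => j _; case: ifP => //= /norP[/eqP ji nE].
by have [_ ->] := HAoff nu ji; rewrite ?nE //; ring.
Qed.

Lemma kappa_le1 : kappa <= 1.
Proof.
have i0 : 'I_I by exact: (Ordinal HI).
rewrite -(HAcol 0%nat i0); apply: Rle_trans (HAdiag 0%nat i0) _.
by apply: (@sumI_term I (fun i => A 0%nat i i0)) => i; exact: weights_ge0.
Qed.

Lemma phi_rec nu i : phi nu.+1 i = \big[Rplus/0]_(j < I) (A nu i j * phi nu j).
Proof. by rewrite Hphi weights_neighbours. Qed.

Lemma phi_gt0 nu i : 0 < phi nu i.
Proof.
elim: nu i => [|nu IH] i; first by rewrite Hphi0; lra.
rewrite phi_rec; apply: Rlt_le_trans (_ : A nu i i * phi nu i <= _).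
  by apply: Rmult_lt_0_compat => //; have := HAdiag nu i; lra.
apply: (@sumI_term I (fun j => A nu i j * phi nu j)) => j.
by apply: Rmult_le_pos; [exact: weights_ge0 | exact: Rlt_le].
Qed.

Lemma mixing_sum nu (F : 'I_I -> R) :
  \big[Rplus/0]_(i < I) \big[Rplus/0]_(j < I) (A nu i j * F j) = \big[Rplus/0]_(j < I) F j.
Proof.
rewrite sumI_exchange; apply: eq_bigr => j _.
rewrite (eq_bigr (fun i => F j * A nu i j)); last by move=> *; ring.
by rewrite sumI_scale HAcol; ring.
Qed.

Lemma phi_sum nu : \big[Rplus/0]_(i < I) phi nu i = INR I.
Proof.
elim: nu => [|nu IH].
  by rewrite (eq_bigr (fun _ => 1)) // sumI_const; ring.
by rewrite (eq_bigr _ (fun i _ => phi_rec nu i)) mixing_sum.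
Qed.

Lemma phi_le nu i : phi nu i <= INR I.
Proof.
rewrite -(phi_sum nu); apply: (@sumI_term I (fun i => phi nu i)) => j.
exact: Rlt_le (phi_gt0 _ _).
Qed.

Lemma phi_step_ge nu i k : kappa <= A nu i k -> kappa * phi nu k <= phi nu.+1 i.
Proof.
move=> h; rewrite phi_rec; apply: Rle_trans (_ : A nu i k * phi nu k <= _).
  by apply: Rmult_le_compat_r => //; exact: Rlt_le (phi_gt0 _ _).
apply: (@sumI_term I (fun j => A nu i j * phi nu j)) => j.
by apply: Rmult_le_pos; [exact: weights_ge0 | exact: Rlt_le (phi_gt0 _ _)].
Qed.

Lemma edge_weight nu i j : E nu j i -> kappa <= A nu i j.
Proof. by move=> hE; case: (eqVneq j i) => [->|/eqP ji] //; apply: (proj1 (HAoff nu ji)). Qed.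

(** From time [T] on, [spreading] over the preceding window bounds [phi nu i] below by [kappa ^ T]
    times every earlier [phi k j]; averaging over [j] uses that these sum to [I]. Before time [T]
    the diagonal weights suffice. *)
Lemma phi_lower nu i : kappa ^ T <= phi nu i.
Proof.
have k1 := kappa_le1; have I1 : 1 <= INR I by exact: (INR_leq HI).
case: (ltnP nu T) => [nuT|Tnu].
  have : kappa ^ nu <= phi nu i.
    elim: nu i {nuT} => [|nu IH] i; first by rewrite Hphi0 /=; lra.
    apply: Rle_trans (phi_step_ge (HAdiag nu i)) => /=.
    by apply: Rmult_le_compat_l; [lra|].
  apply: Rle_trans; rewrite -(subnKC (ltnW nuT)) pow_add.
  have := pow_le kappa nu; have := pow_incr kappa 1 (T - nu); rewrite pow1 => h1 h2.
  have : kappa ^ (T - nu) <= 1 by lra.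
  have : 0 <= kappa ^ nu by lra.
  nra.
pose k := (nu - T)%nat; have ek : (k + T = nu)%nat by rewrite subnK.
have hj j : kappa ^ T * phi k j <= phi nu i.
  have := @spreading k (fun s i => phi (k + s)%nat i) kappa j Hkappa _ _ i.
  rewrite ek addn0; apply.
  - by move=> s l; rewrite addnS; exact: phi_step_ge.
  - by move=> s l m hE; rewrite addnS; apply: phi_step_ge; exact: edge_weight.
have : \big[Rplus/0]_(j < I) (kappa ^ T * phi k j) <= \big[Rplus/0]_(j < I) phi nu i.
  exact: sumI_le.
rewrite sumI_scale phi_sum sumI_const => h.
by apply: (Rmult_le_reg_l (INR I)); lra.
Qed.

(** Dividing by [phi] turns the column stochastic [A] into row stochastic weights, so the updates of
    D and Theta are genuine averages. *)
Definition pushW nu i j := A nu i j * phi nu j / phi nu.+1 i.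

Lemma pushW_ge0 nu i j : 0 <= pushW nu i j.
Proof.
apply: Rdiv_ge0; last exact: phi_gt0.
by apply: Rmult_le_pos; [exact: weights_ge0 | exact: Rlt_le (phi_gt0 _ _)].
Qed.

Lemma pushW_sum nu i : \big[Rplus/0]_(j < I) pushW nu i j = 1.
Proof.
rewrite (eq_bigr (fun j => / phi nu.+1 i * (A nu i j * phi nu j))); last first.
  by move=> j _; rewrite /pushW; field; have := phi_gt0 nu.+1 i; lra.
by rewrite sumI_scale -phi_rec Rinv_l //; have := phi_gt0 nu.+1 i; lra.
Qed.

Definition push_weight := kappa * kappa ^ T / INR I.

Lemma pushW_ge nu i j : kappa <= A nu i j -> push_weight <= pushW nu i j.
Proof.
move=> h; have I1 : 1 <= INR I by exact: (INR_leq HI).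
have p0 := phi_gt0 nu.+1 i; have p1 := phi_le nu.+1 i.
have kT : 0 < kappa ^ T by exact: pow_lt.
apply: Rmult_le_compat.
- by apply: Rlt_le; apply: Rmult_lt_0_compat.
- by apply: Rlt_le; apply: Rinv_0_lt_compat; lra.
- by apply: Rmult_le_compat => //; [lra | lra | exact: phi_lower].
- exact: Rinv_le_contravar.
Qed.

Lemma pushW_diag nu i : push_weight <= pushW nu i i.
Proof. exact: pushW_ge. Qed.

Lemma pushW_edge nu i j : E nu j i -> push_weight <= pushW nu i j.
Proof. by move=> hE; apply: pushW_ge; exact: edge_weight. Qed.

Lemma push_weight_bounds : 0 < push_weight <= 1.
Proof.
have I1 : 1 <= INR I by exact: (INR_leq HI).
have kT : 0 < kappa ^ T by exact: pow_lt.
split; first by apply: Rdiv_lt_0_compat; [apply: Rmult_lt_0_compat | lra].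
have i0 : 'I_I by exact: (Ordinal HI).
apply: Rle_trans (pushW_diag 0%nat i0) _; rewrite -(pushW_sum 0%nat i0).
by apply: (@sumI_term I (fun j => pushW 0%nat i0 j)) => j; exact: pushW_ge0.
Qed.

Lemma pushW_phi nu i j : phi nu.+1 i * pushW nu i j = A nu i j * phi nu j.
Proof. by rewrite /pushW; field; have := phi_gt0 nu.+1 i; lra. Qed.

Lemma push_sum_step (S : finType) nu i (Y : 'I_I -> vec S) t :
  vscale (/ phi nu.+1 i) (vsumI_if (fun j => (j == i) || E nu j i)
     (fun j => vscale (A nu i j * phi nu j) (Y j))) t
  = \big[Rplus/0]_(j < I) (pushW nu i j * Y j t).
Proof.
rewrite /vscale /vsumI_if.
rewrite (eq_bigr (fun j => A nu i j * (phi nu j * Y j t))); last by move=> *; ring.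
rewrite weights_neighbours -sumI_scale; apply: eq_bigr => j _.
by rewrite /pushW; field; have := phi_gt0 nu.+1 i; lra.
Qed.

End PushSum.

End Consensus.

(** * Proximal steps *)

Section ProximalSteps.
Variable T : finType.
Variables (O S : vec T -> Prop) (h : vec T -> R) (Gr : vec T -> vec T).
Variables (g : vec T -> R) (m tau : R).
Hypothesis opO : is_open O.
Hypothesis cO : convex_set O.
Hypothesis ch : convex_on O h.
Hypothesis m0 : 0 <= m.
Hypothesis sg : strongly_convex_on m O g.
Hypothesis SO : subset_of S O.
Hypothesis clS : is_closed S.
Hypothesis cS : convex_set S.
Hypothesis hg : forall z, S z -> has_grad h z (Gr z).
Hypothesis tau0 : 0 < tau.

(** The linear term [c] is the tracking correction in the D-step; the X-step is the case [c = 0],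
    treated in [prox_surrogate]. *)
Lemma prox_surrogate_linear lin Y0 c :
  S Y0 -> let x := argmin_on S (fun Y => surrogate lin h (Gr Y0) tau Y0 Y
                                  + inner c (vsub Y Y0) + g Y) in
  S x /\ forall y, S y -> m / 2 * fnorm (vsub y x) ^ 2 <=
    inner (vadd (vadd (Gr (if lin then Y0 else x)) (vscale tau (vsub x Y0))) c)
          (vsub y x) + g y - g x.
Proof.
move=> S0; set obj := (fun Y => _); move=> x.
have sc : strongly_convex_on (tau + 0 + m) O obj.
  apply: strongly_convex_add sg; apply: strongly_convex_add.
    exact: surrogate_strongly_convex.
  exact: linear_strongly_convex.
have mp : 0 < tau + 0 + m by lra.
have hx : is_min_on S obj x.
  by apply: (argmin_strongly_convex mp opO cO sc SO clS); exists Y0.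
split; first by case: hx.
apply: (prox_optimality cS (strongly_convex_subset SO sg) _ hx) => [Y|]; first by [].
apply: has_grad_add; last exact: has_grad_linear.
by apply: surrogate_has_grad; [lra | apply: hg; case: hx].
Qed.

Lemma prox_surrogate lin Y0 :
  S Y0 -> let x := argmin_on S (fun Y => surrogate lin h (Gr Y0) tau Y0 Y + g Y) in
  S x /\ forall y, S y -> m / 2 * fnorm (vsub y x) ^ 2 <=
    inner (vadd (Gr (if lin then Y0 else x)) (vscale tau (vsub x Y0)))
          (vsub y x) + g y - g x.
Proof.
move=> S0 x; pose z : vec T := fun _ => 0.
have z0 (y : vec T) : inner z y = 0.
  by rewrite /inner big1 // => t _; rewrite /z; ring.
have [] := prox_surrogate_linear lin z S0.
have -> : (fun Y => surrogate lin h (Gr Y0) tau Y0 Y + inner z (vsub Y Y0) + g Y) =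
          (fun Y => surrogate lin h (Gr Y0) tau Y0 Y + g Y).
  by apply: functional_extensionality => Y; rewrite z0; ring.
rewrite -/x => Sx hx; split=> // y Sy; have := hx y Sy.
by rewrite (inner_addl _ z) z0; lra.
Qed.

(* [b] plays the role of a subgradient of [- g] at [y], up to the slack [c]. *)
Lemma prox_contraction_base x xp y zeta b c :
  m / 2 * fnorm (vsub y xp) ^ 2 <=
    inner (vadd zeta (vscale tau (vsub xp x))) (vsub y xp) + g y - g xp ->
  m / 2 * fnorm (vsub xp y) ^ 2 <= inner b (vsub xp y) + g xp - g y + c * fnorm (vsub xp y) ->
  (m + tau) * fnorm (vsub xp y) ^ 2 <=
    tau * inner (vsub x y) (vsub xp y) - inner (vsub zeta b) (vsub xp y)
    + c * fnorm (vsub xp y).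
Proof.
rewrite (fnorm_vsubC y xp) !fnorm_sq; set n := fnorm (vsub xp y).
have -> : inner (vadd zeta (vscale tau (vsub xp x))) (vsub y xp) =
  - inner zeta (vsub xp y) - tau * inner (vsub xp y) (vsub xp y)
  + tau * inner (vsub x y) (vsub xp y).
  by rewrite !innerE; ring.
by rewrite (inner_subl zeta); lra.
Qed.

End ProximalSteps.

(** The inequality passes to the limit because [G], convex on an open set, is Lipschitz near [z]. *)
Lemma vi_limit (T : finType) (O S : vec T -> Prop) (G : vec T -> R) z p y :
  is_open O -> convex_set O -> convex_on O G -> subset_of S O -> S z ->
  (forall eps, 0 < eps -> exists w a, fnorm (vsub w z) <= eps /\
     fnorm (vsub a p) <= eps /\ 0 <= inner a (vsub y w) + G y - G w) ->
  0 <= inner p (vsub y z) + G y - G z.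
Proof.
move=> opO cO cG SO Sz lim.
have [r [C [r0 [C0 hr]]]] := convex_local_lipschitz opO cO cG (SO z Sz).
have n1 := fnorm_ge0 (vsub y z); have n2 := fnorm_ge0 p.
apply: (@Rpos_le_scale _ _ (fnorm (vsub y z) + 1 + fnorm p + C)); first by lra.
move=> eps e0; pose e := Rmin (Rmin eps r) 1.
have e00 : 0 < e by repeat apply: Rmin_pos; lra.
have e1 : e <= 1 by exact: Rmin_r.
have e2 : e <= eps by apply: Rle_trans (Rmin_l _ _) (Rmin_l _ _).
have e3 : e <= r by apply: Rle_trans (Rmin_l _ _) (Rmin_r _ _).
have [w [a [hw [ha h]]]] := lim e e00.
have [|_ hG] := hr w; first by lra.
have n3 := fnorm_ge0 (vsub w z); have n4 := fnorm_ge0 (vsub a p).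
have k1 := cauchy_schwarz (vsub a p) (vsub y w).
have k2 := cauchy_schwarz p (vsub z w); rewrite (fnorm_vsubC z w) in k2.
have k3 := fnorm_tri z y w; rewrite (fnorm_vsubC z w) in k3.
have k4 : fnorm (vsub a p) * fnorm (vsub y w) <= e * (fnorm (vsub y z) + 1).
  by apply: Rmult_le_compat; try lra; exact: fnorm_ge0.
have k5 : fnorm p * fnorm (vsub w z) <= fnorm p * e by apply: Rmult_le_compat_l; lra.
have k6 : C * fnorm (vsub w z) <= C * e by apply: Rmult_le_compat_l; lra.
have k7 : (fnorm (vsub y z) + 1 + fnorm p + C) * e <=
          (fnorm (vsub y z) + 1 + fnorm p + C) * eps by apply: Rmult_le_compat_l; lra.
have -> : inner p (vsub y z) = inner a (vsub y w) - inner (vsub a p) (vsub y w)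
   - inner p (vsub z w) by rewrite !innerE; ring.
have := Rle_abs (G w - G z); have := Rle_abs (- (G w - G z)); rewrite Rabs_Ropp; lra.
Qed.

Lemma convex_combination_ord (I : nat) (T : finType) (S : vec T -> Prop) (h : vec T -> R)
    (a : 'I_I -> R) (x : 'I_I -> vec T) :
  convex_set S -> convex_on S h -> (forall j, 0 <= a j) -> (forall j, S (x j)) ->
  \big[Rplus/0]_(j < I) a j = 1 ->
  S (fun t => \big[Rplus/0]_(j < I) (a j * x j t)) /\
  h (fun t => \big[Rplus/0]_(j < I) (a j * x j t)) <= \big[Rplus/0]_(j < I) (a j * h (x j)).
Proof. exact: convex_combination. Qed.

Lemma weighted_average_dist (J T : finType) (a : J -> R) (x : J -> vec T) z s :
  (forall j, 0 <= a j) -> \big[Rplus/0]_j a j = 1 -> (forall j, fnorm (vsub (x j) z) <= s) ->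
  fnorm (vsub (fun t => \big[Rplus/0]_j (a j * x j t)) z) <= s.
Proof.
move=> a0 a1 hs.
have [|||||_] := @convex_combination T (fun _ => True) (fun w => fnorm (vsub w z)) J a x => //.
  by move=> u v c _ _; exact: fnorm_sub_comb.
move=> h; apply: Rle_trans h _.
have -> : s = \big[Rplus/0]_j (a j * s).
  rewrite (eq_bigr (fun j => s * a j)); last by move=> *; ring.
  by rewrite sumR_scale a1; ring.
by apply: sumR_le => j; exact: Rmult_le_compat_l.
Qed.

Fixpoint geometric (r : R) (e : nat -> R) (q0 : R) (k : nat) : R :=
  if k is S l then r * geometric r e q0 l + e l else q0.

Lemma geometric_ge0 r e q0 k : 0 <= r -> 0 <= q0 -> (forall k, 0 <= e k) ->
  0 <= geometric r e q0 k.
Proof.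
move=> r0 h0 e0; elim: k => [|k IH] //=; have := e0 k.
by have := Rmult_le_pos _ _ r0 IH; lra.
Qed.

Lemma sum_sqr_le (I : nat) (a : 'I_I -> R) :
  (\big[Rplus/0]_(i < I) a i) ^ 2 <= INR I * \big[Rplus/0]_(i < I) (a i ^ 2).
Proof.
have -> : (\big[Rplus/0]_(i < I) a i) ^ 2 =
    \big[Rplus/0]_(i < I) \big[Rplus/0]_(j < I) (a i * a j).
  rewrite [RHS](eq_bigr (fun i => (\big[Rplus/0]_(j < I) a j) * a i)); last first.
    by move=> i _; rewrite [LHS]sumI_scale; ring.
  by rewrite [RHS]sumI_scale; ring.
apply: (Rle_trans _ (\big[Rplus/0]_(i < I) \big[Rplus/0]_(j < I) (/ 2 * a i ^ 2 + / 2 * a j ^ 2))).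
  by apply: sumI_le => i; apply: sumI_le => j; have := pow2_ge_0 (a i - a j); lra.
rewrite (eq_bigr (fun i => INR I * / 2 * a i ^ 2 + / 2 * \big[Rplus/0]_(j < I) a j ^ 2)).
  by rewrite sumI_add sumI_const sumI_scale; lra.
by move=> i _; rewrite sumI_add sumI_const sumI_scale; ring.
Qed.

(** For [Dhat] and [Xhat]: an instance of [prox_surrogate] in which the smooth function is linear
    with constant gradient [p]. *)
Lemma prox_linear (T : finType) (O S : vec T -> Prop) (g : vec T -> R) m tau (p Y0 : vec T) :
  is_open O -> convex_set O -> 0 <= m -> strongly_convex_on m O g -> subset_of S O ->
  is_closed S -> convex_set S -> 0 < tau -> S Y0 ->
  let x := argmin_on S (fun Y => inner p (vsub Y Y0) + tau / 2 * fnorm (vsub Y Y0) ^ 2 + g Y) in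
  S x /\ forall y, S y -> m / 2 * fnorm (vsub y x) ^ 2 <=
    inner (vadd p (vscale tau (vsub x Y0))) (vsub y x) + g y - g x.
Proof.
move=> oO cO m0 sg SO clS cS t0 S0.
have r0 : 0 <= 0 by lra.
exact: (@prox_surrogate T O S (fun Y => inner p (vsub Y Y0)) (fun _ => p) g m tau oO cO
  (strongly_convex_convex r0 (linear_strongly_convex (S:=O) p Y0)) m0 sg SO clS cS
  (fun z _ => has_grad_linear p Y0 z) t0 true Y0 S0).
Qed.

(** * The algorithm *)

Lemma fnorm_vadd_subr (T : finType) (x k : vec T) : fnorm (vsub (vadd x k) x) = fnorm k.
Proof. by congr fnorm; vring. Qed.

Lemma vcomb_step (T : finType) (c : R) (x y : vec T) :
  vadd x (vscale c (vsub y x)) = vcomb c y x.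
Proof. by vring. Qed.

Section D4L.
Variables (I M K : nat) (n : 'I_I -> nat).
Hypothesis HI : (0 < I)%nat.
Unset Implicit Arguments.
Variables (Dset Oset : Mat M K -> Prop) (Xset Oi : forall i : 'I_I, Mat K (n i) -> Prop).
Variable f : forall i : 'I_I, Mat M K -> Mat K (n i) -> R.
Variable gD : forall i : 'I_I, Mat M K -> Mat K (n i) -> Mat M K.
Variable gX : forall i : 'I_I, Mat M K -> Mat K (n i) -> Mat K (n i).
Variables (L : 'I_I -> Mat M K -> R) (g : forall i : 'I_I, Mat K (n i) -> R).
Variables (G : Mat M K -> R) (mu : 'I_I -> R).
Hypothesis HO : is_open Oset /\ convex_set Oset /\ subset_of Dset Oset.
Hypothesis HOi : forall i, is_open (Oi i) /\ convex_set (Oi i) /\ subset_of (Xset i) (Oi i).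
Hypothesis Hf_C2 : forall i,
  C2_on (fun z => Oset (fstv z) /\ Oi i (sndv z))
        (fun z => f i (fstv z) (sndv z))
        (fun z => pairv (gD i (fstv z) (sndv z)) (gX i (fstv z) (sndv z))).
Hypothesis Hf_lb : forall i, exists c, forall D X, Oset D -> Oi i X -> c <= f i D X.
Hypothesis Hf_bicvx : forall i,
  (forall X, Oi i X -> convex_on Oset (fun D => f i D X)) /\
  (forall D, Oset D -> convex_on (Oi i) (f i D)).
Hypothesis HLip : forall i D, Dset D -> forall X X', Xset i X -> Xset i X' ->
  fnorm (vsub (gX i D X) (gX i D X')) <= L i D * fnorm (vsub X X').
Hypothesis HD : nonempty Dset /\ is_compact Dset /\ convex_set Dset.
Hypothesis HX : forall i, nonempty (Xset i) /\ is_closed (Xset i) /\ convex_set (Xset i).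
Hypothesis HG : convex_on Oset G.
Hypothesis Hg : forall i,
  (is_compact (Xset i) /\ convex_on (Oi i) (g i)) \/
  (0 < mu i /\ strongly_convex_on (mu i) (Oi i) (g i)).
Variables (E : nat -> 'I_I -> 'I_I -> bool) (A : nat -> 'I_I -> 'I_I -> R) (kappa : R).
Variable B : nat.
Hypothesis HB0 : (0 < B)%nat.
Hypothesis HB : forall k : nat, strongly_connected
  (fun j i => exists t : nat, (k * B <= t <= (k + 1) * B - 1)%nat /\ E t j i).
Hypothesis Hkappa : 0 < kappa.
Hypothesis HAdiag : forall nu i, kappa <= A nu i i.
Hypothesis HAoff : forall nu (i j : 'I_I), j <> i ->
  (E nu j i -> kappa <= A nu i j) /\ (~~ E nu j i -> A nu i j = 0).
Hypothesis HAcol : forall nu j, \big[Rplus/0]_(i < I) A nu i j = 1.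
Variables (linD linX : 'I_I -> bool) (tauD tauX : nat -> 'I_I -> R) (gam : nat -> R).
Hypothesis Htau_pos : forall nu i, 0 < tauD nu i /\ 0 < tauX nu i.
Hypothesis HT1D : forall i, exists lo hi, 0 < lo /\ forall nu, lo <= tauD nu i <= hi.
Hypothesis HT1X : forall i, exists hi, forall nu, tauX nu i <= hi.
Variables (Dl Dt U Th : nat -> 'I_I -> Mat M K) (Xs : nat -> forall i : 'I_I, Mat K (n i)).
Variable phi : nat -> 'I_I -> R.
Variable epsX : R.
Hypothesis HepsX : 0 < epsX.
Hypothesis HT1eps : forall i nu, (1 <= nu)%nat -> L i (U nu i) / 2 + epsX <= tauX nu i.
Hypothesis Hgam : forall nu, 0 < gam nu <= 1.
Hypothesis Hgam_div : cv_infty (psum gam).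
Hypothesis Hgam_sq : summable (fun k => gam k ^ 2).
Hypothesis Hinit : forall i, phi 0%nat i = 1 /\ Dset (Dl 0%nat i) /\ Xset i (Xs 0%nat i) /\
  Th 0%nat i = gD i (Dl 0%nat i) (Xs 0%nat i).
Hypothesis HDt : forall nu i, Dt nu i =
  argmin_on Dset (fun D =>
    surrogate (linD i) (fun D' => f i D' (Xs nu i)) (gD i (Dl nu i) (Xs nu i))
              (tauD nu i) (Dl nu i) D
    + inner (vsub (vscale (INR I) (Th nu i)) (gD i (Dl nu i) (Xs nu i)))
            (vsub D (Dl nu i))
    + G D).
Hypothesis HU : forall nu i,
  U nu i = vadd (Dl nu i) (vscale (gam nu) (vsub (Dt nu i) (Dl nu i))).
Hypothesis HXs : forall nu i, Xs (S nu) i =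
  argmin_on (Xset i) (fun X =>
    surrogate (linX i) (fun X' => f i (U nu i) X') (gX i (U nu i) (Xs nu i))
              (tauX nu i) (Xs nu i) X
    + g i X).
Hypothesis Hphi : forall nu i, phi (S nu) i =
  \big[Rplus/0]_(j < I | (j == i) || E nu j i) (A nu i j * phi nu j).
Hypothesis HDl : forall nu i, Dl (S nu) i =
  vscale (/ phi (S nu) i)
    (vsumI_if (fun j => (j == i) || E nu j i)
              (fun j => vscale (A nu i j * phi nu j) (U nu j))).
Hypothesis HTh : forall nu i, Th (S nu) i =
  vadd (vscale (/ phi (S nu) i)
          (vsumI_if (fun j => (j == i) || E nu j i)
                    (fun j => vscale (A nu i j * phi nu j) (Th nu j))))
       (vscale (/ phi (S nu) i)
          (vsub (gD i (Dl (S nu) i) (Xs (S nu) i)) (gD i (Dl nu i) (Xs nu i)))).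
Variables (tDh tXh : R).
Hypothesis HtDh : 0 < tDh.
Hypothesis HtXh : 0 < tXh.

Set Implicit Arguments.

Let oO : is_open Oset. Proof. by case: HO. Qed.
Let cO : convex_set Oset. Proof. by case: HO => _ []. Qed.
Let DO : subset_of Dset Oset. Proof. by case: HO => _ []. Qed.
Let oOi i : is_open (Oi i). Proof. by case: (HOi i). Qed.
Let cOi i : convex_set (Oi i). Proof. by case: (HOi i) => _ []. Qed.
Let XO i : subset_of (Xset i) (Oi i). Proof. by case: (HOi i) => _ []. Qed.
Let clD : is_closed Dset. Proof. by apply: compact_closed; case: HD => _ []. Qed.
Let cD : convex_set Dset. Proof. by case: HD => _ []. Qed.
Let clX i : is_closed (Xset i). Proof. by case: (HX i) => _ []. Qed.
Let cX i : convex_set (Xset i). Proof. by case: (HX i) => _ []. Qed.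
Let i0 : 'I_I := Ordinal HI.
Let INR_I : 1 <= INR I. Proof. exact: (INR_leq HI). Qed.

Lemma has_grad_D i D X : Oset D -> Oi i X -> has_grad (fun D' => f i D' X) D (gD i D X).
Proof.
move=> hD hX; case: (Hf_C2 i) => [[h _] _].
exact: (has_grad_fst (h (pairv D X) (conj hD hX))).
Qed.

Lemma has_grad_X i D X : Oset D -> Oi i X -> has_grad (f i D) X (gX i D X).
Proof.
move=> hD hX; case: (Hf_C2 i) => [[h _] _].
exact: (has_grad_snd (h (pairv D X) (conj hD hX))).
Qed.

Lemma convex_D i X : Oi i X -> convex_on Oset (fun D => f i D X).
Proof. by case: (Hf_bicvx i) => h _; exact: h. Qed.

Lemma convex_X i D : Oset D -> convex_on (Oi i) (f i D).
Proof. by case: (Hf_bicvx i) => _; exact. Qed.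

Lemma convex_g i : convex_on (Oi i) (g i).
Proof.
by case: (Hg i) => [[_]//|[m0 sc]]; apply: strongly_convex_convex sc; lra.
Qed.

Lemma Dt_optimality nu i : Dset (Dl nu i) -> Xset i (Xs nu i) ->
  Dset (Dt nu i) /\ forall y, Dset y -> 0 <=
    inner (vadd (vadd (gD i (if linD i then Dl nu i else Dt nu i) (Xs nu i))
                      (vscale (tauD nu i) (vsub (Dt nu i) (Dl nu i))))
                (vsub (vscale (INR I) (Th nu i)) (gD i (Dl nu i) (Xs nu i))))
          (vsub y (Dt nu i)) + G y - G (Dt nu i).
Proof.
move=> hD hX; have hOX := XO hX.
have r0 : 0 <= 0 by lra.
have := @prox_surrogate_linear _ Oset Dset (fun D => f i D (Xs nu i)) (fun D => gD i D (Xs nu i))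
  G 0 (tauD nu i) oO cO (convex_D hOX) r0 (convex_strongly0 HG) DO clD cD
  (fun z hz => has_grad_D (DO hz) hOX) (proj1 (Htau_pos nu i)) (linD i) (Dl nu i)
  (vsub (vscale (INR I) (Th nu i)) (gD i (Dl nu i) (Xs nu i))) hD.
rewrite /= -HDt => -[h1 h2]; split=> // y hy; have := h2 y hy.
by move: (fnorm _) => N; case: (linD i); lra.
Qed.

Lemma Xs_optimality nu i m : Dset (U nu i) -> Xset i (Xs nu i) -> 0 <= m ->
  strongly_convex_on m (Oi i) (g i) ->
  Xset i (Xs nu.+1 i) /\ forall y, Xset i y -> m / 2 * fnorm (vsub y (Xs nu.+1 i)) ^ 2 <=
    inner (vadd (gX i (U nu i) (if linX i then Xs nu i else Xs nu.+1 i))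
                (vscale (tauX nu i) (vsub (Xs nu.+1 i) (Xs nu i))))
          (vsub y (Xs nu.+1 i)) + g i y - g i (Xs nu.+1 i).
Proof.
move=> hU hX m0 sg; have hOU := DO hU.
have := @prox_surrogate _ (Oi i) (Xset i) (f i (U nu i)) (gX i (U nu i))
  (g i) m (tauX nu i) (@oOi i) (@cOi i) (convex_X hOU) m0 sg (@XO i) (@clX i) (@cX i)
  (fun z hz => has_grad_X hOU (XO hz)) (proj2 (Htau_pos nu i)) (linX i) (Xs nu i) hX.
by rewrite /= -HXs => -[h1 h2].
Qed.

Let phi0 i : phi 0%nat i = 1. Proof. by case: (Hinit i). Qed.
Let phigt := phi_gt0 Hkappa HAdiag HAoff phi0 Hphi.
Let W := pushW A phi.
Let W0 nu i j : 0 <= W nu i j. Proof. exact: (pushW_ge0 Hkappa HAdiag HAoff phi0 Hphi). Qed.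
Let W1 nu i : \big[Rplus/0]_(j < I) W nu i j = 1.
Proof. exact: (pushW_sum Hkappa HAdiag HAoff phi0 Hphi). Qed.

Lemma Dl_step nu i : Dl nu.+1 i = fun t => \big[Rplus/0]_(j < I) (W nu i j * U nu j t).
Proof.
apply: vec_ext => t.
by rewrite HDl; apply: (push_sum_step Hkappa HAdiag HAoff phi0 Hphi).
Qed.

Lemma Th_step nu i t : Th nu.+1 i t = \big[Rplus/0]_(j < I) (W nu i j * Th nu j t)
  + / phi nu.+1 i * (gD i (Dl nu.+1 i) (Xs nu.+1 i) t - gD i (Dl nu i) (Xs nu i) t).
Proof.
rewrite HTh {1}/vadd; congr (_ + _).
by apply: (push_sum_step Hkappa HAdiag HAoff phi0 Hphi).
Qed.

Lemma U_in nu i : Dset (Dl nu i) -> Dset (Dt nu i) -> Dset (U nu i).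
Proof. by move=> h1 h2; rewrite HU vcomb_step; apply: cD => //; have := Hgam nu; lra. Qed.

(** One joint induction, since [argmin_on] is known to be a minimizer only when the current iterates
    are feasible. *)
Lemma feasible nu : forall i, Dset (Dl nu i) /\ Xset i (Xs nu i).
Proof.
elim: nu => [|nu IH] i; first by case: (Hinit i) => _ [h1 [h2 _]].
have hU j : Dset (U nu j).
  by case: (IH j) => h1 h2; apply: U_in => //; case: (Dt_optimality h1 h2).
split; last first.
  case: (IH i) => _ h2; have r0 : 0 <= 0 by lra.
  by case: (Xs_optimality (hU i) h2 r0 (convex_strongly0 (convex_g (i:=i)))).
rewrite Dl_step.
(* With the zero function, [convex_combination] delivers membership alone. *)
have c0 : convex_on Dset (fun _ => 0) by move=> *; lra.
by case: (@convex_combination _ Dset (fun _ => 0) 'I_I (W nu i) (U nu) cD c0).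
Qed.

Lemma Dl_in nu i : Dset (Dl nu i). Proof. by case: (feasible nu i). Qed.
Lemma Xs_in nu i : Xset i (Xs nu i). Proof. by case: (feasible nu i). Qed.
Lemma Dt_in nu i : Dset (Dt nu i).
Proof. by case: (Dt_optimality (Dl_in nu i) (Xs_in nu i)). Qed.
Lemma U_Dset nu i : Dset (U nu i). Proof. by apply: U_in; [exact: Dl_in | exact: Dt_in]. Qed.

(** A bound on the norm over [Dset]; the diameter is at most twice this number. *)
Definition diamD := proj1_sig (constructive_indefinite_description _
  (compact_bounded (proj1 (proj2 HD)))).

Lemma diamD_spec : 0 <= diamD /\ bounded_by Dset diamD.
Proof. by rewrite /diamD; case: constructive_indefinite_description. Qed.

Lemma diam_dist D D' : Dset D -> Dset D' -> fnorm (vsub D D') <= 2 * diamD.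
Proof.
case: diamD_spec => _ b hD hD'; apply: Rle_trans (fnorm_sub _ _) _.
by have := b _ hD; have := b _ hD'; lra.
Qed.

(** The gradients are jointly Lipschitz only on bounded sets, hence the radius [r]; it becomes the
    bound on the iterates once that is known. *)
Definition gradients_lipschitz i r C := forall D X D' X', Dset D -> Dset D' ->
  Xset i X -> Xset i X' -> fnorm X <= r -> fnorm X' <= r ->
  fnorm (vsub (gD i D X) (gD i D' X')) <= C * (fnorm (vsub D D') + fnorm (vsub X X')) /\
  fnorm (vsub (gX i D X) (gX i D' X')) <= C * (fnorm (vsub D D') + fnorm (vsub X X')).

Lemma joint_lipschitz i r : exists C, 0 <= C /\ gradients_lipschitz i r C.
Proof.
pose Kc (z : vec ('I_M * 'I_K + 'I_K * 'I_(n i))%type) :=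
  Dset (fstv z) /\ (Xset i (sndv z) /\ fnorm (sndv z) <= r).
have split_sub (z w : vec ('I_M * 'I_K + 'I_K * 'I_(n i))%type) :
  fstv (vsub z w) = vsub (fstv z) (fstv w) /\ sndv (vsub z w) = vsub (sndv z) (sndv w) by [].
have clK : is_closed Kc.
  move=> z nz; case: (classic (Dset (fstv z))) => [h1|h1]; last first.
    have [e [e0 he]] := clD h1; exists e; split=> // w hw [hw1 _].
    apply: (he (fstv w)) => //; apply: Rle_lt_trans hw.
    by case: (split_sub w z) => <- _; exact: fnorm_fstv.
  case: (classic (Xset i (sndv z))) => [h2|h2]; last first.
    have [e [e0 he]] := clX h2; exists e; split=> // w hw [_ [hw1 _]].
    apply: (he (sndv w)) => //; apply: Rle_lt_trans hw.
    by case: (split_sub w z) => _ <-; exact: fnorm_sndv.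
  have h3 : r < fnorm (sndv z).
    by apply: Rnot_le_lt => c; apply: nz.
  exists (fnorm (sndv z) - r); split; first lra.
  move=> w hw [_ [_ hw1]].
  have hs := fnorm_sndv (vsub w z); case: (split_sub w z) => _ es; rewrite es in hs.
  have := fnorm_add (sndv w) (vsub (sndv z) (sndv w)); rewrite vadd_subK fnorm_vsubC.
  move: h3 hw1 hs hw; set a1 := fnorm (sndv z); set a2 := fnorm (sndv w).
  by set a3 := fnorm (vsub (sndv w) (sndv z)); set a4 := fnorm (vsub w z); lra.
have bK : bounded_by Kc (diamD + r).
  move=> z [h1 [_ h2]]; have -> : z = pairv (fstv z) (sndv z) by apply: vec_ext; case.
  apply: Rle_trans (fnorm_pair_le _ _) _; case: diamD_spec => _ b.
  by move: h2 (b _ h1); set a1 := fnorm (sndv z); set a2 := fnorm (fstv z); lra.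
have cK : convex_set Kc.
  move=> z w c [h1 [h2 h3]] [h4 [h5 h6]] hc; split; first exact: (cD h1 h4 hc).
  by split; [exact: (cX h2 h5 hc) | exact: (fnorm_comb_le hc h3 h6)].
have KS : subset_of Kc (fun z => Oset (fstv z) /\ Oi i (sndv z)).
  by move=> z [h1 [h2 _]]; split; [exact: DO | exact: XO].
have [C [C0 hC]] := C2_grad_lipschitz (Hf_C2 i) KS clK bK cK.
exists C; split=> // D X D' X' hD hD' hX hX' hr hr'.
have := hC (pairv D X) (pairv D' X') (conj hD (conj hX hr)) (conj hD' (conj hX' hr')).
rewrite !fstv_pair !sndv_pair !vsub_pair => h.
have h1 := fnorm_pair_le (vsub D D') (vsub X X').
have h2 := Rmult_le_compat_l _ _ _ C0 h1.
split; apply: Rle_trans _ (Rle_trans _ _ _ h h2).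
- exact: (fnorm_fstv (pairv (vsub (gD i D X) (gD i D' X')) (vsub (gX i D X) (gX i D' X')))).
- exact: (fnorm_sndv (pairv (vsub (gD i D X) (gD i D' X')) (vsub (gX i D X) (gX i D' X')))).
Qed.

Lemma gX_nonexpansive nu i x y w : (1 <= nu)%nat -> Xset i x -> Xset i y -> Xset i w ->
  Rabs (tauX nu i * inner (vsub x y) (vsub w y)
        - inner (vsub (gX i (U nu i) x) (gX i (U nu i) y)) (vsub w y))
    <= tauX nu i * (fnorm (vsub x y) * fnorm (vsub w y)).
Proof.
move=> nu1 hx hy hw; have hU := U_Dset nu i; have hOU := DO hU.
(* [L] is not assumed nonnegative, and it can be negative when [Xset i] is a single point, whence
   [Rmax 0]. *)
apply: (@grad_step_nonexpansive _ (Xset i) (f i (U nu i)) (gX i (U nu i))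
  (Rmax 0 (L i (U nu i)))) => //.
- by move=> u v c hu hv; apply: convex_X => //; apply: XO.
- by move=> z hz; apply: has_grad_X => //; exact: XO.
- move=> z z' hz hz'; apply: Rle_trans (HLip i _ hU _ _ hz hz') _.
  by apply: Rmult_le_compat_r; [exact: fnorm_ge0 | exact: Rmax_r].
- exact: Rmax_l.
- have := HT1eps i nu nu1; have [_ tp] := Htau_pos nu i.
  by rewrite /Rmax; case: Rle_dec => _; lra.
Qed.

(* The case analysis on the surrogate: an exact one contributes only a monotone
   term, a linearized one is handled by nonexpansiveness. *)
Lemma X_contraction nu i m y c : (1 <= nu)%nat -> 0 < m ->
  strongly_convex_on m (Oi i) (g i) -> Xset i y ->
  m / 2 * fnorm (vsub (Xs nu.+1 i) y) ^ 2 <=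
    inner (gX i (U nu i) y) (vsub (Xs nu.+1 i) y) + g i (Xs nu.+1 i) - g i y
    + c * fnorm (vsub (Xs nu.+1 i) y) ->
  (m + tauX nu i) * fnorm (vsub (Xs nu.+1 i) y) <= tauX nu i * fnorm (vsub (Xs nu i) y) + Rmax 0 c.
Proof.
move=> nu1 m0 sg hy hr; have hU := U_Dset nu i; have hX := Xs_in nu i.
have m0' : 0 <= m by lra.
have [hX' vi] := Xs_optimality hU hX m0' sg.
have := prox_contraction_base (vi y hy) hr.
set w := vsub (Xs nu.+1 i) y; set v := vsub (Xs nu i) y.
have tp := proj2 (Htau_pos nu i).
have w0 : 0 <= fnorm w by exact: fnorm_ge0.
have v0 : 0 <= fnorm v by exact: fnorm_ge0.
have cm := Rmax_r 0 c; have cm0 := Rmax_l 0 c.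
case: (Rle_lt_or_eq_dec _ _ w0) => [wp|<-] h; last by nra.
apply: (Rmult_le_reg_r (fnorm w)) => //.
have : tauX nu i * inner v w - inner (vsub (gX i (U nu i)
    (if linX i then Xs nu i else Xs nu.+1 i)) (gX i (U nu i) y)) w
  <= tauX nu i * (fnorm v * fnorm w).
  case: (linX i).
    have := @gX_nonexpansive nu i (Xs nu i) y (Xs nu.+1 i) nu1 hX hy hX'.
    by rewrite -/w -/v => hh; apply: Rle_trans (Rle_abs _) hh.
  have := convex_grad_monotone (convex_X (DO hU)) (XO hX') (XO hy)
     (has_grad_X (DO hU) (XO hX')) (has_grad_X (DO hU) (XO hy)).
  rewrite -/w; have := Rmult_le_compat_l _ _ _ (Rlt_le _ _ tp) (cauchy_schwarz v w); lra.
have : c * fnorm w <= Rmax 0 c * fnorm w by apply: Rmult_le_compat_r.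
by move: h; rewrite /=; lra.
Qed.

(** For strongly convex [g i], contract towards the initial point [y]. As [y] is no fixed point,
    there is a slack: [C1] from the minorant of [g i] at [y] and [C3] from the gradients at [y],
    uniform in [U] because [Dset] is bounded. The factor [tauX / (tauX + mu i)] increases with
    [tauX], so [hi / (hi + mu i)] is a uniform ratio. *)
Lemma Xs_bounded_i i : exists C, forall nu, fnorm (Xs nu i) <= C.
Proof.
case: (Hg i) => [[cpt _]|[m0 sg]].
  by have [C [_ hC]] := compact_bounded cpt; exists C => nu; apply: hC; exact: Xs_in.
pose y := Xs 0%nat i; have hy : Xset i y := Xs_in 0 i.
have m0' : 0 <= mu i by lra.
have [C1 [C10 hC1]] := strongly_convex_minorant m0' (@oOi i) (@cOi i) sg (XO hy).
have [C2 [C20 hC2]] := joint_lipschitz i (fnorm y).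
pose D0 := Dl 0%nat i; pose C3 := fnorm (gX i D0 y) + C2 * (2 * diamD).
have hC3 nu : fnorm (gX i (U nu i) y) <= C3.
  have [_] := hC2 _ _ _ _ (U_Dset nu i) (Dl_in 0 i) hy hy (Rle_refl _) (Rle_refl _).
  rewrite fnorm_subrr Rplus_0_r -/D0 => h.
  have := fnorm_add (gX i D0 y) (vsub (gX i (U nu i) y) (gX i D0 y)); rewrite vadd_subK => h1.
  have := Rmult_le_compat_l _ _ _ C20 (diam_dist (U_Dset nu i) (Dl_in 0 i)).
  by rewrite /C3 -/D0; lra.
have C30 : 0 <= C3 by apply: Rle_trans (hC3 0%nat); exact: fnorm_ge0.
have [hi hhi] := HT1X i.
have hi0 : 0 < hi by have := hhi 0%nat; have := proj2 (Htau_pos 0 i); lra.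
(* Shifted by one, as [X_contraction] holds from time 1. *)
pose a k := fnorm (vsub (Xs k.+1 i) y).
pose C := C1 + C3; have C0 : 0 <= C by rewrite /C; lra.
have rec k : a k.+1 <= hi / (hi + mu i) * a k + C / mu i.
  have hXo := XO (Xs_in k.+2 i).
  have : (mu i + tauX k.+1 i) * a k.+1 <= tauX k.+1 i * a k + Rmax 0 C.
    apply: X_contraction => //; have := hC1 _ hXo.
    have h2 := cauchy_schwarz_abs (gX i (U k.+1 i) y) (vsub (Xs k.+2 i) y).
    have h3 := Rmult_le_compat_r _ _ _ (fnorm_ge0 (vsub (Xs k.+2 i) y)) (hC3 k.+1).
    have := Rle_abs (- inner (gX i (U k.+1 i) y) (vsub (Xs k.+2 i) y)).
    by rewrite Rabs_Ropp /C; lra.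
  rewrite Rmax_right //; have tp := proj2 (Htau_pos k.+1 i); have th := hhi k.+1.
  have ak : 0 <= a k by exact: fnorm_ge0.
  move=> h; apply: (Rmult_le_reg_l (mu i + tauX k.+1 i)); first lra.
  apply: Rle_trans h _; rewrite Rmult_plus_distr_l; apply: Rplus_le_compat.
    rewrite -Rmult_assoc; apply: Rmult_le_compat_r => //.
    apply: (Rmult_le_reg_r (hi + mu i)); first lra.
    have -> : (mu i + tauX k.+1 i) * (hi / (hi + mu i)) * (hi + mu i) =
      (mu i + tauX k.+1 i) * hi by field; lra.
    nra.
  have -> : C = mu i * (C / mu i) by field; lra.
  have -> : mu i * (C / mu i) / mu i = C / mu i by field; lra.
  by apply: Rmult_le_compat_r; [apply: Rdiv_ge0 | lra].
have hr : 0 <= hi / (hi + mu i) < 1.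
  split; first by apply: Rdiv_ge0; lra.
  by apply: (Rmult_lt_reg_r (hi + mu i)); [lra | field_simplify; lra].
have [|Bd hB] := recursion_bounded hr _ rec; first by apply: Rdiv_ge0.
exists (Rmax (fnorm y) (Bd + fnorm y)) => -[|k]; first exact: Rmax_l.
apply: Rle_trans _ (Rmax_r _ _); have := hB k; rewrite /a.
by have := fnorm_add y (vsub (Xs k.+1 i) y); rewrite vadd_subK; lra.
Qed.

(** * Disagreement, gradient tracking and descent along bounded iterates *)

Section BoundedIterates.
Variables RX CL lo hi : R.
Hypothesis HRX : forall nu i, fnorm (Xs nu i) <= RX.
Hypothesis CL0 : 0 <= CL.
Hypothesis HCL : forall i, gradients_lipschitz i RX CL.
Hypothesis lo0 : 0 < lo.
Hypothesis HtD : forall nu i, lo <= tauD nu i <= hi.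
Hypothesis HtX : forall nu i, tauX nu i <= hi.

Let hi0 : 0 < hi. Proof. by have := HtD 0 i0; lra. Qed.

Definition RD := 2 * diamD.
Lemma RD_ge0 : 0 <= RD. Proof. by case: diamD_spec => h _; rewrite /RD; lra. Qed.
Lemma RD_dist D D' : Dset D -> Dset D' -> fnorm (vsub D D') <= RD.
Proof. exact: diam_dist. Qed.

Definition dX nu i := fnorm (vsub (Xs nu.+1 i) (Xs nu i)).
Definition dXsum nu := \big[Rplus/0]_(i < I) dX nu i.
Definition dXsq nu := \big[Rplus/0]_(i < I) (dX nu i ^ 2).
Definition dDt nu i := fnorm (vsub (Dt nu i) (Dl nu i)).
Definition dDtsq nu := \big[Rplus/0]_(i < I) (dDt nu i ^ 2).

Lemma dX_ge0 nu i : 0 <= dX nu i. Proof. exact: fnorm_ge0. Qed.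
Lemma dDt_ge0 nu i : 0 <= dDt nu i. Proof. exact: fnorm_ge0. Qed.
Lemma dXsum_ge0 nu : 0 <= dXsum nu. Proof. by apply: sumI_ge0 => i; exact: dX_ge0. Qed.
Lemma dXsq_ge0 nu : 0 <= dXsq nu. Proof. by apply: sumI_ge0 => i; exact: pow2_ge_0. Qed.
Lemma dDtsq_ge0 nu : 0 <= dDtsq nu. Proof. by apply: sumI_ge0 => i; exact: pow2_ge_0. Qed.
Lemma dX_le nu i : dX nu i <= dXsum nu.
Proof. by apply: (@sumI_term I (fun i => dX nu i)) => j; exact: dX_ge0. Qed.

Let wt := push_weight I B kappa.
Let wt01 : 0 < wt <= 1.
Proof. exact: (push_weight_bounds HB0 HB HI Hkappa HAdiag HAoff HAcol phi0 Hphi). Qed.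
Definition rho := rate I B wt.
Lemma rho01 : 0 <= rho < 1. Proof. exact: rate_bounds. Qed.

Let Wd nu i : wt <= W nu i i.
Proof. exact: (pushW_diag HB0 HB HI Hkappa HAdiag HAoff HAcol phi0 Hphi). Qed.
Let We nu i j : E nu j i -> wt <= W nu i j.
Proof. exact: (pushW_edge HB0 HB HI Hkappa HAdiag HAoff HAcol phi0 Hphi). Qed.

Let gam0 nu : 0 <= gam nu. Proof. by have := Hgam nu; lra. Qed.

Definition qD := geometric rho (fun k => gam k * RD) RD.
(** The factor 4 of [consensus_bound], applied to every entry, times the number of entries. *)
Definition cT := INR #|{: 'I_M * 'I_K}| * 4.

Lemma cT_ge0 : 0 <= cT. Proof. by rewrite /cT; have := pos_INR #|{: 'I_M * 'I_K}|; lra. Qed.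

Let gRD_ge0 k : 0 <= gam k * RD.
Proof. by apply: Rmult_le_pos; [exact: gam0 | exact: RD_ge0]. Qed.

Lemma qD_ge0 nu : 0 <= qD nu.
Proof. by apply: geometric_ge0 => //; [case: rho01 | exact: RD_ge0]. Qed.

Lemma W_sum_le nu i (F : 'I_I -> R) c : (forall j, Rabs (F j) <= c) ->
  Rabs (\big[Rplus/0]_(j < I) (W nu i j * F j)) <= c.
Proof.
move=> h; apply: Rle_trans (sumI_abs _) _.
apply: (Rle_trans _ (\big[Rplus/0]_(j < I) (c * W nu i j))).
  apply: sumI_le => j; rewrite Rabs_mult (Rabs_pos_eq (W nu i j)) // Rmult_comm.
  exact: Rmult_le_compat_r.
by rewrite sumI_scale W1; lra.
Qed.

Lemma Dl_disagreement nu i j : fnorm (vsub (Dl nu i) (Dl nu j)) <= cT * qD nu.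
Proof.
have key t : forall i j, Dl nu i t - Dl nu j t <= 4 * qD nu.
  apply: (@consensus_bound I B E HB0 HB W wt (fun nu i => Dl nu i t) (fun k => gam k * RD) qD)
    => //.
  - move=> k l; rewrite Dl_step -sumI_sub.
    rewrite (eq_bigr (fun j => W k l j * (gam k * (Dt k j t - Dl k j t)))); last first.
      by move=> m _; rewrite HU /vadd /vscale /vsub; ring.
    apply: W_sum_le => m; rewrite Rabs_mult Rabs_pos_eq //.
    apply: Rmult_le_compat_l => //.
    apply: Rle_trans (RD_dist (Dt_in k m) (Dl_in k m)).
    exact: (coord_le (vsub (Dt k m) (Dl k m)) t).
  - move=> k l; apply: Rle_trans (Rle_abs _) _.
    apply: Rle_trans (RD_dist (Dl_in 0 k) (Dl_in 0 l)).
    exact: (coord_le (vsub (Dl 0%nat k) (Dl 0%nat l)) t).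
rewrite /cT Rmult_assoc; apply: fnorm_le_coord => t; rewrite /vsub.
by have := key t i j; have := key t j i; split_Rabs; lra.
Qed.

Lemma U_Dl nu i : fnorm (vsub (U nu i) (Dl nu i)) <= gam nu * RD.
Proof.
rewrite HU fnorm_vadd_subr fnorm_scale Rabs_pos_eq //.
by apply: Rmult_le_compat_l => //; apply: RD_dist; [exact: Dt_in | exact: Dl_in].
Qed.

Lemma Dl_move nu i : fnorm (vsub (Dl nu.+1 i) (Dl nu i)) <= cT * qD nu + gam nu * RD.
Proof.
rewrite Dl_step; apply: weighted_average_dist => // j.
apply: Rle_trans (fnorm_tri (Dl nu j) _ _) _.
by have := U_Dl nu j; have := Dl_disagreement nu j i; lra.
Qed.

Let kT := kappa ^ (I.+1 * B)%nat.
Let kT0 : 0 < kT. Proof. exact: pow_lt. Qed.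
Let phi_kT nu i : kT <= phi nu i.
Proof. exact: (phi_lower HB0 HB HI Hkappa HAdiag HAoff HAcol phi0 Hphi). Qed.

Definition cE := / kT * CL.
Lemma cE_ge0 : 0 <= cE.
Proof. by apply: Rmult_le_pos => //; apply: Rlt_le; exact: Rinv_0_lt_compat. Qed.

(** Bounds the perturbation of the averaging of Theta: the change of a local gradient over one step,
    divided by [phi], which is at least [kT]. *)
Definition eT nu := cE * (cT * qD nu + gam nu * RD + dXsum nu).
Lemma eT_ge0 nu : 0 <= eT nu.
Proof.
apply: Rmult_le_pos; first exact: cE_ge0.
have := Rmult_le_pos _ _ cT_ge0 (qD_ge0 nu); have := gRD_ge0 nu; have := dXsum_ge0 nu; lra.
Qed.

Definition qT := geometric rho eT (2 * \big[Rplus/0]_(i < I) fnorm (Th 0%nat i)).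

Let ThSum_ge0 : 0 <= 2 * \big[Rplus/0]_(i < I) fnorm (Th 0%nat i).
Proof.
by apply: Rmult_le_pos; [lra | apply: sumI_ge0 => i; exact: fnorm_ge0].
Qed.

Lemma qT_ge0 nu : 0 <= qT nu.
Proof. by apply: geometric_ge0 => //; [case: rho01 | exact: eT_ge0]. Qed.

Lemma gradient_move nu i :
  fnorm (vsub (gD i (Dl nu.+1 i) (Xs nu.+1 i)) (gD i (Dl nu i) (Xs nu i))) <=
  CL * (cT * qD nu + gam nu * RD + dXsum nu).
Proof.
have [h _] := HCL (Dl_in nu.+1 i) (Dl_in nu i) (Xs_in nu.+1 i) (Xs_in nu i) (HRX _ _) (HRX _ _).
apply: Rle_trans h _; apply: Rmult_le_compat_l => //.
by have := Dl_move nu i; have := dX_le nu i; rewrite /dX; lra.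
Qed.

Lemma Th_disagreement nu i j : fnorm (vsub (Th nu i) (Th nu j)) <= cT * qT nu.
Proof.
have key t : forall i j, Th nu i t - Th nu j t <= 4 * qT nu.
  apply: (@consensus_bound I B E HB0 HB W wt (fun nu i => Th nu i t) eT qT) => //.
  - exact: eT_ge0.
  - move=> k l; rewrite Th_step.
    set S0 := \big[Rplus/0]_(j < I) _.
    rewrite (_ : _ + _ - _ = / phi k.+1 l * (gD l (Dl k.+1 l) (Xs k.+1 l) t
       - gD l (Dl k l) (Xs k l) t)); last by ring.
    rewrite Rabs_mult Rabs_pos_eq; last by apply: Rlt_le; exact: Rinv_0_lt_compat.
    rewrite /eT /cE Rmult_assoc; apply: Rmult_le_compat.
    + by apply: Rlt_le; exact: Rinv_0_lt_compat.
    + exact: Rabs_pos.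
    + exact: Rinv_le_contravar.
    + by apply: Rle_trans (gradient_move k l); exact: (coord_le (vsub (gD l _ _) (gD l _ _)) t).
  - move=> k l; have h1 := coord_le (Th 0%nat k) t; have h2 := coord_le (Th 0%nat l) t.
    have h3 := @sumI_term I (fun i => fnorm (Th 0%nat i)) k (fun i => fnorm_ge0 _).
    have h4 := @sumI_term I (fun i => fnorm (Th 0%nat i)) l (fun i => fnorm_ge0 _).
    have -> : qT 0%nat = 2 * \big[Rplus/0]_(i < I) fnorm (Th 0%nat i) by [].
    by move: h1 h2 h3 h4; split_Rabs; lra.
rewrite /cT Rmult_assoc; apply: fnorm_le_coord => t; rewrite /vsub.
by have := key t i j; have := key t j i; split_Rabs; lra.
Qed.

Let phi_pushW nu i j : phi nu.+1 i * W nu i j = A nu i j * phi nu j.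
Proof. exact: (pushW_phi Hkappa HAdiag HAoff phi0 Hphi). Qed.

(** The conservation law behind both the average [Dph] and the tracking of the total gradient by
    Theta. *)
Lemma push_sum_mass nu (Y : 'I_I -> R) :
  \big[Rplus/0]_(i < I) (phi nu.+1 i * \big[Rplus/0]_(j < I) (W nu i j * Y j)) =
  \big[Rplus/0]_(j < I) (phi nu j * Y j).
Proof.
rewrite -[RHS](mixing_sum HAcol nu); apply: eq_bigr => i _.
by rewrite -sumI_scale; apply: eq_bigr => j _; rewrite -Rmult_assoc phi_pushW; ring.
Qed.

Lemma tracking_sum nu t : \big[Rplus/0]_(i < I) (phi nu i * Th nu i t) =
  \big[Rplus/0]_(i < I) gD i (Dl nu i) (Xs nu i) t.
Proof.
elim: nu => [|nu IH].
  by apply: eq_bigr => i _; case: (Hinit i) => -> [_ [_ ->]]; ring.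
rewrite (eq_bigr (fun i => phi nu.+1 i * \big[Rplus/0]_(j < I) (W nu i j * Th nu j t)
   + (gD i (Dl nu.+1 i) (Xs nu.+1 i) t - gD i (Dl nu i) (Xs nu i) t))); last first.
  move=> i _; rewrite Th_step; have := phigt nu.+1 i => p.
  by rewrite Rmult_plus_distr_l -Rmult_assoc Rinv_r; [ring | lra].
by rewrite sumI_add push_sum_mass IH sumI_sub; ring.
Qed.

Let phiI nu : \big[Rplus/0]_(i < I) phi nu i = INR I.
Proof. exact: (phi_sum HAoff HAcol phi0 Hphi). Qed.

(** As [phi] sums to [I], [tracking_sum] splits the error into the disagreement of Theta and the
    variation of the local gradients between [D] and the copies. It is used at [Dph] for the descent
    and at the plain average for [Dhat]. *)
Lemma tracking_error nu i D s : Dset D -> (forall j, fnorm (vsub D (Dl nu j)) <= s) ->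
  fnorm (vsub (vscale (INR I) (Th nu i)) (gradF gD D (Xs nu))) <=
  INR I * (cT * qT nu) + INR I * (CL * s).
Proof.
move=> hD hs.
have -> : vsub (vscale (INR I) (Th nu i)) (gradF gD D (Xs nu)) =
  vadd (vsumI (fun j => vscale (phi nu j) (vsub (Th nu i) (Th nu j))))
       (vsumI (fun j => vsub (gD j (Dl nu j) (Xs nu j)) (gD j D (Xs nu j)))).
  have e1 t : \big[Rplus/0]_(j < I) (phi nu j * (Th nu i t - Th nu j t)) =
      INR I * Th nu i t - \big[Rplus/0]_(j < I) gD j (Dl nu j) (Xs nu j) t.
    rewrite -tracking_sum.
    rewrite [LHS](eq_bigr (fun j => Th nu i t * phi nu j - phi nu j * Th nu j t)); last first.
      by move=> *; ring.
    by rewrite sumI_sub sumI_scale phiI; ring.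
  by apply: vec_ext => t; rewrite /vsub /vadd /vscale /gradF /vsumI e1 sumI_sub; ring.
apply: Rle_trans (fnorm_add _ _) _; apply: Rplus_le_compat.
  apply: Rle_trans (fnorm_sumI _) _.
  apply: (Rle_trans _ (\big[Rplus/0]_(j < I) (cT * qT nu * phi nu j))).
    apply: sumI_le => j; rewrite fnorm_scale Rabs_pos_eq; last exact: Rlt_le.
    rewrite Rmult_comm; apply: Rmult_le_compat_r; [exact: Rlt_le | exact: Th_disagreement].
  by rewrite sumI_scale phiI; lra.
apply: Rle_trans (fnorm_sumI _) _; rewrite -sumI_const; apply: sumI_le => j.
have [h _] := HCL (Dl_in nu j) hD (Xs_in nu j) (Xs_in nu j) (HRX _ _) (HRX _ _).
apply: Rle_trans h _; apply: Rmult_le_compat_l => //.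
by rewrite fnorm_subrr fnorm_vsubC; have := hs j; lra.
Qed.

(** * The weighted average and the Lyapunov function *)

Definition Dph nu : Mat M K := fun t => \big[Rplus/0]_(i < I) (phi nu i / INR I * Dl nu i t).

Let pI nu i : 0 <= phi nu i / INR I.
Proof. by apply: Rdiv_ge0; [exact: Rlt_le | lra]. Qed.
Let pI1 nu : \big[Rplus/0]_(i < I) (phi nu i / INR I) = 1.
Proof.
rewrite (eq_bigr (fun i => / INR I * phi nu i)); last by move=> *; rewrite /Rdiv; ring.
by rewrite sumI_scale phiI Rinv_l; lra.
Qed.

Let const_cvx S0 : convex_on S0 (fun _ : Mat M K => 0).
Proof. by move=> *; lra. Qed.

Lemma Dph_in nu : Dset (Dph nu).
Proof.
by case: (@convex_combination _ Dset _ 'I_I (fun i => phi nu i / INR I) (Dl nu) cD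
  (const_cvx (S0:=Dset)) (pI nu) (Dl_in nu) (pI1 nu)).
Qed.

Lemma Dph_dist nu j : fnorm (vsub (Dph nu) (Dl nu j)) <= cT * qD nu.
Proof. by apply: weighted_average_dist => // i; exact: Dl_disagreement. Qed.

Lemma DbarE nu : Dbar (Dl nu) = fun t => \big[Rplus/0]_(i < I) (/ INR I * Dl nu i t).
Proof. by apply: vec_ext => t; rewrite sumI_scale. Qed.

Let iI0 : 0 <= / INR I. Proof. by apply: Rlt_le; apply: Rinv_0_lt_compat; lra. Qed.
Let iI1 : \big[Rplus/0]_(i < I) / INR I = 1. Proof. by rewrite sumI_const Rinv_r; lra. Qed.

Lemma Dbar_in nu : Dset (Dbar (Dl nu)).
Proof.
rewrite DbarE.
by case: (@convex_combination _ Dset _ 'I_I (fun i => / INR I) (Dl nu) cD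
  (const_cvx (S0:=Dset)) (fun _ => iI0) (Dl_in nu) iI1).
Qed.

Lemma Dbar_dist nu j : fnorm (vsub (Dbar (Dl nu)) (Dl nu j)) <= cT * qD nu.
Proof. by rewrite DbarE; apply: weighted_average_dist => // i; exact: Dl_disagreement. Qed.

Lemma Dbar_move nu : fnorm (vsub (Dbar (Dl nu.+1)) (Dbar (Dl nu))) <=
  cT * qD nu + gam nu * RD.
Proof.
have -> : vsub (Dbar (Dl nu.+1)) (Dbar (Dl nu)) =
  vscale (/ INR I) (vsumI (fun i => vsub (Dl nu.+1 i) (Dl nu i))).
  by apply: vec_ext => t; rewrite /vsub /Dbar /vscale /vsumI sumI_sub; ring.
rewrite fnorm_scale Rabs_pos_eq //.
apply: (Rmult_le_reg_l (INR I)); first lra.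
rewrite -Rmult_assoc Rinv_r ?Rmult_1_l; last lra.
apply: Rle_trans (fnorm_sumI _) _; rewrite -sumI_const; apply: sumI_le => i; exact: Dl_move.
Qed.

(** Mixing drops out by [push_sum_mass]. Hence [Dph_move] is free of the disagreement term that
    [Dbar_move] contains. *)
Lemma Dph_step nu : vsub (Dph nu.+1) (Dph nu) =
  vsumI (fun i => vscale (phi nu i / INR I * gam nu) (vsub (Dt nu i) (Dl nu i))).
Proof.
apply: vec_ext => t; rewrite /vsub /Dph /vsumI /vscale.
have -> : \big[Rplus/0]_(i < I) (phi nu.+1 i / INR I * Dl nu.+1 i t) =
  \big[Rplus/0]_(i < I) (phi nu i / INR I * U nu i t).
  transitivity (/ INR I * \big[Rplus/0]_(i < I)
      (phi nu.+1 i * \big[Rplus/0]_(j < I) (W nu i j * U nu j t))).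
    rewrite -sumI_scale; apply: eq_bigr => i _; rewrite Dl_step /Rdiv; ring.
  by rewrite push_sum_mass -sumI_scale; apply: eq_bigr => i _; rewrite /Rdiv; ring.
by rewrite -sumI_sub; apply: eq_bigr => i _; rewrite HU /vadd /vscale /vsub; ring.
Qed.

Lemma Dph_move nu : fnorm (vsub (Dph nu.+1) (Dph nu)) <= gam nu * RD.
Proof.
rewrite Dph_step; apply: Rle_trans (fnorm_sumI _) _.
apply: (Rle_trans _ (\big[Rplus/0]_(i < I) (gam nu * RD * (phi nu i / INR I)))).
  apply: sumI_le => i; rewrite fnorm_scale Rabs_pos_eq; last exact: Rmult_le_pos.
  have := Rmult_le_compat_l _ _ _ (Rmult_le_pos _ _ (pI nu i) (gam0 nu))
    (RD_dist (Dt_in nu i) (Dl_in nu i)); lra.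
by rewrite sumI_scale pI1; lra.
Qed.

(** Optimality of [Dt] tested at [Dl]. The local gradient subtracted in the objective cancels
    against the surrogate, up to a term that is nonnegative by convexity. *)
Lemma Dt_descent nu i :
  inner (vscale (INR I) (Th nu i)) (vsub (Dt nu i) (Dl nu i)) + G (Dt nu i) - G (Dl nu i)
    <= - lo * dDt nu i ^ 2.
Proof.
have [hDt vi] := Dt_optimality (Dl_in nu i) (Xs_in nu i).
have := vi _ (Dl_in nu i); rewrite /dDt fnorm_sq.
set v := vsub (Dt nu i) (Dl nu i).
have -> : vsub (Dl nu i) (Dt nu i) = vscale (-1) v by rewrite /v; vring.
have mono : 0 <= inner (vsub (gD i (if linD i then Dl nu i else Dt nu i) (Xs nu i))
                             (gD i (Dl nu i) (Xs nu i))) v.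
  case: (linD i); first by rewrite (inner_subl (gD _ _ _)); lra.
  have hO := XO (Xs_in nu i).
  exact: (convex_grad_monotone (convex_D hO) (DO hDt) (DO (Dl_in nu i))
    (has_grad_D (DO hDt) hO) (has_grad_D (DO (Dl_in nu i)) hO)).
have tD := HtD nu i; have v0 := inner_ge0 v.
have : lo * inner v v <= tauD nu i * inner v v by apply: Rmult_le_compat_r; lra.
move: mono; clearbody v; rewrite !innerE. abstract_inner; lra.
Qed.

Lemma X_descent nu i : (1 <= nu)%nat ->
  f i (U nu i) (Xs nu.+1 i) + g i (Xs nu.+1 i) <=
  f i (U nu i) (Xs nu i) + g i (Xs nu i) - epsX * dX nu i ^ 2.
Proof.
move=> nu1; have hU := U_Dset nu i; have hOU := DO hU; have hX := Xs_in nu i.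
have r0 : 0 <= 0 by lra.
have [hX' vi] := Xs_optimality hU hX r0 (convex_strongly0 (convex_g (i:=i))).
have := vi _ hX; rewrite /dX !fnorm_sq.
set v := vsub (Xs nu.+1 i) (Xs nu i).
have ev : vsub (Xs nu i) (Xs nu.+1 i) = vscale (-1) v by rewrite /v; vring.
rewrite ev.
have hE := HepsX; have v0 := inner_ge0 v.
(* The sign of [L] is unknown, but this product is nonnegative by the Lipschitz inequality
   itself. *)
have hL0 : 0 <= L i (U nu i) * inner v v.
  have h := HLip i _ hU _ _ hX' hX; rewrite fnormE -Rmult_assoc.
  by apply: Rmult_le_pos; [apply: Rle_trans h; exact: fnorm_ge0 | exact: fnorm_ge0].
have hT2 : (L i (U nu i) / 2 + epsX) * inner v v <= tauX nu i * inner v v.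
  by apply: Rmult_le_compat_r v0 _; exact: HT1eps.
case: (linX i).
  have := descent_lemma (@cX i) (fun z hz => has_grad_X hOU (XO hz)) (HLip i _ hU) hX hX'.
  rewrite -/v fnorm_sq; move: hL0 hT2 v0; clearbody v; rewrite !innerE.
  by abstract_inner; lra.
have := convex_grad_ineq (convex_X hOU) (XO hX') (XO hX) (has_grad_X hOU (XO hX')).
rewrite ev; move: hL0 hT2 v0; clearbody v; rewrite !innerE.
by abstract_inner; lra.
Qed.

(** The X-step decreases [f i] at [U nu i], while [V] evaluates it at [Dph]. The mean value theorem
    for the difference of the two partial functions shows that the transfer costs only a product of
    small quantities. *)
Lemma X_cross nu i D D' : Dset D -> Dset D' ->
  f i D' (Xs nu.+1 i) - f i D' (Xs nu i) <=
  f i D (Xs nu.+1 i) - f i D (Xs nu i) + CL * fnorm (vsub D' D) * dX nu i.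
Proof.
move=> hD hD'; set v := vsub (Xs nu.+1 i) (Xs nu i).
have ev : vadd (Xs nu i) v = Xs nu.+1 i by rewrite /v vadd_subK.
have seg t : 0 <= t <= 1 -> Xset i (vadd (Xs nu i) (vscale t v)) /\
    fnorm (vadd (Xs nu i) (vscale t v)) <= RX.
  move=> ht; rewrite /v vcomb_step; split; first by apply: cX => //; exact: Xs_in.
  by apply: fnorm_comb_le.
have [|t [ht e]] := @seg_mean_value _ (fun X => f i D' X - f i D X)
   (fun X => vsub (gX i D' X) (gX i D X)) (Xs nu i) v.
  move=> t /seg [h _]; apply: has_grad_sub; apply: has_grad_X; by [exact: DO | exact: XO].
rewrite ev in e; have [h1 h2] := seg t ht.
have [_ h3] := HCL hD' hD h1 h1 h2 h2; rewrite fnorm_subrr Rplus_0_r in h3.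
have h4 := cauchy_schwarz (vsub (gX i D' (vadd (Xs nu i) (vscale t v)))
  (gX i D (vadd (Xs nu i) (vscale t v)))) v.
have h5 := Rmult_le_compat_r _ _ _ (fnorm_ge0 v) h3.
rewrite /dX -/v; lra.
Qed.

Lemma Dph_U nu i : fnorm (vsub (Dph nu.+1) (U nu i)) <= 2 * RD * gam nu + cT * qD nu.
Proof.
apply: Rle_trans (fnorm_tri (Dph nu) _ _) _.
have := fnorm_tri (Dl nu i) (Dph nu) (U nu i); rewrite (fnorm_vsubC (Dl nu i) (U nu i)).
by have := Dph_move nu; have := Dph_dist nu i; have := U_Dl nu i; lra.
Qed.

Definition V nu := \big[Rplus/0]_(i < I) f i (Dph nu) (Xs nu i)
  + \big[Rplus/0]_(i < I) g i (Xs nu i)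
  + \big[Rplus/0]_(i < I) (phi nu i / INR I * G (Dl nu i)).

(** Jensen twice: for the mixing weights, then for the step from [Dl] towards [Dt]. *)
Lemma G_step nu : \big[Rplus/0]_(i < I) (phi nu.+1 i / INR I * G (Dl nu.+1 i)) <=
  \big[Rplus/0]_(i < I) (phi nu i / INR I * G (Dl nu i))
  + \big[Rplus/0]_(i < I) (phi nu i / INR I * gam nu * (G (Dt nu i) - G (Dl nu i))).
Proof.
apply: (Rle_trans _ (\big[Rplus/0]_(i < I) (/ INR I *
   (phi nu.+1 i * \big[Rplus/0]_(j < I) (W nu i j * G (U nu j)))))).
  apply: sumI_le => i; rewrite Dl_step.
  have [_ h] := @convex_combination_ord I _ Oset G (W nu i) (U nu) cO HG (W0 nu i)
    (fun j => DO (U_Dset nu j)) (W1 nu i).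
  have := Rmult_le_compat_l _ _ _ (pI nu.+1 i) h; rewrite /Rdiv; lra.
rewrite sumI_scale push_sum_mass -sumI_scale -sumI_add; apply: sumI_le => i.
have hg : 0 <= gam nu <= 1 by have := Hgam nu; lra.
have := HG _ _ _ (DO (Dt_in nu i)) (DO (Dl_in nu i)) hg; rewrite -vcomb_step -HU => h.
have := Rmult_le_compat_l _ _ _ (pI nu i) h; rewrite /Rdiv; lra.
Qed.

(** The descent lemma produces the true gradient at [Dph]; replacing it by each agent's own estimate
    costs the tracking error times [gam nu * RD]. *)
Lemma F_step nu : \big[Rplus/0]_(i < I) f i (Dph nu.+1) (Xs nu i) <=
  \big[Rplus/0]_(i < I) f i (Dph nu) (Xs nu i)
  + \big[Rplus/0]_(i < I) (phi nu i / INR I * gam nu *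
      inner (vscale (INR I) (Th nu i)) (vsub (Dt nu i) (Dl nu i)))
  + gam nu * ((INR I * (cT * qT nu) + INR I * (CL * (cT * qD nu))) * RD)
  + INR I * (CL / 2 * (gam nu * RD) ^ 2).
Proof.
set d := vsub (Dph nu.+1) (Dph nu).
have h1 : \big[Rplus/0]_(i < I) f i (Dph nu.+1) (Xs nu i) <=
    \big[Rplus/0]_(i < I) f i (Dph nu) (Xs nu i) + inner (gradF gD (Dph nu) (Xs nu)) d
    + INR I * (CL / 2 * (gam nu * RD) ^ 2).
  rewrite /gradF inner_sumI -sumI_const -!sumI_add; apply: sumI_le => i.
  have hO := XO (Xs_in nu i).
  have lip z w : Dset z -> Dset w ->
      fnorm (vsub (gD i z (Xs nu i)) (gD i w (Xs nu i))) <= CL * fnorm (vsub z w).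
    move=> hz hw; have [h _] := HCL hz hw (Xs_in nu i) (Xs_in nu i) (HRX _ _) (HRX _ _).
    by rewrite fnorm_subrr Rplus_0_r in h.
  have := @descent_lemma _ Dset (fun D => f i D (Xs nu i)) (fun D => gD i D (Xs nu i)) CL
    (Dph nu) (Dph nu.+1) cD (fun z hz => has_grad_D (DO hz) hO) lip (Dph_in nu) (Dph_in nu.+1).
  rewrite -/d; have : fnorm d ^ 2 <= (gam nu * RD) ^ 2.
    by apply: pow_incr; split; [exact: fnorm_ge0 | exact: Dph_move].
  move=> hd; have c2 : 0 <= CL / 2 by lra.
  have := Rmult_le_compat_l _ _ _ c2 hd; lra.
have h2 : inner (gradF gD (Dph nu) (Xs nu)) d <=
    \big[Rplus/0]_(i < I) (phi nu i / INR I * gam nu *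
      inner (vscale (INR I) (Th nu i)) (vsub (Dt nu i) (Dl nu i)))
    + gam nu * ((INR I * (cT * qT nu) + INR I * (CL * (cT * qD nu))) * RD).
  set e := (INR I * _ + _) * RD.
  rewrite /d Dph_step inner_sym inner_sumI.
  apply: (Rle_trans _ (\big[Rplus/0]_(i < I) (phi nu i / INR I * gam nu *
      inner (vscale (INR I) (Th nu i)) (vsub (Dt nu i) (Dl nu i))
      + gam nu * e * (phi nu i / INR I)))).
    apply: sumI_le => i; rewrite inner_scalel.
    have pg : 0 <= phi nu i / INR I * gam nu by exact: Rmult_le_pos.
    set v := vsub (Dt nu i) (Dl nu i).
    have := cauchy_schwarz (vsub (gradF gD (Dph nu) (Xs nu)) (vscale (INR I) (Th nu i))) v.
    rewrite fnorm_vsubC (inner_subl (gradF _ _ _)) => h.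
    have te := @tracking_error nu i _ _ (Dph_in nu) (Dph_dist nu).
    have : fnorm (vsub (vscale (INR I) (Th nu i)) (gradF gD (Dph nu) (Xs nu))) * fnorm v <= e.
      apply: Rmult_le_compat => //; try exact: fnorm_ge0.
      by apply: RD_dist; [exact: Dt_in | exact: Dl_in].
    rewrite (inner_sym v) => h'.
    have h3 : inner (gradF gD (Dph nu) (Xs nu)) v <= inner (vscale (INR I) (Th nu i)) v + e by lra.
    have := Rmult_le_compat_l _ _ _ pg h3; lra.
  by rewrite sumI_add sumI_scale pI1; lra.
lra.
Qed.

(** One summand per error: curvature along the move of [Dph], [X_cross] after Young's inequality
    with half of the X-decrease, disagreement of Theta, and disagreement of the copies of D. *)
Definition cV := INR I * (CL / 2 * RD ^ 2)
  + INR I * (CL ^ 2 / (2 * epsX) * (8 * RD ^ 2 + 2 * cT ^ 2))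
  + INR I * cT * RD + INR I * CL * cT * RD.

Let young_cross nu i :
  CL * fnorm (vsub (Dph nu.+1) (U nu i)) * dX nu i <= epsX / 2 * dX nu i ^ 2
   + CL ^ 2 / (2 * epsX) * (8 * RD ^ 2 + 2 * cT ^ 2) * (gam nu ^ 2 + qD nu ^ 2).
Proof.
set a := fnorm _; set x := dX nu i; set k := CL ^ 2 / (2 * epsX).
have k0 : 0 <= k by apply: Rdiv_ge0; [exact: pow2_ge_0 | lra].
have h1 : CL * a * x <= epsX / 2 * x ^ 2 + k * a ^ 2.
  apply: (Rmult_le_reg_l (2 * epsX)); first lra.
  rewrite Rmult_plus_distr_l.
  have -> : 2 * epsX * (k * a ^ 2) = (CL * a) ^ 2 by rewrite /k; field; lra.
  have := pow2_ge_0 (epsX * x - CL * a); lra.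
have a0 : 0 <= a by exact: fnorm_ge0.
have h2 : a ^ 2 <= (2 * RD * gam nu + cT * qD nu) ^ 2.
  by apply: pow_incr; split=> //; exact: Dph_U.
have h3 : (2 * RD * gam nu + cT * qD nu) ^ 2 <=
    (8 * RD ^ 2 + 2 * cT ^ 2) * (gam nu ^ 2 + qD nu ^ 2).
  have := pow2_ge_0 (2 * RD * gam nu - cT * qD nu).
  have := Rmult_le_pos _ _ (pow2_ge_0 RD) (pow2_ge_0 (qD nu)).
  have := Rmult_le_pos _ _ (pow2_ge_0 cT) (pow2_ge_0 (gam nu)); lra.
have := Rmult_le_compat_l _ _ _ k0 (Rle_trans _ _ _ h2 h3); lra.
Qed.

Lemma V_descent nu : (1 <= nu)%nat ->
  V nu.+1 <= V nu - lo * kT / INR I * (gam nu * dDtsq nu) - epsX / 2 * dXsq nu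
    + cV * (gam nu ^ 2 + qD nu ^ 2 + gam nu * qT nu).
Proof.
move=> nu1; set K1 := CL ^ 2 / (2 * epsX) * (8 * RD ^ 2 + 2 * cT ^ 2).
have stepX : \big[Rplus/0]_(i < I) f i (Dph nu.+1) (Xs nu.+1 i) +
    \big[Rplus/0]_(i < I) g i (Xs nu.+1 i) <=
    \big[Rplus/0]_(i < I) f i (Dph nu.+1) (Xs nu i) + \big[Rplus/0]_(i < I) g i (Xs nu i)
    + (- (epsX / 2)) * dXsq nu + INR I * (K1 * (gam nu ^ 2 + qD nu ^ 2)).
  rewrite /dXsq -sumI_scale -sumI_const -!sumI_add; apply: sumI_le => i.
  have := X_descent i nu1; have := X_cross nu i (U_Dset nu i) (Dph_in nu.+1).
  have := young_cross nu i; rewrite -/K1; lra.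
have stepDt : \big[Rplus/0]_(i < I) (phi nu i / INR I * gam nu *
      inner (vscale (INR I) (Th nu i)) (vsub (Dt nu i) (Dl nu i)))
   + \big[Rplus/0]_(i < I) (phi nu i / INR I * gam nu * (G (Dt nu i) - G (Dl nu i)))
   <= - (lo * kT / INR I * gam nu) * dDtsq nu.
  rewrite /dDtsq -sumI_scale -sumI_add; apply: sumI_le => i.
  have pg : 0 <= phi nu i / INR I * gam nu by exact: Rmult_le_pos.
  have := Rmult_le_compat_l _ _ _ pg (Dt_descent nu i).
  have : kT / INR I * gam nu * (lo * dDt nu i ^ 2) <=
         phi nu i / INR I * gam nu * (lo * dDt nu i ^ 2).
    apply: Rmult_le_compat_r; first by apply: Rmult_le_pos; [lra | exact: pow2_ge_0].
    by apply: Rmult_le_compat_r => //; apply: Rmult_le_compat_r.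
  rewrite /Rdiv; lra.
have gs := G_step nu; have fs := F_step nu.
have q0 := qD_ge0 nu; have t0 := qT_ge0 nu; have g0 := gam0 nu.
have g2 := pow2_ge_0 (gam nu); have q2 := pow2_ge_0 (qD nu).
have gt0 := Rmult_le_pos _ _ g0 t0.
have I0 : 0 <= INR I by lra.
have c0 := cT_ge0; have r0 := RD_ge0.
have K10 : 0 <= K1.
  apply: Rmult_le_pos; first by apply: Rdiv_ge0; [exact: pow2_ge_0 | lra].
  by have := pow2_ge_0 RD; have := pow2_ge_0 cT; lra.
set Z := gam nu ^ 2 + qD nu ^ 2 + gam nu * qT nu.
have z1 : INR I * (CL / 2 * RD ^ 2) * gam nu ^ 2 <= INR I * (CL / 2 * RD ^ 2) * Z.
  apply: Rmult_le_compat_l; last by rewrite /Z; lra.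
  by apply: Rmult_le_pos => //; apply: Rmult_le_pos; [lra | exact: pow2_ge_0].
have z2 : INR I * K1 * (gam nu ^ 2 + qD nu ^ 2) <= INR I * K1 * Z.
  by apply: Rmult_le_compat_l; [exact: Rmult_le_pos | rewrite /Z; lra].
have z3 : INR I * cT * RD * (gam nu * qT nu) <= INR I * cT * RD * Z.
  apply: Rmult_le_compat_l; last by rewrite /Z; lra.
  by apply: Rmult_le_pos => //; exact: Rmult_le_pos.
have z4 : INR I * CL * cT * RD * (gam nu * qD nu) <= INR I * CL * cT * RD * Z.
  apply: Rmult_le_compat_l.
    by apply: Rmult_le_pos => //; apply: Rmult_le_pos => //; exact: Rmult_le_pos.
  by have := pow2_ge_0 (gam nu - qD nu); rewrite /Z; lra.
rewrite /cV -/K1 /V; lra.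
Qed.

(** [g i] is not assumed bounded below; its convex minorant at the initial point bounds it on the
    ball that contains the iterates. *)
Lemma V_lower : exists lb, forall nu, lb <= V nu.
Proof.
have [cf [_ hf]] : exists a, 0 <= a /\ forall i nu, - a <= f i (Dph nu) (Xs nu i).
  apply: (@fin_bound 'I_I (fun i a => forall nu, - a <= f i (Dph nu) (Xs nu i))).
    by move=> i a b ab h nu; have := h nu; lra.
  move=> i; have [c hc] := Hf_lb i; exists (- c) => nu; rewrite Ropp_involutive.
  by apply: hc; [apply: DO; exact: Dph_in | apply: XO; exact: Xs_in].
have [cg [_ hgb]] : exists a, 0 <= a /\ forall i nu, - a <= g i (Xs nu i).
  apply: (@fin_bound 'I_I (fun i a => forall nu, - a <= g i (Xs nu i))).
    by move=> i a b ab h nu; have := h nu; lra.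
  move=> i; have r0 : 0 <= 0 by lra.
  have [C [C0 hC]] := strongly_convex_minorant r0 (@oOi i) (@cOi i)
    (convex_strongly0 (convex_g (i:=i))) (XO (Xs_in 0 i)).
  exists (- (g i (Xs 0%nat i) - C * (2 * RX))) => nu.
  have := hC _ (XO (Xs_in nu i)).
  have h : fnorm (vsub (Xs nu i) (Xs 0%nat i)) <= 2 * RX.
    by apply: Rle_trans (fnorm_sub _ _) _; have := HRX nu i; have := HRX 0 i; lra.
  have := Rmult_le_compat_l _ _ _ C0 h; lra.
have [_ bD] := diamD_spec.
have [cG hG] := cont_bounded clD bD (convex_cont oO cO HG DO).
exists (INR I * (- cf) + INR I * (- cg) + (- cG)) => nu.
apply: Rplus_le_compat; first apply: Rplus_le_compat.
- by rewrite -sumI_const; apply: sumI_le => i.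
- by rewrite -sumI_const; apply: sumI_le => i.
- rewrite -(Rmult_1_r (- cG)) -(pI1 nu) -sumI_scale; apply: sumI_le => i.
  rewrite Rmult_comm; apply: Rmult_le_compat_l => //.
  by have := hG _ (Dl_in nu i); split_Rabs; lra.
Qed.

Lemma summable_gam_sq : summable (fun k => (gam k * RD) ^ 2).
Proof.
apply: (@summable_le _ (fun k => RD ^ 2 * gam k ^ 2)) => [k|]; first by lra.
by apply: summable_scale => //; exact: pow2_ge_0.
Qed.

Lemma summable_qD_sq : summable (fun k => qD k ^ 2).
Proof.
apply: (recursion_sqr_summable rho01 qD_ge0 gRD_ge0 _ summable_gam_sq) => k.
by rewrite /qD /=; lra.
Qed.

Lemma gam_cv0 : cv0 gam.
Proof. by apply: cv0_sqr; apply: summable_cv0 => // k; exact: pow2_ge_0. Qed.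

Lemma qD_cv0 : cv0 qD.
Proof.
by apply: cv0_sqr; apply: (summable_cv0 _ summable_qD_sq) => k; exact: pow2_ge_0.
Qed.

Lemma descent_conclusion :
  [/\ summable (fun k => gam k * dDtsq k), cv0 dXsum, cv0 qT & exists l, Un_cv V l].
Proof.
have [lb hlb] := V_lower.
pose CT := cE * (cT + RD + 1).
have CT0 : 0 <= CT.
  by apply: Rmult_le_pos; [exact: cE_ge0 | have := cT_ge0; have := RD_ge0; lra].
have cV0 : 0 <= cV.
  have h1 := cT_ge0; have h2 := RD_ge0; have I0 : 0 <= INR I by lra.
  have h3 : 0 <= CL ^ 2 / (2 * epsX) by apply: Rdiv_ge0; [exact: pow2_ge_0 | lra].
  have h4 : 0 <= 8 * RD ^ 2 + 2 * cT ^ 2 by have := pow2_ge_0 RD; have := pow2_ge_0 cT; lra.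
  have h5 : 0 <= CL / 2 by lra.
  have p1 := Rmult_le_pos _ _ I0 (Rmult_le_pos _ _ h5 (pow2_ge_0 RD)).
  have p2 := Rmult_le_pos _ _ I0 (Rmult_le_pos _ _ h3 h4).
  have p3 := Rmult_le_pos _ _ (Rmult_le_pos _ _ I0 h1) h2.
  have p4 := Rmult_le_pos _ _ (Rmult_le_pos _ _ (Rmult_le_pos _ _ I0 CL0) h1) h2.
  rewrite /cV; lra.
(* Everything is shifted by one because [V_descent] starts at time 1; the shifts are undone at the
   end. *)
have [||||||||||||||||||s1 s2 s3 [l hl]] := @descent_summable (fun k => V k.+1)
  (fun k => gam k.+1) (fun k => dDtsq k.+1) (fun k => dXsq k.+1) (fun k => qD k.+1)
  (fun k => qT k.+1) (fun k => dXsum k.+1) (lo * kT / INR I) (epsX / 2) cV CT (INR I) rho lb.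
- by apply: Rdiv_lt_0_compat; [exact: Rmult_lt_0_compat | lra].
- lra.
- exact: cV0.
- lra.
- exact: CT0.
- exact: rho01.
- by move=> k; exact: gam0.
- by move=> k; exact: dDtsq_ge0.
- by move=> k; exact: dXsq_ge0.
- by move=> k; exact: qD_ge0.
- by move=> k; exact: qT_ge0.
- by move=> k; exact: dXsum_ge0.
- by move=> k; exact: V_descent.
- move=> k; have -> : qT k.+2 = rho * qT k.+1 + eT k.+1 by [].
  apply: Rplus_le_compat_l.
  rewrite /eT /CT Rmult_assoc; apply: Rmult_le_compat_l; first exact: cE_ge0.
  have h1 := cT_ge0; have h2 := RD_ge0; have h3 := qD_ge0 k.+1; have h4 := gam0 k.+1.
  have h5 := dXsum_ge0 k.+1.
  have := Rmult_le_pos _ _ h1 h4; have := Rmult_le_pos _ _ h1 h5.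
  have := Rmult_le_pos _ _ h2 h3; have := Rmult_le_pos _ _ h2 h5; lra.
- by move=> k; exact: sum_sqr_le.
- by apply: (@summable_shift 1 (fun k => gam k ^ 2)) => // k; exact: pow2_ge_0.
- by apply: (@summable_shift 1 (fun k => qD k ^ 2) _ summable_qD_sq) => k; exact: pow2_ge_0.
- by move=> k; exact: hlb.
split.
- exact: (summable_unshift (a := fun k => gam k * dDtsq k)).
- apply: cv0_unshift; apply: cv0_sqr.
  apply: (@cv0_le _ (fun k => INR I * dXsq k.+1)) => [k|]; first exact: sum_sqr_le.
  by apply: cv0_scale; [lra | apply: summable_cv0 => // k; exact: dXsq_ge0].
- apply: cv0_unshift; apply: cv0_sqr.
  by apply: (summable_cv0 _ s3) => k; exact: pow2_ge_0.
- exists l; apply: cv0_Un_cv; apply: (cv0_unshift (a := fun k => Rabs (V k - l))).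
  exact: (Un_cv_cv0 hl).
Qed.

Lemma cons_err_cv : Un_cv (fun nu => cons_err (Dl nu)) 0.
Proof.
apply: cv0_Un_cv; apply: (@cv0_le _ (fun k => cT * qD k)); last first.
  by apply: cv0_scale; [exact: cT_ge0 | exact: qD_cv0].
move=> k; rewrite Rminus_0_r Rabs_pos_eq; last exact: maxR_ge0.
apply: maxR_le; first by apply: Rmult_le_pos; [exact: cT_ge0 | exact: qD_ge0].
by move=> i; apply: Rle_trans (infnorm_le _) _; rewrite fnorm_vsubC; exact: Dbar_dist.
Qed.

Lemma iterates_bounded : exists C, forall nu,
  fnorm (Dbar (Dl nu)) <= C /\ forall i, fnorm (Xs nu i) <= C.
Proof.
exists (Rmax diamD RX) => nu; split=> [|i].
  by apply: Rle_trans _ (Rmax_l _ _); case: diamD_spec => _; apply; exact: Dbar_in.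
by apply: Rle_trans (HRX nu i) (Rmax_r _ _).
Qed.

Lemma f_lipschitz_D : exists C, 0 <= C /\ forall i nu D D', Dset D -> Dset D' ->
  Rabs (f i D (Xs nu i) - f i D' (Xs nu i)) <= C * fnorm (vsub D D').
Proof.
apply: (@fin_bound 'I_I (fun i C => forall nu D D', Dset D -> Dset D' ->
  Rabs (f i D (Xs nu i) - f i D' (Xs nu i)) <= C * fnorm (vsub D D'))).
  move=> i a b ab h nu D D' hD hD'; apply: Rle_trans (h nu D D' hD hD') _.
  by apply: Rmult_le_compat_r => //; exact: fnorm_ge0.
move=> i; exists (fnorm (gD i (Dl 0%nat i) (Xs 0%nat i)) + CL * (RD + 2 * RX)).
move=> nu D D' hD hD'; have hO := XO (Xs_in nu i).
have e := vadd_subK D' D.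
have seg t : 0 <= t <= 1 -> Dset (vadd D' (vscale t (vsub D D'))).
  by move=> ht; apply: seg_in => //; rewrite e.
have [|t [ht h]] := @seg_mean_value _ (fun D => f i D (Xs nu i)) (fun D => gD i D (Xs nu i))
  D' (vsub D D').
  by move=> t /seg hs; apply: has_grad_D => //; exact: DO.
rewrite e in h; rewrite h; apply: Rle_trans (cauchy_schwarz_abs _ _) _.
apply: Rmult_le_compat_r; first exact: fnorm_ge0.
set g1 := gD i _ _; set g0 := gD i (Dl 0%nat i) _.
have [h1 _] := HCL (seg t ht) (Dl_in 0 i) (Xs_in nu i) (Xs_in 0 i) (HRX _ _) (HRX _ _).
have h2 := RD_dist (seg t ht) (Dl_in 0 i).
have h3 : fnorm (vsub (Xs nu i) (Xs 0%nat i)) <= 2 * RX.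
  by apply: Rle_trans (fnorm_sub _ _) _; have := HRX nu i; have := HRX 0 i; lra.
have h4 := Rmult_le_compat_l _ _ _ CL0 (Rplus_le_compat _ _ _ _ h2 h3).
have := fnorm_add g0 (vsub g1 g0); rewrite vadd_subK; rewrite -/g1 -/g0 in h1; lra.
Qed.

(** Uniform continuity of [G] on [Dset] leads back from the averaged values in [V] to the plain
    average in [Uobj]. *)
Lemma G_average_cv : cv0 (fun nu =>
  Rabs (G (Dbar (Dl nu)) - \big[Rplus/0]_(i < I) (phi nu i / INR I * G (Dl nu i)))).
Proof.
move=> eps e0; have [_ bD] := diamD_spec.
have e2 : 0 < eps / 2 by lra.
have [d [d0 hd]] := cont_uniform clD bD (convex_cont oO cO HG DO) e2.
have [N hN] := cv0_scale cT_ge0 qD_cv0 d0.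
exists N => k Nk.
have -> : G (Dbar (Dl k)) = \big[Rplus/0]_(i < I) (phi k i / INR I * G (Dbar (Dl k))).
  rewrite (eq_bigr (fun i => G (Dbar (Dl k)) * (phi k i / INR I))); last by move=> *; ring.
  by rewrite sumI_scale pI1; ring.
rewrite -sumI_sub; apply: Rle_lt_trans (sumI_abs _) _.
apply: (Rle_lt_trans _ (\big[Rplus/0]_(i < I) (eps / 2 * (phi k i / INR I)))); last first.
  by rewrite sumI_scale pI1; lra.
apply: sumI_le => i; rewrite -Rmult_minus_distr_l Rabs_mult Rabs_pos_eq // Rmult_comm.
apply: Rmult_le_compat_r => //; apply: Rlt_le; apply: hd.
- exact: Dl_in.
- exact: Dbar_in.
- by apply: Rle_lt_trans (hN k Nk); exact: Dbar_dist.
Qed.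

Lemma objective_cv : exists l, Un_cv (fun nu => Uobj f g G (Dbar (Dl nu)) (Xs nu)) l.
Proof.
have [_ _ _ [l hl]] := descent_conclusion.
have [C [C0 hC]] := f_lipschitz_D.
exists l; apply: cv0_Un_cv.
apply: (@cv0_le _ (fun k => Rabs (V k - l) + INR I * (C * 2) * (cT * qD k) +
  Rabs (G (Dbar (Dl k)) - \big[Rplus/0]_(i < I) (phi k i / INR I * G (Dl k i))))).
  move=> k.
  have h1 : Rabs (\big[Rplus/0]_(i < I) f i (Dbar (Dl k)) (Xs k i) -
      \big[Rplus/0]_(i < I) f i (Dph k) (Xs k i)) <= INR I * (C * 2) * (cT * qD k).
    rewrite -sumI_sub; apply: Rle_trans (sumI_abs _) _.
    rewrite Rmult_assoc -sumI_const; apply: sumI_le => i.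
    apply: Rle_trans (hC i k _ _ (Dbar_in k) (Dph_in k)) _; rewrite Rmult_assoc.
    apply: Rmult_le_compat_l => //; apply: Rle_trans (fnorm_tri (Dl k i) _ _) _.
    by have := Dbar_dist k i; have := Dph_dist k i; rewrite (fnorm_vsubC (Dph k)); lra.
  rewrite /Uobj; have -> : forall a b c d : R, a + b + c - d =
    (V k - d) + (a - \big[Rplus/0]_(i < I) f i (Dph k) (Xs k i)) +
    (c - \big[Rplus/0]_(i < I) (phi k i / INR I * G (Dl k i)))
    + (b - \big[Rplus/0]_(i < I) g i (Xs k i)) by move=> *; rewrite /V; ring.
  rewrite Rminus_diag Rplus_0_r; apply: Rle_trans (Rabs_triang _ _) _.
  apply: Rplus_le_compat_r; apply: Rle_trans (Rabs_triang _ _) _.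
  exact: Rplus_le_compat_l.
apply: cv0_add; last exact: G_average_cv.
apply: cv0_add; first exact: Un_cv_cv0.
apply: cv0_scale; first by apply: Rmult_le_pos; lra.
by apply: cv0_scale; [exact: cT_ge0 | exact: qD_cv0].
Qed.

(** * The maps [Dhat] and [Xhat] compared with the iterates *)

Unset Implicit Arguments.
Let Db nu := Dbar (Dl nu).
Let Xh nu i := Xhat Xset gX g tXh (Db nu) i (Xs nu i).
Let Dh nu := Dhat Dset gD G tDh (Db nu) (Xs nu).
Set Implicit Arguments.

Lemma Xhat_optimality nu i : Xset i (Xh nu i) /\ forall y, Xset i y -> 0 <=
  inner (vadd (gX i (Db nu) (Xs nu i)) (vscale tXh (vsub (Xh nu i) (Xs nu i))))
        (vsub y (Xh nu i)) + g i y - g i (Xh nu i).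
Proof.
have r0 : 0 <= 0 by lra.
have [h1 h2] := prox_linear (gX i (Db nu) (Xs nu i)) (@oOi i) (@cOi i) r0
  (convex_strongly0 (convex_g (i:=i))) (@XO i) (@clX i) (@cX i) HtXh (Xs_in nu i).
split; first exact: h1.
move=> y hy; have := h2 y hy; rewrite -/(Xh nu i).
by move: (fnorm _) => N; rewrite /Rdiv !Rmult_0_l.
Qed.

Lemma Dhat_optimality nu : Dset (Dh nu) /\ forall y, Dset y -> 0 <=
  inner (vadd (gradF gD (Db nu) (Xs nu)) (vscale tDh (vsub (Dh nu) (Db nu))))
        (vsub y (Dh nu)) + G y - G (Dh nu).
Proof.
have r0 : 0 <= 0 by lra.
have [h1 h2] := prox_linear (gradF gD (Db nu) (Xs nu)) oO cO r0
  (convex_strongly0 HG) DO clD cD HtDh (Dbar_in nu).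
split; first exact: h1.
move=> y hy; have := h2 y hy; rewrite -/(Dh nu).
by move: (fnorm _) => N; rewrite /Rdiv !Rmult_0_l.
Qed.

Lemma Db_U nu i : fnorm (vsub (Db nu) (U nu i)) <= cT * qD nu + gam nu * RD.
Proof.
apply: Rle_trans (fnorm_tri (Dl nu i) _ _) _.
by have := Dbar_dist nu i; have := U_Dl nu i; rewrite (fnorm_vsubC (U nu i)) -/(Db nu); lra.
Qed.

Definition rX nu := ((CL + tXh + hi) / tXh + 1) * (dXsum nu + (cT * qD nu + gam nu * RD)).

(** [Xh] and the next iterate solve variational inequalities with the same [g i]. Their data differ
    by [Db] against [U], by the point of linearization and by the proximal weight, all controlled by
    [rX]. *)
Lemma Xhat_bound nu i : fnorm (vsub (Xh nu i) (Xs nu i)) <= rX nu.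
Proof.
have r0 : 0 <= 0 by lra.
have hU := U_Dset nu i; have hX := Xs_in nu i.
have [hX' vi'] := Xs_optimality hU hX r0 (convex_strongly0 (convex_g (i:=i))).
have [hXh vi] := Xhat_optimality nu i.
set z := if linX i then Xs nu i else Xs nu.+1 i in vi'.
have vi'' : 0 <= inner (vadd (gX i (U nu i) z) (vscale (tauX nu i) (vsub (Xs nu.+1 i) (Xs nu i))))
          (vsub (Xh nu i) (Xs nu.+1 i)) + g i (Xh nu i) - g i (Xs nu.+1 i).
  by have := vi' _ hXh; move: (fnorm _) => N; rewrite /Rdiv !Rmult_0_l.
have := vi_stability HtXh (vi _ hX') vi''.
set rr := vsub (vsub _ _) _.
have er : rr = vadd (vsub (gX i (Db nu) (Xs nu i)) (gX i (U nu i) z))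
  (vscale (tXh - tauX nu i) (vsub (Xs nu.+1 i) (Xs nu i))) by rewrite /rr; vring.
have hz : Xset i z /\ fnorm z <= RX /\ fnorm (vsub (Xs nu i) z) <= dX nu i.
  rewrite /z /dX fnorm_vsubC; case: (linX i); do 2!split=> //; last exact: Rle_refl.
  by rewrite fnorm_subrr; exact: fnorm_ge0.
case: hz => hz1 [hz2 hz3].
have [_ h1] := HCL (Dbar_in nu) hU hX hz1 (HRX _ _) hz2.
have h2 := Db_U nu i; rewrite -/(Db nu) in h1.
have h3 := Rmult_le_compat_l _ _ _ CL0 (Rplus_le_compat _ _ _ _ h2 hz3).
have n1 : fnorm rr <= CL * (cT * qD nu + gam nu * RD + dX nu i) + (tXh + hi) * dX nu i.
  rewrite er; apply: Rle_trans (fnorm_add _ _) _; rewrite fnorm_scale -/(dX nu i).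
  apply: Rplus_le_compat; first exact: Rle_trans h1 h3.
  apply: Rmult_le_compat_r; first exact: dX_ge0.
  have := HtX nu i; have := proj2 (Htau_pos nu i) => t1 t2.
  by apply: Rabs_le; lra.
set q := cT * qD nu + gam nu * RD in h2 n1 *.
have q0 : 0 <= q.
  by have := Rmult_le_pos _ _ cT_ge0 (qD_ge0 nu); have := gRD_ge0 nu; rewrite /q; lra.
have d0 := dX_ge0 nu i; have d1 := dX_le nu i.
move=> h4; apply: Rle_trans (fnorm_tri (Xs nu.+1 i) _ _) _; rewrite -/(dX nu i).
have h5 : fnorm (vsub (Xh nu i) (Xs nu.+1 i)) <= (CL + tXh + hi) / tXh * (dX nu i + q).
  apply: (Rmult_le_reg_l tXh) => //; apply: Rle_trans h4 _; apply: Rle_trans n1 _.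
  have -> : tXh * ((CL + tXh + hi) / tXh * (dX nu i + q)) = (CL + tXh + hi) * (dX nu i + q).
    by field; lra.
  have : 0 <= (tXh + hi) * q by apply: Rmult_le_pos => //; lra.
  lra.
have k0 : 0 <= (CL + tXh + hi) / tXh by apply: Rdiv_ge0; lra.
rewrite /rX -/q.
have := Rmult_le_compat_l _ _ _ k0 (Rplus_le_compat_r q _ _ d1); lra.
Qed.

Lemma rX_cv0 : cv0 rX.
Proof.
have [_ cx _ _] := descent_conclusion.
apply: cv0_scale; first by have : 0 <= (CL + tXh + hi) / tXh; [apply: Rdiv_ge0; lra | lra].
apply: cv0_add => //; apply: cv0_add.
  by apply: cv0_scale; [exact: cT_ge0 | exact: qD_cv0].
apply: (@cv0_le _ (fun k => RD * gam k)) => [k|]; first lra.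
by apply: cv0_scale; [exact: RD_ge0 | exact: gam_cv0].
Qed.

Lemma DeltaX_bounds nu : 0 <= DeltaX Xset gX g tXh (Db nu) (Xs nu) <= rX nu.
Proof.
split; first exact: maxR_ge0.
apply: maxR_le => [|i]; last by apply: Rle_trans (infnorm_le _) _; exact: Xhat_bound.
by apply: Rle_trans (Xhat_bound nu i0); exact: fnorm_ge0.
Qed.

Lemma DeltaX_cv : Un_cv (fun nu => DeltaX Xset gX g tXh (Db nu) (Xs nu)) 0.
Proof.
apply: cv0_Un_cv; apply: cv0_le rX_cv0 => k.
by rewrite Rminus_0_r; have [h1 h2] := DeltaX_bounds k; rewrite Rabs_pos_eq.
Qed.

Definition dDh nu := fnorm (vsub (Dh nu) (Db nu)).

Definition cD1 := (CL + tDh + hi) / tDh + 1.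
Definition errD nu := (INR I * cT) / tDh * qT nu
  + ((INR I * CL * cT + tDh * cT) / tDh + cT) * qD nu.

Lemma cD1_gt0 : 0 < cD1.
Proof. by have : 0 <= (CL + tDh + hi) / tDh; [apply: Rdiv_ge0; lra | rewrite /cD1; lra]. Qed.

Lemma errD_cv0 : cv0 errD.
Proof.
have [_ _ qT0 _] := descent_conclusion.
have c0 := cT_ge0; have I0 : 0 <= INR I by lra.
have p1 := Rmult_le_pos _ _ I0 c0; have p2 := Rmult_le_pos _ _ (Rmult_le_pos _ _ I0 CL0) c0.
have p3 := Rmult_le_pos _ _ (Rlt_le _ _ HtDh) c0.
apply: cv0_add; apply: cv0_scale; [exact: Rdiv_ge0 | exact: qT0 | | exact: qD_cv0].
by apply: Rplus_le_le_0_compat => //; apply: Rdiv_ge0 => //; lra.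
Qed.

(** The same comparison between [Dh] and [Dt nu i], with the tracking error as additional mismatch.
    It holds for every agent, so one agent with a small step suffices to make [dDh] small. *)
Lemma Dhat_bound nu i : dDh nu <= cD1 * dDt nu i + errD nu.
Proof.
have hX := Xs_in nu i; have hDl := Dl_in nu i.
have [hDt vi'] := Dt_optimality hDl hX.
have [hDh vi] := Dhat_optimality nu.
have := vi_stability HtDh (vi _ hDt) (vi' _ hDh).
set z := if linD i then Dl nu i else Dt nu i.
set rr := vsub (vsub _ _) _; set p := gradF gD (Db nu) (Xs nu).
have er : rr = vadd (vsub (vsub p (vscale (INR I) (Th nu i)))
    (vsub (gD i z (Xs nu i)) (gD i (Dl nu i) (Xs nu i))))
  (vsub (vscale tDh (vsub (Dt nu i) (Db nu))) (vscale (tauD nu i) (vsub (Dt nu i) (Dl nu i)))).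
  by rewrite /rr -/p; vring.
have hz : Dset z /\ fnorm (vsub z (Dl nu i)) <= dDt nu i.
  rewrite /z /dDt; case: (linD i); split=> //; last exact: Rle_refl.
  by rewrite fnorm_subrr; exact: fnorm_ge0.
case: hz => hz1 hz2.
have [h1 _] := HCL hz1 hDl hX hX (HRX _ _) (HRX _ _); rewrite fnorm_subrr Rplus_0_r in h1.
have h2 := Rmult_le_compat_l _ _ _ CL0 hz2.
have h3 := @tracking_error nu i _ _ (Dbar_in nu) (Dbar_dist nu).
rewrite -/(Db nu) fnorm_vsubC -/p in h3.
have h4 := fnorm_tri (Dl nu i) (Dt nu i) (Db nu).
rewrite -/(dDt nu i) (fnorm_vsubC (Dl nu i)) in h4.
have h5 := Dbar_dist nu i; rewrite -/(Db nu) in h5.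
have h4' : fnorm (vsub (Dt nu i) (Db nu)) <= dDt nu i + cT * qD nu by lra.
have h6 := Rmult_le_compat_l _ _ _ (Rlt_le _ _ HtDh) h4'.
have d0 := dDt_ge0 nu i.
have h7 : tauD nu i * dDt nu i <= hi * dDt nu i.
  by apply: Rmult_le_compat_r => //; have := HtD nu i; lra.
have n1 : fnorm rr <= (CL + tDh + hi) * dDt nu i + INR I * cT * qT nu
    + (INR I * CL * cT + tDh * cT) * qD nu.
  rewrite er; apply: Rle_trans (fnorm_add _ _) _.
  have k1 := fnorm_sub (vsub p (vscale (INR I) (Th nu i)))
    (vsub (gD i z (Xs nu i)) (gD i (Dl nu i) (Xs nu i))).
  have k2 := fnorm_sub (vscale tDh (vsub (Dt nu i) (Db nu)))
     (vscale (tauD nu i) (vsub (Dt nu i) (Dl nu i))).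
  rewrite !fnorm_scale -/(dDt nu i) !Rabs_pos_eq in k2; last lra; last first.
    by have := HtD nu i; lra.
  lra.
move=> h8; rewrite /dDh; apply: Rle_trans (fnorm_tri (Dt nu i) _ _) _.
have h9 : fnorm (vsub (Dh nu) (Dt nu i)) <= (CL + tDh + hi) / tDh * dDt nu i
   + (INR I * cT) / tDh * qT nu + (INR I * CL * cT + tDh * cT) / tDh * qD nu.
  apply: (Rmult_le_reg_l tDh) => //; apply: Rle_trans h8 _; apply: Rle_trans n1 _.
  by apply: Req_le; field; lra.
rewrite /cD1 /errD; lra.
Qed.

Lemma dDh_frequently eps : 0 < eps -> frequently (fun k => dDh k < eps).
Proof.
move=> e0 N; have [s _ _ _] := descent_conclusion.
have e2 : 0 < eps / 2 by lra.
have [N1 hN1] := errD_cv0 e2; have c0 := cD1_gt0.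
pose e1 := eps / 2 / cD1; have e10 : 0 < e1 by exact: Rdiv_lt_0_compat.
have e1sq : 0 < e1 ^ 2 by exact: pow_lt.
have [k [hk hs]] := weighted_frequently_small gam0 dDtsq_ge0 Hgam_div s e1sq (maxn N N1).
rewrite geq_max in hk; case/andP: hk => Nk N1k; exists k; split=> //.
have h1 : dDt k i0 < e1.
  have := @sumI_term I (fun i => dDt k i ^ 2) i0 (fun i => pow2_ge_0 _).
  rewrite -/(dDtsq k) => h; apply: Rnot_le_lt => c.
  have : e1 ^ 2 <= dDt k i0 ^ 2 by apply: pow_incr; lra.
  lra.
have := Dhat_bound k i0; have := hN1 k N1k.
have : cD1 * dDt k i0 < eps / 2.
  have -> : eps / 2 = cD1 * e1 by rewrite /e1; field; lra.
  exact: Rmult_lt_compat_l.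
lra.
Qed.

Lemma DeltaD_bounds nu : 0 <= DeltaD Dset gD G tDh (Db nu) (Xs nu) <= dDh nu.
Proof. by split; [exact: maxR_ge0 | exact: infnorm_le]. Qed.

Lemma DeltaD_liminf : is_liminf (fun nu => DeltaD Dset gD G tDh (Db nu) (Xs nu)) 0.
Proof.
split=> eps e0.
  by exists 0%nat => k _; case: (DeltaD_bounds k); lra.
move=> N; have [k [Nk hk]] := dDh_frequently e0 N; exists k; split=> //.
by case: (DeltaD_bounds k); lra.
Qed.

(** * Stationarity of limit points *)

Lemma gradF_dist D D' (X X' : forall i, Mat K (n i)) s : Dset D -> Dset D' ->
  (forall i, Xset i (X i) /\ fnorm (X i) <= RX) ->
  (forall i, Xset i (X' i) /\ fnorm (X' i) <= RX) ->
  (\big[Rplus/0]_(i < I) fnorm (vsub (X i) (X' i)) <= s) ->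
  fnorm (vsub (gradF gD D X) (gradF gD D' X')) <= INR I * CL * fnorm (vsub D D') + CL * s.
Proof.
move=> hD hD' hX hX' hs.
have -> : vsub (gradF gD D X) (gradF gD D' X') =
    vsumI (fun i => vsub (gD i D (X i)) (gD i D' (X' i))).
  by apply: vec_ext => t; rewrite /vsub /gradF /vsumI sumI_sub.
apply: Rle_trans (fnorm_sumI _) _.
have h := Rmult_le_compat_l _ _ _ CL0 hs.
apply: Rle_trans _ (Rplus_le_compat_l _ _ _ h).
rewrite Rmult_assoc -sumI_const -sumI_scale -sumI_add; apply: sumI_le => i.
have [h1 h2] := hX i; have [h3 h4] := hX' i.
by have [h5 _] := HCL hD hD' h1 h3 h2 h4; lra.
Qed.

Lemma limit_stationary Ds (Xst : forall i, Mat K (n i)) :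
  (forall eps, 0 < eps -> frequently (fun k => fnorm (vsub (Db k) Ds) < eps /\
     (forall i, fnorm (vsub (Xs k i) (Xst i)) < eps) /\ dDh k < eps)) ->
  stationary Dset Xset gD gX g G Ds Xst.
Proof.
move=> lim.
have hDs : Dset Ds.
  apply: (closed_limit clD) => eps e0; have [k [_ [h _]]] := lim _ e0 0%nat.
  by exists (Db k); split=> //; exact: Dbar_in.
have hXs i : Xset i (Xst i).
  apply: (closed_limit (@clX i)) => eps e0; have [k [_ [_ [h _]]]] := lim _ e0 0%nat.
  by exists (Xs k i); split=> //; exact: Xs_in.
have bXs i : fnorm (Xst i) <= RX.
  apply: Rpos_le => eps e0; have [k [_ [_ [h _]]]] := lim _ e0 0%nat.
  have := fnorm_add (Xs k i) (vsub (Xst i) (Xs k i)); rewrite vadd_subK fnorm_vsubC.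
  by have := h i; have := HRX k i; lra.
have I0 : 0 <= INR I by lra.
have IC := Rmult_le_pos _ _ I0 CL0.
do 2!split=> //; split.
- move=> D hD; apply: Rle_ge.
  apply: (vi_limit oO cO HG DO hDs) => eps e0.
  have den : 0 < 2 + 2 * (INR I * CL) + tDh by lra.
  (* The denominator leaves room for the distance from [Dh k] to [Ds], the change of the total
     gradient and the proximal term. *)
  pose e := eps / (2 + 2 * (INR I * CL) + tDh).
  have ep : 0 < e by exact: Rdiv_lt_0_compat.
  have ee : eps = 2 * e + 2 * (INR I * CL) * e + tDh * e by rewrite /e; field; lra.
  have ICe : 0 <= INR I * CL * e by apply: Rmult_le_pos; lra.
  have te : 0 <= tDh * e by apply: Rmult_le_pos; lra.
  have [k [_ [h1 [h2 h3]]]] := lim _ ep 0%nat.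
  have [hDh vi] := Dhat_optimality k.
  exists (Dh k), (vadd (gradF gD (Db k) (Xs k)) (vscale tDh (vsub (Dh k) (Db k)))).
  split; first by have := fnorm_tri (Db k) (Dh k) Ds; rewrite -/(dDh k); lra.
  split; last exact: vi.
  have -> : vsub (vadd (gradF gD (Db k) (Xs k)) (vscale tDh (vsub (Dh k) (Db k)))) (gradF gD Ds Xst)
    = vadd (vsub (gradF gD (Db k) (Xs k)) (gradF gD Ds Xst)) (vscale tDh (vsub (Dh k) (Db k))).
    by vring.
  apply: Rle_trans (fnorm_add _ _) _; rewrite fnorm_scale Rabs_pos_eq; last lra.
  have hs : \big[Rplus/0]_(i < I) fnorm (vsub (Xs k i) (Xst i)) <= INR I * e.
    by rewrite -sumI_const; apply: sumI_le => i; exact: Rlt_le.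
  have := @gradF_dist (Db k) Ds (Xs k) Xst _ (Dbar_in k) hDs
    (fun i => conj (Xs_in k i) (HRX k i)) (fun i => conj (hXs i) (bXs i)) hs.
  have := Rmult_le_compat_l _ _ _ IC (Rlt_le _ _ h1).
  have := Rmult_le_compat_l _ _ _ (Rlt_le _ _ HtDh) (Rlt_le _ _ h3).
  rewrite /dDh; lra.
- move=> i X hX; apply: Rle_ge.
  apply: (vi_limit (@oOi i) (@cOi i) (convex_g (i:=i)) (@XO i) (hXs i)) => eps e0.
  have den : 0 < 2 + 2 * CL + tXh by lra.
  pose e := eps / (2 + 2 * CL + tXh).
  have ep : 0 < e by exact: Rdiv_lt_0_compat.
  have ee : eps = 2 * e + 2 * CL * e + tXh * e by rewrite /e; field; lra.
  have Ce : 0 <= CL * e by apply: Rmult_le_pos; lra.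
  have te : 0 <= tXh * e by apply: Rmult_le_pos; lra.
  have [N hN] := rX_cv0 ep.
  have [k [Nk [h1 [h2 _]]]] := lim _ ep N.
  have h3 := Rle_lt_trans _ _ _ (Xhat_bound k i) (hN k Nk).
  have [hXh vi] := Xhat_optimality k i; have h4 := h2 i.
  exists (Xh k i), (vadd (gX i (Db k) (Xs k i)) (vscale tXh (vsub (Xh k i) (Xs k i)))).
  split; first by have := fnorm_tri (Xs k i) (Xh k i) (Xst i); lra.
  split; last exact: vi.
  have -> : vsub (vadd (gX i (Db k) (Xs k i)) (vscale tXh (vsub (Xh k i) (Xs k i)))) (gX i Ds (Xst i))
    = vadd (vsub (gX i (Db k) (Xs k i)) (gX i Ds (Xst i))) (vscale tXh (vsub (Xh k i) (Xs k i))).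
    by vring.
  apply: Rle_trans (fnorm_add _ _) _; rewrite fnorm_scale Rabs_pos_eq; last lra.
  have [_ h5] := HCL (Dbar_in k) hDs (Xs_in k i) (hXs i) (HRX k i) (bXs i).
  have h6 : fnorm (vsub (Db k) Ds) + fnorm (vsub (Xs k i) (Xst i)) <= 2 * e by lra.
  have := Rmult_le_compat_l _ _ _ CL0 h6.
  have := Rmult_le_compat_l _ _ _ (Rlt_le _ _ HtXh) (Rlt_le _ _ h3).
  rewrite -/(Db k) in h5; lra.
Qed.

Lemma stationary_limit_point : exists Ds (Xst : forall i, Mat K (n i)),
  is_limit_point Db Xs Ds Xst /\ stationary Dset Xset gD gX g G Ds Xst.
Proof.
(* The blocks have different sizes; gathering them with D in one vector over a dependent sum makes
   all of them cluster along the same times. *)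
pose TT := ('I_M * 'I_K + {i : 'I_I & 'I_K * 'I_(n i)})%type.
pose u k : vec TT := fun t => match t with
  | inl a => Db k a | inr s => Xs k (tag s) (tagged s) end.
pose prD (z : vec TT) : Mat M K := fun a => z (inl a).
pose tg i (b : 'I_K * 'I_(n i)) : TT := inr (Tagged (fun i => ('I_K * 'I_(n i))%type) b).
pose prX (z : vec TT) i : Mat K (n i) := fun b => z (tg i b).
have leD (z : vec TT) : fnorm (prD z) <= INR #|{: 'I_M * 'I_K}| * fnorm z.
  by apply: fnorm_le_coord => t; exact: (coord_le z (inl t)).
have leX (z : vec TT) i : fnorm (prX z i) <= INR #|{: 'I_K * 'I_(n i)}| * fnorm z.
  by apply: fnorm_le_coord => t; exact: (coord_le z (tg i t)).
have [C hC] := iterates_bounded.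
have bu k : fnorm (u k) <= INR #|{: TT}| * C.
  have [h1 h2] := hC k; apply: fnorm_le_coord => -[a|[i b]].
    by apply: Rle_trans h1; exact: (coord_le (Db k) a).
  by apply: Rle_trans (h2 i); exact: (coord_le (Xs k i) b).
(* The side condition selects times at which [dDh] is small, so that the optimality of [Dh] passes
   to the limit. *)
have [||z hz] := @vec_cluster _ u _ (fun eps k => dDh k < eps) _ bu.
- by move=> e1 e2 k; lra.
- exact: dDh_frequently.
have [c [c0 hc]] : exists c, 0 <= c /\ forall i, INR #|{: 'I_K * 'I_(n i)}| <= c.
  apply: (@fin_bound 'I_I (fun i c => INR #|{: 'I_K * 'I_(n i)}| <= c)).
    by move=> i a b ab; lra.
  by move=> i; exists (INR #|{: 'I_K * 'I_(n i)}|); lra.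
have lim eps : 0 < eps -> frequently (fun k => fnorm (vsub (Db k) (prD z)) < eps /\
   (forall i, fnorm (vsub (Xs k i) (prX z i)) < eps) /\ dDh k < eps).
  move=> e0 N; pose b := INR #|{: 'I_M * 'I_K}|; have b0 : 0 <= b by exact: pos_INR.
  pose e := eps / (b + c + 1); have den : 0 < b + c + 1 by lra.
  have ep : 0 < e by exact: Rdiv_lt_0_compat.
  have ee : eps = b * e + c * e + e by rewrite /e; field; lra.
  have be : 0 <= b * e by apply: Rmult_le_pos; lra.
  have ce : 0 <= c * e by apply: Rmult_le_pos; lra.
  have [k [Nk [h1 h2]]] := hz _ ep N; exists k; split=> //.
  split; last split; last lra.
    have := leD (vsub (u k) z); have -> : prD (vsub (u k) z) = vsub (Db k) (prD z) by [].
    by rewrite -/b; have := Rmult_le_compat_l _ _ _ b0 (Rlt_le _ _ h2); lra.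
  move=> i; have := leX (vsub (u k) z) i.
  have -> : prX (vsub (u k) z) i = vsub (Xs k i) (prX z i) by [].
  have := Rmult_le_compat_r _ _ _ (fnorm_ge0 (vsub (u k) z)) (hc i).
  have := Rmult_le_compat_l _ _ _ c0 (Rlt_le _ _ h2); lra.
exists (prD z), (prX z); split; last exact: limit_stationary.
by move=> eps e0 N; have [k [Nk [h1 [h2 _]]]] := lim _ e0 N; exists k.
Qed.

(** [vi_stability] between consecutive times. Only first powers appear, so summing over a window
    requires control of the length of the X-path. *)
Lemma Dhat_move nu : Rabs (dDh nu.+1 - dDh nu) <=
  ((INR I * CL) / tDh + 2) * (cT * qD nu + gam nu * RD) + CL / tDh * dXsum nu.
Proof.
have [h1 vi1] := Dhat_optimality nu.+1; have [h2 vi2] := Dhat_optimality nu.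
have := vi_stability HtDh (vi1 _ h2) (vi2 _ h1).
set p := gradF gD (Db nu) (Xs nu); set p' := gradF gD (Db nu.+1) (Xs nu.+1).
set rr := vsub (vsub _ _) _.
have er : rr = vsub (vsub p' p) (vscale tDh (vsub (Db nu.+1) (Db nu))).
  by rewrite /rr -/p -/p'; vring.
set q := cT * qD nu + gam nu * RD.
have hDb : fnorm (vsub (Db nu.+1) (Db nu)) <= q by exact: Dbar_move.
have hp : fnorm (vsub p' p) <= INR I * CL * fnorm (vsub (Db nu.+1) (Db nu)) + CL * dXsum nu.
  apply: gradF_dist; [exact: Dbar_in | exact: Dbar_in | | | exact: Rle_refl].
  - by move=> i; split; [exact: Xs_in | exact: HRX].
  - by move=> i; split; [exact: Xs_in | exact: HRX].
have I0 : 0 <= INR I * CL by apply: Rmult_le_pos; lra.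
have h3 := Rmult_le_compat_l _ _ _ I0 hDb.
have h4 := Rmult_le_compat_l _ _ _ (Rlt_le _ _ HtDh) hDb.
move=> h5.
have h6 : fnorm (vsub (Dh nu.+1) (Dh nu)) <= ((INR I * CL) / tDh + 1) * q + CL / tDh * dXsum nu.
  apply: (Rmult_le_reg_l tDh) => //; apply: Rle_trans h5 _.
  have -> : tDh * (((INR I * CL) / tDh + 1) * q + CL / tDh * dXsum nu) =
    INR I * CL * q + tDh * q + CL * dXsum nu by field; lra.
  rewrite er; apply: Rle_trans (fnorm_sub _ _) _; rewrite fnorm_scale Rabs_pos_eq; lra.
have t1 : dDh nu.+1 <= fnorm (vsub (Dh nu.+1) (Dh nu)) + dDh nu + q.
  have := fnorm_tri (Dh nu) (Dh nu.+1) (Db nu.+1).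
  have := fnorm_tri (Db nu) (Dh nu) (Db nu.+1).
  by rewrite /dDh (fnorm_vsubC (Db nu) (Db nu.+1)); lra.
have t2 : dDh nu <= fnorm (vsub (Dh nu.+1) (Dh nu)) + dDh nu.+1 + q.
  have := fnorm_tri (Dh nu.+1) (Dh nu) (Db nu).
  have := fnorm_tri (Db nu.+1) (Dh nu.+1) (Db nu).
  by rewrite /dDh (fnorm_vsubC (Dh nu) (Dh nu.+1)); lra.
by apply: Rabs_le; lra.
Qed.

Lemma U_move nu i : fnorm (vsub (U nu.+1 i) (U nu i)) <=
  gam nu.+1 * RD + cT * qD nu + 2 * (gam nu * RD).
Proof.
apply: Rle_trans (fnorm_tri (Dl nu.+1 i) _ _) _.
have := fnorm_tri (Dl nu i) (Dl nu.+1 i) (U nu i); rewrite (fnorm_vsubC (Dl nu i)).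
by have := U_Dl nu.+1 i; have := U_Dl nu i; have := Dl_move nu i; lra.
Qed.

(** * Full convergence under strong convexity of every [g i] *)

Section StronglyConvex.
Hypothesis HmuS : forall i, 0 < mu i /\ strongly_convex_on (mu i) (Oi i) (g i).
Hypothesis HT2 : forall i, exists c N0, (forall j, c < mu j) /\
  forall nu, (N0 <= nu)%nat -> Rabs (tauX (S nu) i - tauX nu i) <= c.

(** [prox_contraction_base] with [Xs nu.+1 i] as both center and reference point: its inner product
    with the center vanishes. The optimality of the previous step supplies [b], whose proximal term
    brings in [tauX nu i * dX nu i]. *)
Lemma dX_step nu i : (1 <= nu)%nat ->
  (mu i + tauX nu.+1 i) * dX nu.+1 i <=
  tauX nu i * dX nu i + CL * fnorm (vsub (U nu.+1 i) (U nu i)).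
Proof.
move=> nu1; have [m0 sg] := HmuS i; have m0' : 0 <= mu i by lra.
have hU := U_Dset nu i; have hU' := U_Dset nu.+1 i.
have X0 := Xs_in nu i; have X1 := Xs_in nu.+1 i; have X2 := Xs_in nu.+2 i.
have [_ vi1] := Xs_optimality hU X0 m0' sg; have [_ vi2] := Xs_optimality hU' X1 m0' sg.
set b := vadd _ _ in vi1.
have vi1' := vi1 _ X2.
have := @prox_contraction_base _ _ _ _ _ _ _ _ b 0 (vi2 _ X1).
rewrite Rmult_0_l Rplus_0_r Rplus_0_r => /(_ vi1').
set w := vsub (Xs nu.+2 i) (Xs nu.+1 i).
have -> : inner (vsub (Xs nu.+1 i) (Xs nu.+1 i)) w = 0.
  by rewrite /inner big1 // => t _; rewrite /vsub; ring.
rewrite /dX -/w; have w0 : 0 <= fnorm w by exact: fnorm_ge0.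
set d := vsub (Xs nu.+1 i) (Xs nu i) in b vi1 vi1' *.
have tp := proj2 (Htau_pos nu i); have d0 := fnorm_ge0 d.
set uu := fnorm (vsub (U nu.+1 i) (U nu i)); have u0 : 0 <= uu by exact: fnorm_ge0.
have cross z : Xset i z -> fnorm z <= RX ->
    - inner (vsub (gX i (U nu.+1 i) z) (gX i (U nu i) z)) w <= CL * uu * fnorm w.
  move=> hz hz'; have [_ h] := HCL hU' hU hz hz hz' hz'.
  rewrite fnorm_subrr Rplus_0_r -/uu in h.
  have := cauchy_schwarz_abs (vsub (gX i (U nu.+1 i) z) (gX i (U nu i) z)) w.
  have := Rmult_le_compat_r _ _ _ w0 h.
  have := Rle_abs (- inner (vsub (gX i (U nu.+1 i) z) (gX i (U nu i) z)) w).
  by rewrite Rabs_Ropp; lra.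
move=> h; case: (Rle_lt_or_eq_dec _ _ w0) => [wp|<-]; last first.
  by rewrite Rmult_0_r; apply: Rplus_le_le_0_compat; apply: Rmult_le_pos; lra.
apply: (Rmult_le_reg_r (fnorm w)) => //.
suff : - inner (vsub (gX i (U nu.+1 i) (if linX i then Xs nu.+1 i else Xs nu.+2 i)) b) w <=
  tauX nu i * fnorm d * fnorm w + CL * uu * fnorm w by lra.
rewrite /b; case: (linX i).
  have h1 := @gX_nonexpansive nu i (Xs nu i) (Xs nu.+1 i) (Xs nu.+2 i) nu1 X0 X1 X2.
  rewrite -/w (fnorm_vsubC (Xs nu i)) -/d in h1.
  have ed : vsub (Xs nu i) (Xs nu.+1 i) = vscale (-1) d by rewrite /d; vring.
  rewrite ed inner_scalel in h1.
  have h2 := cross _ X1 (HRX _ _); move: h1 h2.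
  rewrite !(inner_subl (gX _ _ _)) (inner_addl (gX _ _ _)) (inner_scalel (tauX nu i)).
  by move=> h1 h2; move: h1; split_Rabs; lra.
have hO := DO hU.
have h1 := convex_grad_monotone (convex_X hO) (XO X2) (XO X1)
  (has_grad_X hO (XO X2)) (has_grad_X hO (XO X1)).
rewrite -/w in h1; have h2 := cross _ X2 (HRX _ _).
have h3 := Rmult_le_compat_l _ _ _ (Rlt_le _ _ tp) (cauchy_schwarz d w).
move: h1 h2; rewrite !(inner_subl (gX _ _ _)) (inner_addl (gX _ _ _)) (inner_scalel (tauX nu i)).
lra.
Qed.

Lemma dX_contraction i : exists r C N, 0 <= r < 1 /\ 0 <= C /\ forall nu, (N <= nu)%nat ->
  dX nu.+1 i <= r * dX nu i + C * fnorm (vsub (U nu.+1 i) (U nu i)).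
Proof.
have [m0 _] := HmuS i; have [c [N0 [hc hN]]] := HT2 i.
have c0 : 0 <= c by apply: Rle_trans (hN N0 (leqnn _)); exact: Rabs_pos.
have cm := hc i.
(* By (T2), [tauX nu i <= tauX nu.+1 i + c]; since [c < mu i], the ratio of [t + c] to [t + mu i]
   increases with [t], so [t = hi] is the worst case. [N0.+1] ensures time at least 1. *)
exists ((hi + c) / (hi + mu i)), (CL / mu i), N0.+1; split.
  split; first by apply: Rdiv_ge0; lra.
  by apply: (Rmult_lt_reg_r (hi + mu i)); [lra | field_simplify; lra].
split; first exact: Rdiv_ge0.
move=> nu Nnu; have nu1 : (1 <= nu)%nat by apply: leq_trans Nnu.
have hs := dX_step i nu1; have hN' := hN nu (ltnW Nnu).
have t1 := HtX nu.+1 i; have t0 := proj2 (Htau_pos nu.+1 i).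
have t2 : tauX nu i <= tauX nu.+1 i + c.
  by have := Rle_abs (- (tauX nu.+1 i - tauX nu i)); rewrite Rabs_Ropp; lra.
have d0 := dX_ge0 nu i; have u0 := fnorm_ge0 (vsub (U nu.+1 i) (U nu i)).
apply: (Rmult_le_reg_l (mu i + tauX nu.+1 i)); first lra.
apply: Rle_trans hs _; rewrite Rmult_plus_distr_l; apply: Rplus_le_compat.
  rewrite -Rmult_assoc; apply: Rmult_le_compat_r => //; apply: Rle_trans t2 _.
  apply: (Rmult_le_reg_r (hi + mu i)); first lra.
  have -> : (mu i + tauX nu.+1 i) * ((hi + c) / (hi + mu i)) * (hi + mu i) =
    (mu i + tauX nu.+1 i) * (hi + c) by field; lra.
  have : 0 <= (hi - tauX nu.+1 i) * (mu i - c) by apply: Rmult_le_pos; lra.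
  lra.
rewrite -Rmult_assoc; apply: Rmult_le_compat_r => //.
have -> : CL = mu i * (CL / mu i) by field; lra.
have -> : mu i * (CL / mu i) / mu i = CL / mu i by field; lra.
by apply: Rmult_le_compat_r; [exact: Rdiv_ge0 | lra].
Qed.

Lemma qD_window m l : (1 - rho) * psum (fun k => qD (m + k)%nat) l <=
  qD m + RD * psum (fun k => gam (m + k)%nat) l.
Proof.
rewrite -(psum_scale RD).
have := @recursion_psum rho (fun k => qD (m + k)%nat) (fun k => RD * gam (m + k)%nat) l rho01.
rewrite addn0; apply.
- by move=> k; exact: qD_ge0.
- by move=> k; rewrite Rmult_comm.
- move=> k; rewrite addnS.
  have -> : qD (m + k).+1 = rho * qD (m + k)%nat + gam (m + k)%nat * RD by [].
  lra.
Qed.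

(* Subtracting the contribution of [gam nu] from [dX nu] removes the step size
   [gam nu.+1] from its recursion, so that sums over a window involve only step
   sizes of that window. *)
Lemma dX_window_i i : exists a, forall m, a <= INR m -> forall l,
  psum (fun k => dX (m + k)%nat i) l <=
  a * (dX m i + qD m + psum (fun k => gam (m + k)%nat) l).
Proof.
have [r [C [N [hr [C0 hC]]]]] := dX_contraction i.
have r0 := RD_ge0; have c0 := cT_ge0.
pose y k := Rmax 0 (dX k i - C * RD * gam k).
have CR : 0 <= C * RD by exact: Rmult_le_pos.
have y0 k : 0 <= y k by exact: Rmax_l.
have ydX k : y k <= dX k i.
  apply: Rmax_lub; first exact: dX_ge0.
  by have := Rmult_le_pos _ _ CR (gam0 k); lra.
have dXy k : dX k i <= y k + C * RD * gam k.
  by have := Rmax_r 0 (dX k i - C * RD * gam k); rewrite -/(y k); lra.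
pose C' := C * (cT + 3 * RD).
have C'0 : 0 <= C' by apply: Rmult_le_pos => //; lra.
have yrec k : (N <= k)%nat -> y k.+1 <= r * y k + C' * (qD k + gam k).
  move=> Nk; have qk := qD_ge0 k; have gk := gam0 k; have yk := y0 k.
  have b0 : 0 <= r * y k + C' * (qD k + gam k).
    by apply: Rplus_le_le_0_compat; apply: Rmult_le_pos => //; lra.
  apply: Rmax_lub => //.
  have h1 := hC k Nk; have h2 := Rmult_le_compat_l _ _ _ C0 (U_move k i).
  have hr0 : 0 <= r by lra.
  have h3 := Rmult_le_compat_l _ _ _ hr0 (dXy k).
  have h4 : r * (C * RD * gam k) <= 1 * (C * RD * gam k).
    by apply: Rmult_le_compat_r; [exact: Rmult_le_pos | lra].
  have p1 := Rmult_le_pos _ _ (Rmult_le_pos _ _ C0 c0) gk.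
  have p2 := Rmult_le_pos _ _ CR qk.
  rewrite /C'; lra.
pose i1 := / (1 - r); have i10 : 0 < i1 by apply: Rinv_0_lt_compat; lra.
pose i2 := / (1 - rho); have i20 : 0 < i2 by apply: Rinv_0_lt_compat; case: rho01; lra.
pose K1 := i1 + i1 * C' * i2 + i1 * C' * i2 * RD + i1 * C' + C * RD.
have q1 : 0 <= i1 * C' by apply: Rmult_le_pos; lra.
have q2 : 0 <= i1 * C' * i2 by apply: Rmult_le_pos; lra.
have q3 : 0 <= i1 * C' * i2 * RD by apply: Rmult_le_pos; lra.
have K10 : 0 <= K1 by rewrite /K1; lra.
(* One number serves as factor and as starting time, so that [fin_bound] makes both uniform over the
   agents at once. *)
exists (Rmax K1 (INR N)) => m hm l.
have Nm : (N <= m)%nat.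
  by apply/leP; apply: INR_le; apply: Rle_trans hm; exact: Rmax_r.
set Gm := psum (fun k => gam (m + k)%nat) l; set Qm := psum (fun k => qD (m + k)%nat) l.
have G0 : 0 <= Gm by apply: psum_ge0.
have hQ : Qm <= i2 * (qD m + RD * Gm).
  apply: (Rmult_le_reg_l (1 - rho)); first by case: rho01; lra.
  rewrite -Rmult_assoc Rinv_r ?Rmult_1_l; last by case: rho01; lra.
  exact: qD_window.
have hY : psum (fun k => y (m + k)%nat) l <= i1 * (y m + C' * (Qm + Gm)).
  apply: (Rmult_le_reg_l (1 - r)); first lra.
  rewrite -Rmult_assoc Rinv_r ?Rmult_1_l; last lra.
  have := @recursion_psum r (fun k => y (m + k)%nat)
    (fun k => C' * (qD (m + k)%nat + gam (m + k)%nat)) l hr.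
  rewrite addn0 psum_scale psum_add -/Qm -/Gm; apply=> k //.
    by apply: Rmult_le_pos => //; have := qD_ge0 (m + k); have := gam0 (m + k); lra.
  by rewrite addnS; apply: yrec; apply: leq_trans Nm _; exact: leq_addr.
have hX : psum (fun k => dX (m + k)%nat i) l <= psum (fun k => y (m + k)%nat) l + C * RD * Gm.
  by rewrite -psum_scale -psum_add; apply: psum_le.
have dm := dX_ge0 m i; have qm := qD_ge0 m; have ym := ydX m.
apply: (Rle_trans _ (K1 * (dX m i + qD m + Gm))); last first.
  by apply: Rmult_le_compat_r; [lra | exact: Rmax_l].
have s1 := Rmult_le_compat_l _ _ _ (Rlt_le _ _ i10) ym.
have s2 := Rmult_le_compat_l _ _ _ q1 hQ.
have e1 := Rmult_le_pos _ _ (Rlt_le _ _ i10) qm; have e2 := Rmult_le_pos _ _ (Rlt_le _ _ i10) G0.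
have e3 := Rmult_le_pos _ _ q2 dm; have e4 := Rmult_le_pos _ _ q2 G0.
have e5 := Rmult_le_pos _ _ q3 dm; have e6 := Rmult_le_pos _ _ q3 qm.
have e7 := Rmult_le_pos _ _ q1 dm; have e8 := Rmult_le_pos _ _ q1 qm.
have e9 := Rmult_le_pos _ _ CR dm; have e10 := Rmult_le_pos _ _ CR qm.
rewrite /K1; lra.
Qed.

Lemma dXsum_window : exists a, 0 <= a /\ forall m, a <= INR m -> forall l,
  psum (fun k => dXsum (m + k)%nat) l <=
  a * (dXsum m + INR I * qD m + INR I * psum (fun k => gam (m + k)%nat) l).
Proof.
have [|a [a0 ha]] := @fin_bound 'I_I (fun i a => forall m, a <= INR m -> forall l,
  psum (fun k => dX (m + k)%nat i) l <=
  a * (dX m i + qD m + psum (fun k => gam (m + k)%nat) l)) _ dX_window_i.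
  move=> i a b ab h m hm l; apply: Rle_trans (h m (Rle_trans _ _ _ ab hm) l) _.
  apply: Rmult_le_compat_r => //; have := dX_ge0 m i; have := qD_ge0 m.
  have : 0 <= psum (fun k => gam (m + k)%nat) l by exact: psum_ge0.
  lra.
exists a; split=> // m hm l; rewrite /dXsum psum_sumI.
rewrite -!sumI_const -!sumI_add -sumI_scale; apply: sumI_le => i; exact: ha.
Qed.

(** Summing [Dhat_move] over a window bounds the variation of [dDh] by [h m], which vanishes, plus
    [Cg] times the [gam]-length: the hypothesis of [crossing_cv0]. The sequences are shifted by [N],
    from which on [dXsum_window] applies. *)
Lemma dDh_cv0 : cv0 dDh.
Proof.
have [s cx _ _] := descent_conclusion.
have [a [a0 ha]] := dXsum_window; have [N hN] := INR_unbounded a.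
have r0 := RD_ge0; have c0 := cT_ge0; have I0 : 0 <= INR I by lra.
pose k1 := (INR I * CL) / tDh + 2; pose k2 := CL / tDh.
have k10 : 0 <= k1.
  by apply: Rplus_le_le_0_compat; [apply: Rdiv_ge0 => //; exact: Rmult_le_pos | lra].
have k20 : 0 <= k2 by exact: Rdiv_ge0.
pose i2 := / (1 - rho); have i20 : 0 < i2 by apply: Rinv_0_lt_compat; case: rho01; lra.
pose h m := k1 * cT * i2 * qD m + k2 * a * (dXsum m + INR I * qD m).
pose Cg := k1 * cT * i2 * RD + k1 * RD + k2 * a * INR I + 1.
have p1 : 0 <= k1 * cT * i2 by apply: Rmult_le_pos; [exact: Rmult_le_pos | lra].
have p2 : 0 <= k2 * a by exact: Rmult_le_pos.
have p3 := Rmult_le_pos _ _ p1 r0; have p4 := Rmult_le_pos _ _ p2 I0.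
have p5 := Rmult_le_pos _ _ k10 r0.
have hvar m l : a <= INR m -> psum (fun k => Rabs (dDh (m + k).+1 - dDh (m + k)%nat)) l <=
    h m + Cg * psum (fun k => gam (m + k)%nat) l.
  move=> hm; set Gm := psum (fun k => gam (m + k)%nat) l.
  have G0 : 0 <= Gm by exact: psum_ge0.
  apply: (Rle_trans _ (psum (fun k => k1 * (cT * qD (m + k)%nat + RD * gam (m + k)%nat)
     + k2 * dXsum (m + k)%nat) l)).
    by apply: psum_le => k; have := Dhat_move (m + k); rewrite -/k1 -/k2 (Rmult_comm RD).
  rewrite psum_add !psum_scale psum_add !psum_scale -/Gm.
  have hQ : psum (fun k => qD (m + k)%nat) l <= i2 * (qD m + RD * Gm).
    apply: (Rmult_le_reg_l (1 - rho)); first by case: rho01; lra.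
    rewrite -Rmult_assoc Rinv_r ?Rmult_1_l; last by case: rho01; lra.
    exact: qD_window.
  have s1 := Rmult_le_compat_l _ _ _ (Rmult_le_pos _ _ k10 c0) hQ.
  have s2 := Rmult_le_compat_l _ _ _ k20 (ha m hm l); rewrite -/Gm in s2.
  rewrite /h /Cg; lra.
have Cg0 : 0 < Cg by rewrite /Cg; lra.
have hh : cv0 h.
  apply: cv0_add; first by apply: cv0_scale => //; exact: qD_cv0.
  by apply: cv0_scale => //; apply: cv0_add => //; apply: cv0_scale => //; exact: qD_cv0.
have sw : summable (fun k => gam k * dDt k i0 ^ 2).
  apply: summable_le s => k; apply: Rmult_le_compat_l => //.
  exact: (@sumI_term I (fun i => dDt k i ^ 2) i0 (fun i => pow2_ge_0 _)).
apply: (@cv0_drop N).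
apply: (@crossing_cv0 (fun k => dDh (N + k)%nat) (fun k => gam (N + k)%nat)
  (fun k => dDt (N + k)%nat i0) (fun k => h (N + k)%nat) (fun k => errD (N + k)%nat) Cg cD1).
- by move=> k; exact: gam0.
- exact: (cv0_add_index N gam_cv0).
- exact: (cv0_add_index N hh).
- exact: (cv0_add_index N errD_cv0).
- by move=> k; exact: dDt_ge0.
- exact: Cg0.
- exact: cD1_gt0.
- move=> m l.
  have hm : a <= INR (N + m).
    by apply: Rle_trans (Rlt_le _ _ hN) _; apply: INR_leq; exact: leq_addr.
  apply: Rle_trans _ (Rle_trans _ _ _ (hvar (N + m)%nat l hm) _); apply: Req_le.
    by elim: l => [|l IH] //; rewrite !psumS IH addnS addnA.
  by congr (_ + _ * _); elim: l => [|l IH] //; rewrite !psumS IH addnA.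
- apply: (@summable_shift N (fun k => gam k * dDt k i0 ^ 2)) => // k.
  by apply: Rmult_le_pos => //; exact: pow2_ge_0.
- by move=> k; exact: Dhat_bound.
- move=> eps e0 N1; have [k [hk h1]] := dDh_frequently e0 (N + N1)%nat.
  have Nk : (N <= k)%nat by apply: leq_trans hk; exact: leq_addr.
  by exists (k - N)%nat; rewrite leq_subRL // subnKC.
Qed.

Lemma Delta_cv : Un_cv (fun nu => Rmax (DeltaD Dset gD G tDh (Db nu) (Xs nu))
                                       (DeltaX Xset gX g tXh (Db nu) (Xs nu))) 0.
Proof.
apply: cv0_Un_cv; apply: cv0_le (cv0_add dDh_cv0 rX_cv0) => k.
have [h1 h2] := DeltaD_bounds k; have [h3 h4] := DeltaX_bounds k.
rewrite Rminus_0_r Rabs_pos_eq; last by apply: Rle_trans h1 (Rmax_l _ _).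
by apply: Rmax_lub; lra.
Qed.

Lemma limit_point_stationary Ds (Xst : forall i, Mat K (n i)) :
  is_limit_point Db Xs Ds Xst -> stationary Dset Xset gD gX g G Ds Xst.
Proof.
move=> lp; apply: limit_stationary => eps e0 N.
have [N1 hN1] := dDh_cv0 e0; have [k [hk [h1 h2]]] := lp _ e0 (maxn N N1).
move: hk; rewrite geq_max => /andP[Nk N1k]; exists k; split=> //; split=> //; split=> //.
exact: hN1.
Qed.

End StronglyConvex.

End BoundedIterates.

Lemma uniform_constants : exists RX CL lo hi,
  [/\ forall nu i, fnorm (Xs nu i) <= RX, 0 <= CL, 0 < lo,
      forall i, gradients_lipschitz i RX CL &
      forall nu i, lo <= tauD nu i <= hi /\ tauX nu i <= hi].
Proof.
have [|RX [RX0 hRX]] := @fin_bound 'I_I (fun i C => forall nu, fnorm (Xs nu i) <= C) _ Xs_bounded_i.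
  by move=> i a b ab h nu; apply: Rle_trans (h nu) ab.
have [||CL [CL0 hCL]] := @fin_bound 'I_I (fun i C => gradients_lipschitz i RX C).
- move=> i a b ab h D X D' X' h1 h2 h3 h4 h5 h6; have [k1 k2] := h D X D' X' h1 h2 h3 h4 h5 h6.
  set v := fnorm (vsub D D') + _ in k1 k2 *; have p : a * v <= b * v.
    by apply: Rmult_le_compat_r => //; apply: Rplus_le_le_0_compat; exact: fnorm_ge0.
  by split; [exact: Rle_trans k1 p | exact: Rle_trans k2 p].
- by move=> i; have [C [_ hC]] := joint_lipschitz i RX; exists C.
have [||hi [_ hhi]] := @fin_bound 'I_I (fun i C => forall nu, tauD nu i <= C /\ tauX nu i <= C).
- by move=> i a b ab h nu; have := h nu; lra.
- move=> i; have [l1 [h1 [_ hh1]]] := HT1D i; have [h2 hh2] := HT1X i; exists (Rmax h1 h2) => nu.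
  split; last exact: Rle_trans (hh2 nu) (Rmax_r _ _).
  by apply: Rle_trans _ (Rmax_l _ _); case: (hh1 nu).
(* [fin_bound] yields upper bounds, so the lower bound on [tauD] is obtained through its inverse. *)
have [||b [b0 hb]] := @fin_bound 'I_I (fun i b => 0 < b /\ forall nu, / b <= tauD nu i).
- move=> i a c ac [a0 h]; split; [lra | move=> nu; apply: Rle_trans (h nu)].
  exact: Rinv_le_contravar.
- move=> i; have [l1 [h1 [l10 hh1]]] := HT1D i; exists (/ l1).
  by split=> [|nu]; [exact: Rinv_0_lt_compat | rewrite Rinv_inv; case: (hh1 nu)].
exists RX, CL, (/ b), hi; split=> //.
- by apply: Rinv_0_lt_compat; case: (hb i0).
- move=> nu i; have [_ h1] := hb i; have [h2 h3] := hhi i nu.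
  by split=> //; split.
Qed.

Lemma d4l_convergence :
  let Db := fun nu => Dbar (Dl nu) in
  let DeltaDn := fun nu => DeltaD Dset gD G tDh (Db nu) (Xs nu) in
  let DeltaXn := fun nu => DeltaX Xset gX g tXh (Db nu) (Xs nu) in
  Un_cv (fun nu => cons_err (Dl nu)) 0 /\
  (exists C, forall nu, fnorm (Db nu) <= C /\ forall i, fnorm (Xs nu i) <= C) /\
  (exists l, Un_cv (fun nu => Uobj f g G (Db nu) (Xs nu)) l) /\
  Un_cv DeltaXn 0 /\
  is_liminf DeltaDn 0 /\
  (exists Ds (Xst : forall i, Mat K (n i)),
     is_limit_point Db Xs Ds Xst /\ stationary Dset Xset gD gX g G Ds Xst) /\
  ((forall i, 0 < mu i /\ strongly_convex_on (mu i) (Oi i) (g i)) ->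
   (forall i, exists c N0, (forall j, c < mu j) /\
        forall nu, (N0 <= nu)%nat -> Rabs (tauX (S nu) i - tauX nu i) <= c) ->
   Un_cv (fun nu => Rmax (DeltaDn nu) (DeltaXn nu)) 0 /\
   forall Ds (Xst : forall i, Mat K (n i)),
     is_limit_point Db Xs Ds Xst -> stationary Dset Xset gD gX g G Ds Xst).
Proof.
have [RX [CL [lo [hi [hRX CL0 lo0 hCL htau]]]]] := uniform_constants.
have htD nu i : lo <= tauD nu i <= hi by case: (htau nu i).
have htX nu i : tauX nu i <= hi by case: (htau nu i).
split; first exact: @cons_err_cv.
split; first exact: iterates_bounded hRX.
split; first exact: objective_cv hRX CL0 hCL lo0 htD.
split; first exact: DeltaX_cv hRX CL0 hCL lo0 htD htX.
split; first exact: DeltaD_liminf hRX CL0 hCL lo0 htD.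
split; first exact: stationary_limit_point hRX CL0 hCL lo0 htD htX.
move=> hmu hT2; split; first exact: Delta_cv hRX CL0 hCL lo0 htD htX hmu hT2.
exact: limit_point_stationary hRX CL0 hCL lo0 htD htX hmu hT2.
Qed.

End D4L.

Theorem theorem1
  (* dimensions: I agents, D is M x K, X_i is K x n_i *)
  (I M K : nat) (n : 'I_I -> nat)
  (HI : (0 < I)%nat) (HM : (0 < M)%nat) (HK : (0 < K)%nat)
  (Hn : forall i, (0 < n i)%nat)
  (* problem data *)
  (Dset Oset : Mat M K -> Prop)
  (Xset Oi : forall i : 'I_I, Mat K (n i) -> Prop)
  (f : forall i : 'I_I, Mat M K -> Mat K (n i) -> R)
  (gD : forall i : 'I_I, Mat M K -> Mat K (n i) -> Mat M K)   (* grad_D f_i *)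
  (gX : forall i : 'I_I, Mat M K -> Mat K (n i) -> Mat K (n i)) (* grad_{X_i} f_i *)
  (L : 'I_I -> Mat M K -> R)                                   (* L_{grad X_i} *)
  (g : forall i : 'I_I, Mat K (n i) -> R) (G : Mat M K -> R) (mu : 'I_I -> R)
  (* (A1) *)
  (HO : is_open Oset /\ convex_set Oset /\ subset_of Dset Oset)
  (HOi : forall i, is_open (Oi i) /\ convex_set (Oi i) /\ subset_of (Xset i) (Oi i))
  (Hf_C2 : forall i,
     C2_on (fun z => Oset (fstv z) /\ Oi i (sndv z))
           (fun z => f i (fstv z) (sndv z))
           (fun z => pairv (gD i (fstv z) (sndv z)) (gX i (fstv z) (sndv z))))
  (Hf_lb : forall i, exists c, forall D X, Oset D -> Oi i X -> c <= f i D X)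
  (Hf_bicvx : forall i,
     (forall X, Oi i X -> convex_on Oset (fun D => f i D X)) /\
     (forall D, Oset D -> convex_on (Oi i) (f i D)))
  (* (A2) *)
  (HLip : forall i D, Dset D -> forall X X', Xset i X -> Xset i X' ->
     fnorm (vsub (gX i D X) (gX i D X')) <= L i D * fnorm (vsub X X'))
  (HLcont : forall i, cont_on_rel Dset (L i))
  (* (A3) *)
  (HD : nonempty Dset /\ is_compact Dset /\ convex_set Dset)
  (HX : forall i, nonempty (Xset i) /\ is_closed (Xset i) /\ convex_set (Xset i))
  (* (A4) *)
  (HG : convex_on Oset G)
  (* (A5) *)
  (Hg : forall i,
     (is_compact (Xset i) /\ convex_on (Oi i) (g i)) \/
     (0 < mu i /\ strongly_convex_on (mu i) (Oi i) (g i)))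
  (* network: E nu j i = link j -> i at time nu; weights A nu i j = a^nu_{ij} *)
  (E : nat -> 'I_I -> 'I_I -> bool) (A : nat -> 'I_I -> 'I_I -> R) (kappa : R)
  (HB : exists B : nat, (0 < B)%nat /\ forall k : nat,
     strongly_connected
       (fun j i => exists t : nat, (k * B <= t <= (k + 1) * B - 1)%nat /\ E t j i))
  (Hkappa : 0 < kappa)
  (HAdiag : forall nu i, kappa <= A nu i i)
  (HAoff : forall nu (i j : 'I_I), j <> i ->
     (E nu j i -> kappa <= A nu i j) /\ (~~ E nu j i -> A nu i j = 0))
  (HAcol : forall nu j, \big[Rplus/0%R]_(i < I) A nu i j = 1)
  (* algorithm parameters *)
  (linD linX : 'I_I -> bool)           (* choice of surrogate for each agent *)
  (tauD tauX : nat -> 'I_I -> R) (gamma : nat -> R)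
  (* (S) *)
  (Htau_pos : forall nu i, 0 < tauD nu i /\ 0 < tauX nu i)
  (* (T1) *)
  (HT1D : forall i, exists lo hi, 0 < lo /\ forall nu, lo <= tauD nu i <= hi)
  (HT1X : forall i, exists hi, forall nu, tauX nu i <= hi)
  (* iterates of D^4L *)
  (Dl Dt U Th : nat -> 'I_I -> Mat M K) (Xs : nat -> forall i : 'I_I, Mat K (n i))
  (phi : nat -> 'I_I -> R)
  (HT1eps : exists eps, 0 < eps /\ forall i nu, (1 <= nu)%nat ->
     tauX nu i >= L i (U nu i) / 2 + eps)
  (* step sizes *)
  (Hgamma : forall nu, 0 < gamma nu <= 1)
  (Hgamma_div : cv_infty (fun N => sum_f_R0 gamma N))
  (Hgamma_sq : exists l, Un_cv (fun N => sum_f_R0 (fun k => gamma k ^ 2) N) l)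
  (* initialization *)
  (Hinit : forall i, phi 0%nat i = 1 /\ Dset (Dl 0%nat i) /\ Xset i (Xs 0%nat i) /\
     Th 0%nat i = gD i (Dl 0%nat i) (Xs 0%nat i))
  (* updates; N_i^in[nu] = {j | (j,i) in E^nu} u {i} *)
  (HDt : forall nu i, Dt nu i =
     argmin_on Dset (fun D =>
       surrogate (linD i) (fun D' => f i D' (Xs nu i)) (gD i (Dl nu i) (Xs nu i))
                 (tauD nu i) (Dl nu i) D
       + inner (vsub (vscale (INR I) (Th nu i)) (gD i (Dl nu i) (Xs nu i)))
               (vsub D (Dl nu i))
       + G D))
  (HU : forall nu i, U nu i = vadd (Dl nu i) (vscale (gamma nu) (vsub (Dt nu i) (Dl nu i))))
  (HXs : forall nu i, Xs (S nu) i =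
     argmin_on (Xset i) (fun X =>
       surrogate (linX i) (fun X' => f i (U nu i) X') (gX i (U nu i) (Xs nu i))
                 (tauX nu i) (Xs nu i) X
       + g i X))
  (Hphi : forall nu i, phi (S nu) i =
     \big[Rplus/0%R]_(j < I | (j == i) || E nu j i) (A nu i j * phi nu j))
  (HDl : forall nu i, Dl (S nu) i =
     vscale (/ phi (S nu) i)
       (vsumI_if (fun j => (j == i) || E nu j i)
                 (fun j => vscale (A nu i j * phi nu j) (U nu j))))
  (HTh : forall nu i, Th (S nu) i =
     vadd (vscale (/ phi (S nu) i)
             (vsumI_if (fun j => (j == i) || E nu j i)
                       (fun j => vscale (A nu i j * phi nu j) (Th nu j))))
          (vscale (/ phi (S nu) i)
             (vsub (gD i (Dl (S nu) i) (Xs (S nu) i)) (gD i (Dl nu i) (Xs nu i)))))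
  (* constants of the merit functions *)
  (tDh tXh : R) (HtDh : 0 < tDh) (HtXh : 0 < tXh) :
  let Db := fun nu => Dbar (Dl nu) in
  let DeltaDn := fun nu => DeltaD Dset gD G tDh (Db nu) (Xs nu) in
  let DeltaXn := fun nu => DeltaX Xset gX g tXh (Db nu) (Xs nu) in
  (* (a) consensus *)
  Un_cv (fun nu => cons_err (Dl nu)) 0 /\
  (* (b)(i) boundedness *)
  (exists C, forall nu, fnorm (Db nu) <= C /\ forall i, fnorm (Xs nu i) <= C) /\
  (* (b)(ii) objective values converge to a finite value *)
  (exists l, Un_cv (fun nu => Uobj f g G (Db nu) (Xs nu)) l) /\
  (* (b)(iii) *)
  Un_cv DeltaXn 0 /\
  (* (b)(iv) *)
  is_liminf DeltaDn 0 /\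
  (* (b) consequence: a stationary limit point exists *)
  (exists Ds (Xst : forall i, Mat K (n i)),
     is_limit_point Db Xs Ds Xst /\ stationary Dset Xset gD gX g G Ds Xst) /\
  (* (b') *)
  ((forall i, 0 < mu i /\ strongly_convex_on (mu i) (Oi i) (g i)) ->
   (* (T2), with mu = min_i mu_i *)
   (forall i, exists l, Un_cv (fun N => sum_f_R0
        (fun t => Rabs (tauD (S t) i - tauD t i)) N) l) ->
   (forall i, exists c N0, (forall j, c < mu j) /\
        forall nu, (N0 <= nu)%nat -> Rabs (tauX (S nu) i - tauX nu i) <= c) ->
   Un_cv (fun nu => Rmax (DeltaDn nu) (DeltaXn nu)) 0 /\
   forall Ds (Xst : forall i, Mat K (n i)),
     is_limit_point Db Xs Ds Xst -> stationary Dset Xset gD gX g G Ds Xst).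
Proof.
have [B [HB0 HB1]] := HB; have [epsX [HepsX HT1e]] := HT1eps.
have HT1e' i nu : (1 <= nu)%nat -> L i (U nu i) / 2 + epsX <= tauX nu i.
  by move=> nu1; apply: Rge_le; exact: HT1e.
have Hdiv : cv_infty (psum gamma).
  (* [sum_f_R0 gamma N] has [N + 1] terms, whence the shift by one against [psum]. *)
  move=> C; have [N hN] := Hgamma_div C; exists N.+1 => -[|k] /leP // hk.
  by rewrite -psum_sum_f_R0; apply: hN; apply/leP.
have Hsq : summable (fun k => gamma k ^ 2).
  apply: sum_f_R0_cv_summable Hgamma_sq => k; exact: pow2_ge_0.
have [h1 [h2 [h3 [h4 [h5 [h6 h7]]]]]] := d4l_convergence HI HO HOi Hf_C2 Hf_lb Hf_bicvx HLip
  HD HX HG Hg HB0 HB1 Hkappa HAdiag HAoff HAcol Htau_pos HT1D HT1X HepsX HT1e' Hgamma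
  Hdiv Hsq Hinit HDt HU HXs Hphi HDl HTh HtDh HtXh.
do 6!split=> //.
by move=> hmu _ hT2; exact: h7 hmu hT2.
Qed.
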